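(* The following is, up to isomorphism of FDGs, the complete list of periodic FDGs $(G,\alpha)$ with $\lambda(\alpha)=\frac12$ (every FDG in the list has this property, and every periodic FDG with $\lambda(\alpha)=\frac12$ is isomorphic to one in the list), together with the information whether they are $\lambda$-maximal: 1. $\mathbb{Z}/2\mathbb{Z}$ with the identity. It is $\lambda$-maximal. 2. $\mathbb{Z}/4\mathbb{Z}$ with multiplication by $3$. It is $\lambda$-maximal. 3. $\mathbb{Z}/2\mathbb{Z}\times\mathbb{Z}/4\mathbb{Z}=\langle v_1,v_2\mid v_1^2=v_2^4=1,[v_1,v_2]=1\rangle$ with the automorphism sending $v_1\mapsto v_1v_2^2$ and $v_2\mapsto v_1v_2$. It is $\lambda$-maximal. 4. $(\mathbb{Z}/2\mathbb{Z})^2$ with the automorphism given by the companion matrix of $(X-1)^2\in\mathbb{F}_2[X]$. It is not $\lambda$-maximal. 5. $(\mathbb{Z}/2\mathbb{Z})^3$ with the automorphism given by the companion matrix of $(X-1)^3\in\mathbb{F}_2[X]$. It is not $\lambda$-maximal. 6. $(\mathbb{Z}/2\mathbb{Z})^2\times\mathbb{Z}/3\mathbb{Z}$ with the product of the automorphism of $(\mathbb{Z}/2\mathbb{Z})^2$ given by the companion matrix of $X^2+X+1\in\mathbb{F}_2[X]$ with multiplication by $2$ on $\mathbb{Z}/3\mathbb{Z}$. It is $\lambda$-maximal. 7. For $n\geq 3$ and $m\in\{0,\ldots,n-1\}$ such that $m\equiv1\pmod p$ for every prime divisor $p$ of $n$, and $m\equiv1\pmod 4$ if $4\mid n$: $\mathrm{D}_{2n}=\langle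 r,x\mid r^n=x^2=1,xrx^{-1}=r^{-1}\rangle$ with the automorphism sending $r\mapsto r^m$, $x\mapsto xr$. They are all $\lambda$-maximal, and for each $n$, any two such FDGs arising from different choices of $m$ are nonisomorphic. 8. For even $n\geq4$ and $m\in\{0,\ldots,n-1\}$ such that $m\equiv1\pmod p$ for every prime divisor $p$ of $n$, and $m\equiv1\pmod4$ if $4\mid n$: $\mathrm{Dic}_{2n}=\langle r,x\mid r^n=1,x^2=r^{n/2},xrx^{-1}=r^{-1}\rangle$ with the automorphism sending $r\mapsto r^m$, $x\mapsto xr$. They are all $\lambda$-maximal, and for each $n$, any two such FDGs arising from different choices of $m$ are nonisomorphic. 9. For odd $o\geq3$ and $m\in\{0,\ldots,o-1\}$ such that $m\equiv1\pmod p$ for every prime divisor $p$ of $o$: $\mathrm{D}((\mathbb{Z}/2\mathbb{Z})^2\times\mathbb{Z}/o\mathbb{Z})=\langle r_1,r_2,r,x\mid r_1^2=r_2^2=r^o=[r_1,r_2]=[r_1,r]=[r_2,r]=1,\ x^2=1,\ [r_1,x]=[r_2,x]=1,\ xrx^{-1}=r^{-1}\rangle$ with the automorphism sending $r_1\mapsto r_2$, $r_2\mapsto r_1$, $r\mapsto r^m$, $x\mapsto xr_1r$. They are all $\lambda$-maximal, and for each $o$, any two such FDGs arising from different choices of $m$ are nonisomorphic. 10. For odd $o\geq3$ and $m\in\{0,\ldots,o-1\}$ such that $m\equiv1\pmod p$ for every prime divisor $p$ of $o$: $\mathrm{Dic}((\mathbb{Z}/2\mathbb{Z})^2\times\mathbb{Z}/o\mathbb{Z})=\langle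 r_1,r_2,r,x\mid r_1^2=r_2^2=r^o=[r_1,r_2]=[r_1,r]=[r_2,r]=1,\ x^2=r_1r_2,\ [r_1,x]=[r_2,x]=1,\ xrx^{-1}=r^{-1}\rangle$ with the automorphism sending $r_1\mapsto r_2$, $r_2\mapsto r_1$, $r\mapsto r^m$, $x\mapsto xr_1r$. They are all $\lambda$-maximal, and for each $o$, any two such FDGs arising from different choices of $m$ are nonisomorphic.
   Context: For a permutation $\psi$ of a finite set $X$, $\Lambda(\psi)$ denotes the largest length of a cycle of $\psi$ (fixed points count as cycles of length $1$), and $\lambda(\psi):=\frac{1}{|X|}\Lambda(\psi)$. For a finite group $G$, $\lambda(G):=\max_{\alpha\in\mathrm{Aut}(G)}\lambda(\alpha)$. A finite dynamical group (FDG) is a pair $(G,\varphi)$ with $G$ a finite group and $\varphi$ an endomorphism of $G$; it is periodic if $\varphi$ is an automorphism. A periodic FDG $(G,\alpha)$ is $\lambda$-maximal if $\lambda(\alpha)=\lambda(G)$. An isomorphism $(G,\varphi)\to(H,\psi)$ of FDGs is a group isomorphism $f:G\to H$ with $f\circ\varphi=\psi\circ f$. The companion matrix of $X^n+a_{n-1}X^{n-1}+\cdots+a_0$ is the $n\times n$ matrix with $1$'s on the subdiagonal, last column $(-a_0,\ldots,-a_{n-1})^t$ and zeros elsewhere; it acts on $(\mathbb{Z}/p\mathbb{Z})^n=\mathbb{F}_p^n$ with respect to the standard basis. *)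

(* Defs.v *)
From HB Require Import structures.
From mathcomp Require Import all_boot all_order all_algebra all_fingroup.
Set Implicit Arguments.
Unset Strict Implicit.
Unset Printing Implicit Defensive.

Import GroupScope.
Import Order.TTheory GRing.Theory Num.Theory.

(* Only used when f is a permutation of T: then the f-orbit of x is the cycle
   of f through x, and [fingraph.order f x] is the length of that cycle. *)
Definition Lambda (T : finType) (f : T -> T) : nat := \max_(x : T) fingraph.order f x.

Definition lambda (T : finType) (f : T -> T) : rat :=
  ((Lambda f)%:R / #|T|%:R)%R.

(* The default value 0 is harmless: the range is nonempty, and lambda is
   nonnegative. *)
Definition lambda_group (gT : finGroupType) : rat :=
  \big[Num.max/0%R]_(a in Aut [set: gT]) lambda a.

Record fdg := FDG {
  fdg_group :> finGroupType;
  fdg_endo : {morphism [set: fdg_group] >-> fdg_group}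
}.

Definition periodic (X : fdg) : Prop := bijective (fdg_endo X).

Definition fdg_lambda (X : fdg) : rat := lambda (fdg_endo X).

Definition lambda_maximal (X : fdg) : Prop := fdg_lambda X = lambda_group X.

Definition fdg_iso (X Y : fdg) : Prop :=
  exists2 f : {morphism [set: X] >-> Y},
    isom [set: X] [set: Y] f & forall x : X, f (fdg_endo X x) = fdg_endo Y (f x).

(* The transpose of the library's [companionmx], which is adapted to row
   vectors; p is meant to be monic of degree n. *)
Definition companion (R : nzRingType) (n : nat) (p : {poly R}) : 'M[R]_n :=
  (\matrix_(i < n, j < n)
     if (j == n.-1 :> nat) then - p`_i else (i == j.+1 :> nat)%:R)%R.

Definition id_fdg (gT : finGroupType) : fdg := @FDG gT (idm [set: gT]).

Lemma mulz_morph (n k : nat) :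
  {in [set: 'Z_n] &, {morph (fun x : 'Z_n => (k%:R * x)%R) : x y / x * y}}.
Proof. by move=> x y _ _; apply: mulrDr. Qed.

Definition mulz_fdg (n k : nat) : fdg := @FDG 'Z_n (Morphism (@mulz_morph n k)).

Lemma mulcol_morph (p n : nat) (A : 'M['F_p]_n) :
  {in [set: 'cV['F_p]_n] &, {morph (fun v : 'cV_n => A *m v)%R : v w / v * w}}.
Proof. by move=> v w _ _; apply: mulmxDr. Qed.

Definition matrix_fdg (p n : nat) (A : 'M['F_p]_n) : fdg :=
  @FDG 'cV['F_p]_n (Morphism (mulcol_morph A)).

Lemma prod_morph (X Y : fdg) :
  {in [set: (X * Y)%type] &, {morph (fun z : (X * Y)%type => (fdg_endo X z.1, fdg_endo Y z.2))
     : z t / z * t}}.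
Proof. by move=> [x y] [x' y'] _ _; rewrite /= !morphM ?inE. Qed.

Definition prod_fdg (X Y : fdg) : fdg :=
  @FDG (X * Y)%type (Morphism (@prod_morph X Y)).

(* [presents rel s]: gT is the group presented by the generators s subject to
   the relations rel, i.e. s generates gT and satisfies rel, and every family
   satisfying rel in a group is the image of s under a homomorphism. As for the
   library's [Grp], which does not give access to the generators, only finite
   target groups are considered; this loses nothing here, because the presented
   groups below are all finite. *)
Definition presents (rel : forall hT : finGroupType, seq hT -> Prop)
    (gT : finGroupType) (s : seq gT) : Prop :=
  [/\ <<[set:: s]>> = [set: gT], rel gT s &
      forall (hT : finGroupType) (t : seq hT), rel hT t ->
        exists f : {morphism [set: gT] >-> hT}, [seq f y | y <- s] = t].

Definition Z2xZ4_rel (hT : finGroupType) (s : seq hT) : Prop :=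
  if s is [:: v1; v2] then [/\ v1 ^+ 2 = 1, v2 ^+ 4 = 1 & [~ v1, v2] = 1]
  else False.

Definition dihedral_rel (n : nat) (hT : finGroupType) (s : seq hT) : Prop :=
  if s is [:: r; x] then [/\ r ^+ n = 1, x ^+ 2 = 1 & x * r * x^-1 = r^-1]
  else False.

Definition dicyclic_rel (n : nat) (hT : finGroupType) (s : seq hT) : Prop :=
  if s is [:: r; x]
  then [/\ r ^+ n = 1, x ^+ 2 = r ^+ (n %/ 2) & x * r * x^-1 = r^-1]
  else False.

Definition Z22xZo_rel (o : nat) (hT : finGroupType) (r1 r2 r : hT) : Prop :=
  [/\ r1 ^+ 2 = 1, r2 ^+ 2 = 1 & r ^+ o = 1] /\
  [/\ [~ r1, r2] = 1, [~ r1, r] = 1 & [~ r2, r] = 1].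

Definition gen_dihedral_rel (o : nat) (hT : finGroupType) (s : seq hT) : Prop :=
  if s is [:: r1; r2; r; x]
  then Z22xZo_rel o r1 r2 r /\
       [/\ x ^+ 2 = 1, [~ r1, x] = 1, [~ r2, x] = 1 & x * r * x^-1 = r^-1]
  else False.

Definition gen_dicyclic_rel (o : nat) (hT : finGroupType) (s : seq hT) : Prop :=
  if s is [:: r1; r2; r; x]
  then Z22xZo_rel o r1 r2 r /\
       [/\ x ^+ 2 = r1 * r2, [~ r1, x] = 1, [~ r2, x] = 1 & x * r * x^-1 = r^-1]
  else False.

(* An FDG given by a presentation and the images of the generators is
   described up to isomorphism, by a predicate on FDGs. *)

Definition is_Z2xZ4_fdg (X : fdg) : Prop :=
  exists v1 v2 : X,
    [/\ presents Z2xZ4_rel [:: v1; v2],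
        fdg_endo X v1 = v1 * v2 ^+ 2 & fdg_endo X v2 = v1 * v2].

Definition is_dihedral_fdg (n m : nat) (X : fdg) : Prop :=
  exists r x : X,
    [/\ presents (dihedral_rel n) [:: r; x],
        fdg_endo X r = r ^+ m & fdg_endo X x = x * r].

Definition is_dicyclic_fdg (n m : nat) (X : fdg) : Prop :=
  exists r x : X,
    [/\ presents (dicyclic_rel n) [:: r; x],
        fdg_endo X r = r ^+ m & fdg_endo X x = x * r].

Definition is_gen_dihedral_fdg (o m : nat) (X : fdg) : Prop :=
  exists r1 r2 r x : X,
    presents (gen_dihedral_rel o) [:: r1; r2; r; x] /\
    [/\ fdg_endo X r1 = r2, fdg_endo X r2 = r1,
        fdg_endo X r = r ^+ m & fdg_endo X x = x * r1 * r].

Definition is_gen_dicyclic_fdg (o m : nat) (X : fdg) : Prop :=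
  exists r1 r2 r x : X,
    presents (gen_dicyclic_rel o) [:: r1; r2; r; x] /\
    [/\ fdg_endo X r1 = r2, fdg_endo X r2 = r1,
        fdg_endo X r = r ^+ m & fdg_endo X x = x * r1 * r].

Definition one_mod_primes (n m : nat) : Prop :=
  forall p : nat, prime p -> p %| n -> m = 1%N %[mod p].

Definition dihedral_param (n m : nat) : Prop :=
  [/\ 3 <= n, m < n, one_mod_primes n m & 4 %| n -> m = 1%N %[mod 4]].

Definition dicyclic_param (n m : nat) : Prop :=
  [/\ ~~ odd n /\ 4 <= n, m < n, one_mod_primes n m & 4 %| n -> m = 1%N %[mod 4]].

Definition odd_param (o m : nat) : Prop :=
  [/\ odd o /\ 3 <= o, m < o & one_mod_primes o m].

(* Existence, lambda-maximality, and pairwise nonisomorphism for equal n, of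
   the members of a family of FDGs indexed by the (n, m) satisfying param. *)
Definition family_maximal_noniso (param : nat -> nat -> Prop)
    (is_member : nat -> nat -> fdg -> Prop) : Prop :=
  [/\ forall n m, param n m -> exists X, is_member n m X,
      forall n m X, param n m -> is_member n m X -> lambda_maximal X
    & forall n m m' X Y, param n m -> param n m' -> m <> m' ->
        is_member n m X -> is_member n m' Y -> ~ fdg_iso X Y].

Definition fdg1 : fdg := id_fdg 'Z_2.

Definition fdg2 : fdg := mulz_fdg 4 3.

Definition fdg4 : fdg := matrix_fdg (companion 2 (('X - 1) ^+ 2 : {poly 'F_2})%R).

Definition fdg5 : fdg := matrix_fdg (companion 3 (('X - 1) ^+ 3 : {poly 'F_2})%R).

Definition fdg6 : fdg :=
  prod_fdg (matrix_fdg (companion 2 ('X^2 + 'X + 1 : {poly 'F_2})%R))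
           (mulz_fdg 3 2).

(* Main.v *)
(* Let [O] be the cycle through [x] of an automorphism [f] of [G], with
   [2 |O| >= |G| > 2]. As [O] and [O^-1] both avoid [1], they meet, so a power of [f]
   inverts every element of [O].

   If [G] is nonabelian, then [O] lies in a coset [x A] of a proper subgroup [A]. By
   induction through [G / 'Z(G)] it suffices to treat the groups of class 2 and those
   with trivial centre. In the latter, let [M] be a minimal invariant normal subgroup:
   if [M] is abelian, then [A = 'C(M)]; if [M] is perfect, then some automorphism
   inverts at least half of [M], so a quarter of the pairs of elements of [M] commute,
   which is too much. If [G] is abelian and [f] has a nontrivial fixed point, the image
   of [y |-> y^-1 f(y)] can serve as [A].

   Then [A] has index 2 and [O = x A = G \ A]. The power of [f] inverting [O] shows that
   [A] is abelian and inverted by [x]. That a single cycle fills a coset bounds the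
   [p]-torsion of [A] by [p], or by 4 if [p = 2]. Hence [A] is cyclic, or a
   Klein four-group times a cyclic group of odd order; the conditions on [m] are those
   of Hull and Dobell for the iterates of [c |-> 1 + m c] to be transitive.

   In the remaining case the Sylow components of [x] have cycles of coprime lengths,
   and as a power of [f] inverts [G], only [(Z/2)^2 x Z/3] survives. *)

(* The length hypothesis is kept as the inequality [#|G| <= #|O|.*2]. It passes to the quotients
   used in the induction. It also applies to a cycle longer than half, where for nonabelian groups
   it is contradictory, so that the maximality of all nonabelian families comes out of the
   classification itself. The recurring difficulty is that the inverting power [f^i] is known only
   on [O]. On a subgroup [M] it is determined just at those [m] with [x m] in [O], which is at least
   half of [M]. If [M] is abelian and proper, the agreement spreads to [M]: [f^i] sends [m] to
   [y m^-1 y^-1] for every [y] in [O], so all these [y] act alike on [M] and differ by elements of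
   'C(M). The torsion bound is about unipotent maps. An affine map with linear part [g] has period
   dividing [p] where [(g - 1)^2 = 0] ([p] odd), and dividing 4 where [(g - 1)^3 = 0] ([p = 2]), so
   a filled coset of such a kernel is small. In the fixed-point-free case, the part of a Sylow
   component left over by the cycle turns out to be a subgroup, and comparing orders gives
   [2^k = p^t + 1] and a companion equation. *)
Require Import Defs.
From HB Require Import structures.
From mathcomp Require Import all_boot all_order all_algebra all_fingroup all_solvable.
From mathcomp Require Import zify.

Set Implicit Arguments.
Unset Strict Implicit.
Unset Printing Implicit Defensive.

Import GroupScope.

(* The cardinal of a set of group elements occurs with several convertible but
   syntactically distinct finType instances, which [lia] takes for different
   atoms. *)
Ltac clia :=
  intros;
  let abstract_card T A :=
    let n := fresh "n" in
    pose (n := @card.body T A);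
    repeat match goal with
    | H : context[@card.body ?U ?B] |- _ =>
        unify A B; change (@card.body U B) with n in H
    | |- context[@card.body ?U ?B] =>
        unify A B; change (@card.body U B) with n
    end;
    clearbody n
  in
  repeat match goal with
  | H : context[@card.body ?T ?A] |- _ => abstract_card T A
  | |- context[@card.body ?T ?A] => abstract_card T A
  end; lia.

(** * Cycles of a group automorphism *)

Section MorphismFunctions.

Variables (gT hT : finGroupType) (h : gT -> hT).
Hypothesis hM : {morph h : y z / y * z}.

Lemma endo1 : h 1 = 1.
Proof. by apply: (mulgI (h 1)); rewrite -hM !mulg1. Qed.

Lemma endoV y : h y^-1 = (h y)^-1.
Proof. by apply: (mulgI (h y)); rewrite -hM !mulgV endo1. Qed.

Lemma endoX y k : h (y ^+ k) = h y ^+ k.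
Proof. by elim: k => [|k IHk]; rewrite ?expg0 ?endo1 // !expgS hM IHk. Qed.

End MorphismFunctions.

Section Cycle.

Variables (gT : finGroupType) (f : gT -> gT).
Hypotheses (fM : {morph f : y z / y * z}) (fI : injective f).

Definition cyc (x : gT) : {set gT} := [set y | fconnect f x y].

(** One inclusion is enough to ask for: an injective map of a finite set into itself is onto, which
    gives [stableV]. *)
Definition stable (H : {set gT}) : Prop := {in H, forall y, f y \in H}.

Lemma iter_endoM i : {morph iter i f : y z / y * z}.
Proof. by move=> y z; elim: i => //= i ->; rewrite fM. Qed.

Lemma iter_endo_inj i : injective (iter i f).
Proof. by elim: i => // i IHi y z /= /fI/IHi. Qed.

Lemma iter_endoC i j y : iter i f (iter j f y) = iter j f (iter i f y).
Proof. by rewrite -!iterD addnC. Qed.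

Lemma stable_iter H i y : stable H -> y \in H -> iter i f y \in H.
Proof. by move=> sH Hy; elim: i => //= i /sH. Qed.

Lemma cyc_refl x : x \in cyc x.
Proof. by rewrite inE connect0. Qed.

Lemma mem_cyc x i : iter i f x \in cyc x.
Proof. by rewrite inE fconnect_iter. Qed.

Lemma cycP x y : reflect (exists i, y = iter i f x) (y \in cyc x).
Proof.
apply: (iffP idP) => [|[i ->]]; last exact: mem_cyc.
by rewrite inE => /iter_findex <-; exists (findex f x y).
Qed.

Lemma cyc_stable x : stable (cyc x).
Proof. by move=> _ /cycP[i ->]; exact: (mem_cyc x i.+1). Qed.

Lemma cyc_sub x H : stable H -> x \in H -> cyc x \subset H.
Proof. by move=> sH Hx; apply/subsetP=> _ /cycP[i ->]; exact: stable_iter. Qed.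

Lemma cyc_sym x y : (y \in cyc x) = (x \in cyc y).
Proof. by rewrite !inE fconnect_sym. Qed.

Lemma cyc_eq x y : y \in cyc x -> cyc y = cyc x.
Proof.
rewrite inE => xy; apply/setP=> z; rewrite !inE.
by rewrite (same_connect (fconnect_sym fI) xy).
Qed.

Lemma card_cyc x : #|cyc x| = fingraph.order f x.
Proof. by rewrite cardsE. Qed.

Lemma iter_card_cyc x : iter #|cyc x| f x = x.
Proof. by rewrite card_cyc iter_order. Qed.

Lemma iter_eq_dvdn x i : (iter i f x == x) = (#|cyc x| %| i).
Proof.
have e0 k : iter (k * #|cyc x|) f x = x.
  by elim: k => //= k IHk; rewrite mulSn iterD IHk iter_card_cyc.
rewrite {1}(divn_eq i #|cyc x|) addnC iterD e0 /dvdn.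
have ltr : i %% #|cyc x| < #|cyc x|.
  by rewrite ltn_mod card_cyc fingraph.order_gt0.
apply/eqP/eqP=> [eqx | -> //].
have := @findex_iter _ f x (i %% #|cyc x|).
by rewrite -card_cyc eqx findex0 => /(_ ltr).
Qed.

Lemma card_cyc_iterI x i : 0 < i -> iter i f x = x -> #|cyc x| <= i.
Proof. by move=> i0 /eqP; rewrite iter_eq_dvdn => /(dvdn_leq i0). Qed.

Lemma card_cycV x : #|cyc x^-1| = #|cyc x|.
Proof.
suff le y : #|cyc y^-1| <= #|cyc y|.
  by apply/eqP; rewrite eqn_leq le -{1}[x]invgK le.
apply: card_cyc_iterI; first by rewrite card_cyc fingraph.order_gt0.
have iV i : iter i f y^-1 = (iter i f y)^-1 by elim: i => //= i ->; rewrite (endoV fM).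
by rewrite iV iter_card_cyc.
Qed.

Lemma cyc1 : cyc 1 = [set 1].
Proof.
apply/setP=> y; rewrite in_set1; apply/cycP/eqP=> [[i ->]|->]; last by exists 0.
by elim: i => //= i ->; rewrite (endo1 fM).
Qed.

Lemma stableV H y : stable H -> f y \in H -> y \in H.
Proof.
move=> sH fy; have /eqP fH : f @: H == H.
  rewrite eqEcard card_imset // leqnn andbT.
  by apply/subsetP=> _ /imsetP[z Hz ->]; apply: sH.
by move: fy; rewrite -{1}fH => /imsetP[z Hz /fI->].
Qed.

Lemma stable_iterV H i y : stable H -> iter i f y \in H -> y \in H.
Proof. by move=> sH; elim: i => //= i IHi /(stableV sH)/IHi. Qed.

Lemma gen_stable (H : {set gT}) : (forall y, y \in H -> f y \in <<H>>) -> stable <<H>>.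
Proof.
move=> sH; pose K := [set y | f y \in <<H>>].
have gK : group_set K.
  apply/group_setP; split=> [|y z]; first by rewrite inE (endo1 fM) group1.
  by rewrite !inE fM => Ky Kz; rewrite groupM.
have : <<H>> \subset Group gK.
  by rewrite gen_subG; apply/subsetP=> y Hy; rewrite inE sH.
by move/subsetP=> sHK y /sHK; rewrite inE.
Qed.

Lemma stable_gen (H : {set gT}) : stable H -> stable <<H>>.
Proof. by move=> sH; apply: gen_stable => y /sH; apply: mem_gen. Qed.

Lemma center_stable : stable 'Z([set: gT]).
Proof.
move=> z; rewrite !inE /= => /centP cz; apply/centP=> t _.
have [h _ fh] := injF_bij fI; rewrite -(fh t).
by have := cz (h t) (in_setT _); rewrite /commute -!fM => ->.
Qed.

(** The power of [f] carrying [y] to [z] maps [y M] injectively into [z M]. Hence the cycle meets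
    equally often all the cosets of [M] that it meets. *)
Lemma card_cyc_lcoset x (M : {group gT}) y z : stable M ->
  y \in cyc x -> z \in cyc x -> #|cyc x :&: y *: M| <= #|cyc x :&: z *: M|.
Proof.
move=> sM Oy Oz; have /cycP[j zE]: z \in cyc y by rewrite (cyc_eq Oy).
rewrite -(card_imset (mem (cyc x :&: y *: M)) (@iter_endo_inj j)).
apply: subset_leq_card; apply/subsetP=> _ /imsetP[t /setIP[Ot /lcosetP[m Mm tE]] ->].
rewrite inE (stable_iter _ (@cyc_stable x) Ot) tE iter_endoM -zE.
by rewrite mem_lcoset mulKg stable_iter.
Qed.

Lemma card_cyc_le x (M : {group gT}) : stable M ->
  #|cyc x| <= (#|[set y *: M | y in cyc x]| * #|cyc x :&: x *: M|)%N.
Proof.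
move=> sM; rewrite -sum1_card (partition_big_imset (fun y => y *: M)) /=.
rewrite -sum_nat_const; apply: leq_sum => _ /imsetP[y Oy ->].
apply: leq_trans (card_cyc_lcoset sM Oy (cyc_refl x)).
rewrite sum1dep_card; apply: subset_leq_card.
by apply/subsetP=> z; rewrite !inE => /andP[-> /eqP <-]; rewrite lcoset_refl.
Qed.

End Cycle.

Arguments cyc_refl {gT f}.

(** * Cycles through at least half of the group *)

Section LongCycle.

Variables (gT : finGroupType) (f : gT -> gT).
Hypotheses (fM : {morph f : y z / y * z}) (fI : injective f).
Variable x : gT.
Hypotheses (gt2 : 2 < #|[set: gT]|) (long : #|[set: gT]| <= #|cyc f x|.*2).

Local Notation O := (cyc f x).

Lemma long_cyc_neq1 : x != 1.
Proof. by apply: contraTneq long => ->; rewrite cyc1 // cards1 -ltnNge. Qed.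

Lemma long_cyc_notin1 : 1 \notin O.
Proof.
rewrite (cyc_sym fI) cyc1 // inE; exact: long_cyc_neq1.
Qed.

Lemma proper_card_half (M : {group gT}) : M != [set: gT] :> {set gT} ->
  #|M|.*2 <= #|[set: gT]|.
Proof.
move=> nM; rewrite -(Lagrange (subsetT M)) -muln2 leq_mul2l.
by rewrite indexg_gt1 subTset nM orbT.
Qed.

(** Such an [M] contains the cycle and also 1, which is outside the cycle, hence more than half of
    the group. *)
Lemma long_stable_full (M : {group gT}) y : stable f M -> y \in O -> y \in M ->
  M = [set: gT] :> {set gT}.
Proof.
move=> sM Oy My; apply/eqP; apply: contraT => nM.
have /subset_leqif_cards : O \subset M by rewrite -(cyc_eq fI Oy) cyc_sub.
case=> _ eqOM; have := proper_card_half nM.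
rewrite leqNgt; case/negP; rewrite ltnNge; apply/negP=> leM.
have /eqP OM : O == M.
  rewrite -eqOM eqn_leq -(leq_double #|M|) (leq_trans leM long) andbT.
  by rewrite -(cyc_eq fI Oy) subset_leq_card // cyc_sub.
by have := long_cyc_notin1; rewrite OM group1.
Qed.

(** The fixed points of [g] form a stable subgroup containing [x]. Identities between endomorphisms
    commuting with [f] can thus be tested at [x] alone. *)
Lemma long_fix_full (g : gT -> gT) : {morph g : y z / y * z} ->
  (forall y, g (f y) = f (g y)) -> g x = x -> forall y, g y = y.
Proof.
move=> gM gC gx y.
have gG : group_set [set t | g t == t].
  apply/group_setP; split=> [|s t]; first by rewrite inE (endo1 gM).
  by rewrite !inE => /eqP gs /eqP gt; rewrite gM gs gt.
have /setP/(_ y) : Group gG = [set: gT] :> {set gT}.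
  apply: (@long_stable_full (Group gG) x); rewrite ?cyc_refl ?inE ?gx //.
  by move=> t; rewrite !inE gC => /eqP->.
by rewrite !inE => /eqP.
Qed.

Lemma long_iter_full i : iter i f x = x -> forall y, iter i f y = y.
Proof.
apply: long_fix_full; first exact: iter_endoM.
by move=> y; rewrite -iterSr.
Qed.

(** The cycle is spread evenly over at most [#|G : M|] cosets, so in each it covers at least
    half. *)
Lemma long_lcoset (M : {group gT}) : stable f M -> #|M| <= #|O :&: x *: M|.*2.
Proof.
move=> sM; have := card_cyc_le fM fI x sM.
have : #|[set y *: M | y in O]| <= #|[set: gT] : M|.
  rewrite -card_lcosets; apply: subset_leq_card.
  by apply/subsetP=> _ /imsetP[y Oy ->]; apply/lcosetsP; exists y; rewrite ?inE.
move: long; rewrite -(Lagrange (subsetT M)).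
set i := #|_ : _|; set k := #|_ :&: _|; set q := #|[set _ | _ in _]|.
have : 0 < i by rewrite indexg_gt0.
nia.
Qed.

(** The inequality is strict because the coset [M] itself is missed: a proper stable subgroup
    contains no point of the cycle. *)
Lemma long_lcoset_proper (M : {group gT}) : stable f M ->
  M != [set: gT] :> {set gT} -> #|M| < #|O :&: x *: M|.*2.
Proof.
move=> sM nM; have := card_cyc_le fM fI x sM.
have : #|[set y *: M | y in O]| < #|[set: gT] : M|.
  rewrite -card_lcosets; apply: proper_card; apply/properP; split.
    by apply/subsetP=> _ /imsetP[y Oy ->]; apply/lcosetsP; exists y; rewrite ?inE.
  exists (1 *: M); first by apply/lcosetsP; exists 1; rewrite ?inE.
  apply/imsetP=> [[y Oy eyM]]; case/eqP: nM.
  apply: (long_stable_full sM Oy).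
  by have := lcoset_refl M y; rewrite -eyM mem_lcoset invg1 mul1g.
move: long; rewrite -(Lagrange (subsetT M)).
set i := #|_ : _|; set k := #|_ :&: _|; set q := #|[set _ | _ in _]|.
move=> leO lt_qi le_qk; rewrite ltnNge; apply/negP=> le_kM.
have : (q * k.*2 <= q * #|M|)%N by rewrite leq_mul2l le_kM orbT.
have : (q.+1 * #|M| <= i * #|M|)%N by rewrite leq_mul2r lt_qi orbT.
by rewrite mulSn; move: leO; rewrite mulnC -!muln2; nia.
Qed.

(** The cycle has at least half of the elements and the coset at most half, so they coincide; the
    coset is not [A], because 1 is not on the cycle. *)
Lemma long_lcoset_half (A : {group gT}) : A != [set: gT] :> {set gT} ->
  O \subset x *: A -> #|A|.*2 = #|[set: gT]| /\ O = ~: A.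
Proof.
move=> nA sOA; have leA := proper_card_half nA.
have leO := subset_leq_card sOA; rewrite card_lcoset in leO.
have OE : O = x *: A by apply/eqP; rewrite eqEcard sOA card_lcoset /=; clia.
split; first by move: long; rewrite OE card_lcoset; clia.
apply/eqP; rewrite eqEcard; apply/andP; split.
  apply/subsetP=> y Oy; rewrite inE; apply: contra long_cyc_notin1 => Ay.
  move: Oy; rewrite OE !mem_lcoset mulg1 => xy.
  by rewrite -(groupMr _ Ay).
by move: (cardsC A) long; rewrite -cardsT OE card_lcoset; clia.
Qed.

Lemma long_inverter : exists i, iter i f x = x^-1.
Proof.
suff: x^-1 \in O by case/cycP=> i ->; exists i.
apply: contraT => nOV; have := subset_leq_card (subsetT (1 |: (O :|: cyc f x^-1))).
rewrite cardsU1 !inE negb_or.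
have -> : ~~ fconnect f x 1 by have := long_cyc_notin1; rewrite inE.
have -> : ~~ fconnect f x^-1 1.
  have := long_cyc_neq1; rewrite fconnect_sym //.
  have -> : fconnect f 1 x^-1 = (x^-1 \in cyc f 1) by rewrite inE.
  by rewrite cyc1 // inE invg_eq1.
have := cardsUI O (cyc f x^-1).
have -> : O :&: cyc f x^-1 = set0.
  apply/setP=> y; rewrite in_setI in_set0; apply/negP=> /andP[Oy OVy].
  by case/negP: nOV; rewrite -(cyc_eq fI Oy) (cyc_eq fI OVy) cyc_refl.
by rewrite cards0 (card_cycV fM fI); move: long; clia.
Qed.

Section Inverter.

Variable i : nat.
Hypothesis ix : iter i f x = x^-1.
Local Notation iota := (iter i f).

Lemma inverter_cyc y : y \in O -> iota y = y^-1.
Proof.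
case/cycP=> j ->; rewrite iter_endoC ix.
by elim: j => //= j ->; rewrite endoV.
Qed.

(** Divide [iota (y m) = m^-1 y^-1] by [iota y = y^-1]. *)
Lemma inverter_lcoset y m : y \in O -> y * m \in O -> iota m = y * m^-1 * y^-1.
Proof.
move=> Oy Oym; have := inverter_cyc Oym.
rewrite iter_endoM // inverter_cyc // invMg => e.
by apply: (mulgI y^-1); rewrite e !mulgA mulVg mul1g.
Qed.

End Inverter.

(** In this form the property pulls back from quotients by taking preimages. Index 2 and stability
    of [A] follow from the length of the cycle ([long_lcoset_half], [two_stable]). *)
Definition split_off : Prop :=
  exists2 A : {group gT}, A != [set: gT] :> {set gT} & O \subset x *: A.

End LongCycle.

(** * Perfect groups of small index *)

Lemma perfect_sol (gT : finGroupType) (K : {group gT}) : K^`(1) = K -> solvable K -> K :=: 1.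
Proof.
move=> pK sK; apply/eqP; apply: contraT => nK.
by have := sol_der1_proper sK (subxx K) nK; rewrite pK properxx.
Qed.

Lemma perfect_quotient (gT : finGroupType) (K H : {group gT}) : K^`(1) = K -> H <| K -> (K / H)^`(1) = K / H.
Proof. by move=> pK nHK; rewrite -quotient_der ?normal_norm // pK. Qed.

Lemma perfect_index2 (gT : finGroupType) (K H : {group gT}) : K^`(1) = K -> H \subset K -> #|K : H| != 2.
Proof.
move=> pK sHK; apply/eqP=> i2; have nHK := index2_normal sHK i2.
have abQ : abelian (K / H).
  by apply/cyclic_abelian/prime_cyclic; rewrite card_quotient ?normal_norm // i2.
have := der1_min (normal_norm nHK) abQ; rewrite pK -indexg_eq1.
by rewrite i2.
Qed.

(** [K] acts on the cosets of [H] with kernel the core, so the quotient embeds in a symmetric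
    group. *)
Lemma card_quotient_gcore (gT : finGroupType) (K H : {group gT}) : H \subset K ->
  #|K / gcore H K| %| (#|K : H|)`!.
Proof.
move=> sHK; pose to := <[actsRs_rcosets H K]>%act.
have kE : 'ker (actperm to) = gcore H K.
  rewrite ker_actperm astab_actby setIT astabRs_rcosets.
  apply/setIidPr.
  exact: subset_trans (gcore_sub _ _) sHK.
rewrite card_quotient ?gcore_norm //.
have := card_morphim (actperm_morphism to) K; rewrite setIid kE => <-.
have -> : #|K : H| = #|rcosets H K| by [].
rewrite -perm.card_Sym; apply: cardSg; apply/subsetP=> _ /morphimP[g _ Kg ->].
rewrite inE; apply/subsetP=> C; rewrite !inE actpermE /=; apply: contraR => nC.
by rewrite /to /= /actby (negPf nC).
Qed.

Lemma perfect_prime (gT : finGroupType) (K : {group gT}) : K^`(1) = K -> ~~ prime #|K|.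
Proof.
move=> pK; apply/negP=> prK; have := perfect_sol pK.
rewrite abelian_sol ?(cyclic_abelian (prime_cyclic prK)) // => /(_ isT) K1.
by move: prK; rewrite K1 cards1.
Qed.

Lemma perfect_pnat (gT : finGroupType) (p : nat) (K : {group gT}) : K^`(1) = K -> p.-nat #|K| -> K :=: 1.
Proof. by move=> pK pgK; exact: (perfect_sol pK (pgroup_sol pgK)). Qed.

(** In order 6 a subgroup of order 3 has index 2, which perfect groups do not have; the other
    divisors are 1 or prime. *)
Lemma perfect_dvd6 (gT : finGroupType) (K : {group gT}) : K^`(1) = K -> #|K| %| 6 -> K :=: 1.
Proof.
move=> pK K6; apply/eqP; have := perfect_prime pK.
have : #|K| \in divisors 6 by rewrite -dvdn_divisors.
rewrite !inE trivg_card1 => /or4P[] /eqP KE; rewrite KE // => _.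
have [||y Ky oy] := @Cauchy _ 3 K; rewrite ?KE //.
have sYK : <[y]> \subset K by rewrite cycle_subG.
have := perfect_index2 pK sYK; have := Lagrange sYK.
by rewrite KE -orderE oy => e /eqP[]; lia.
Qed.

(** Among the divisors of 24 that do not divide 6, 4 and 8 are powers of 2. In orders 12 and 24 a
    Sylow 2-subgroup has index 3, so the quotient by its core has order dividing 6. *)
Lemma perfect_dvd24 (gT : finGroupType) (K : {group gT}) : K^`(1) = K -> #|K| %| 24 -> K :=: 1.
Proof.
move=> pK K24; have [K6|nK6] := boolP (#|K| %| 6); first exact: perfect_dvd6.
have [P sylP] := Sylow_exists 2 K; have sPK := pHall_sub sylP.
have := Lagrange sPK; rewrite (card_Hall sylP) p_part => iK.
have : #|K| \in divisors 24 by rewrite -dvdn_divisors.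
rewrite !inE; case/orP=> [/eqP KE|]; first by rewrite KE in nK6.
case/orP=> [/eqP KE|]; first by rewrite KE in nK6.
case/orP=> [/eqP KE|]; first by rewrite KE in nK6.
case/orP=> [/eqP KE|]; first by apply: (@perfect_pnat _ 2); rewrite ?KE.
case/orP=> [/eqP KE|]; first by rewrite KE in nK6.
case/orP=> [/eqP KE|K12]; first by apply: (@perfect_pnat _ 2); rewrite ?KE.
have i3 : #|K : P| = 3.
  case/orP: K12 => /eqP KE; rewrite KE in iK.
    by rewrite (_ : logn 2 12 = 2) // in iK; lia.
  by rewrite (_ : logn 2 24 = 3) // in iK; lia.
have nC : gcore P K <| K.
  by rewrite /normal gcore_norm (subset_trans (gcore_sub _ _)).
have Q1 : K / gcore P K = 1.
  apply: (@perfect_dvd6 _ (K / gcore P K)%G); first exact: perfect_quotient.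
  by have := card_quotient_gcore sPK; rewrite i3.
have : K \subset gcore P K by rewrite -quotient_sub1 ?gcore_norm // Q1.
by move/subset_trans/(_ (gcore_sub _ _)); rewrite -indexg_eq1 i3.
Qed.

(** The quotient by the core of [H] embeds in a symmetric group on at most 4 letters, hence is
    trivial. *)
Lemma perfect_index4 (gT : finGroupType) (K H : {group gT}) :
  K^`(1) = K -> H \subset K -> #|K : H| <= 4 -> H = K.
Proof.
move=> pK sHK i4; have nC : gcore H K <| K.
  by rewrite /normal gcore_norm (subset_trans (gcore_sub _ _)).
have Q1 : K / gcore H K = 1.
  apply: (@perfect_dvd24 _ (K / gcore H K)%G); first exact: perfect_quotient.
  apply: dvdn_trans (card_quotient_gcore sHK) _.
  by case: #|K : H| i4 => [|[|[|[|[]]]]].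
apply/val_inj/eqP; rewrite eqEsubset sHK /=.
have : K \subset gcore H K by rewrite -quotient_sub1 ?gcore_norm // Q1.
by move/subset_trans/(_ (gcore_sub _ _)).
Qed.

(** Proper subgroups have index at least 5, hence order at most 3; this applies to the Sylow
    subgroups, as [K] is not a p-group. *)
Lemma perfect_card16 (gT : finGroupType) (K : {group gT}) :
  K^`(1) = K -> #|K| <= 16 -> K :=: 1.
Proof.
move=> pK K16; apply/eqP; apply: contraT => nK.
have small (H : {group gT}) : H \subset K -> H != K -> #|H| <= 3.
  move=> sHK nHK; rewrite leqNgt; apply: contra nHK => H4.
  apply/eqP; apply: perfect_index4 => //.
  have := Lagrange sHK; have := cardG_gt0 H; nia.
have part (p : nat) : #|K|`_p <= 3.
  have [P sylP] := Sylow_exists p K; rewrite -(card_Hall sylP).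
  apply: small (pHall_sub sylP) _; apply: contra nK => /eqP PK.
  have pP := pHall_pgroup sylP; rewrite PK in pP.
  by apply/eqP; apply: (perfect_pnat pK pP).
(* Every order up to 16 is prime, divides 24, or has a Sylow subgroup of order above 3. *)
have chk : all (fun n => [|| prime n, n %| 24, 3 < 2 ^ logn 2 n, 3 < 3 ^ logn 3 n,
    3 < 5 ^ logn 5 n | 3 < 7 ^ logn 7 n]) (iota 1 16) by [].
have /(allP chk) : #|K| \in iota 1 16 by rewrite mem_iota cardG_gt0 ltnS.
rewrite (negPf (perfect_prime pK)) -!p_part /= !(ltnNge 3) !part !orbF.
by move/(perfect_dvd24 pK)=> K1; rewrite K1 eqxx in nK.
Qed.

(* Each [t] in [M] is a product of two elements inverted by [s] in at most
   [#|'C_M[t]|] ways, so a fraction at least 1/4 of the pairs of elements of [M]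
   commute, whereas a proper centraliser in a perfect group has index at least 5. *)
Lemma perfect_half_inverted (gT : finGroupType) (M : {group gT}) (s : gT -> gT) :
  {in M &, {morph s : y z / y * z}} -> M^`(1) = M -> 'Z(M) = 1 ->
  #|M| <= #|[set m in M | s m == m^-1]|.*2 -> M :=: 1.
Proof.
move=> sM pM ZM; set T := [set m in M | _] => half.
have TM y : y \in T -> y \in M by rewrite inE => /andP[].
have sT y : y \in T -> s y = y^-1 by rewrite inE => /andP[_ /eqP].
apply: (perfect_card16 pM).
have pairs : (#|T| * #|T| <= \sum_(t in M) #|'C_M[t]|)%N.
  rewrite -cardsX -sum1_card.
  rewrite (partition_big (fun u : gT * gT => u.1 * u.2) (mem M)) /=; last first.
    by move=> [y z]; rewrite inE => /andP[/TM My /TM Mz]; rewrite groupM.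
  apply: leq_sum => t Mt; rewrite sum1dep_card.
  set X := [set u | _]; have [->|[[y0 z0] X0]] := set_0Vmem X; first by rewrite cards0.
  have XE y z : (y, z) \in X -> [/\ y \in T, y \in M & s t = y^-1 * t^-1 * y].
    rewrite inE => /andP[/setXP[Ty Tz] /eqP /= <-]; split; rewrite ?TM //.
    by rewrite sM ?TM // !sT // invMg mulgA mulgKV.
  have [T0 M0 st0] := XE _ _ X0.
  (* For [t = y z], [s t] is [t^-1] conjugated by [y]. Two factorisations of [t] therefore have left
     factors that differ by an element centralising [t]. *)
  have inj : {in X &, injective (fun u : gT * gT => u.1 * y0^-1)}.
    move=> [y z] [y' z'] Xy Xy' /= /mulIg eyy; rewrite -eyy in Xy' *; congr (_, _).
    move: Xy Xy'; rewrite !inE /= => /andP[_ /eqP <-] /andP[_ /eqP].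
    by move/mulgI->.
  rewrite -(card_in_imset inj); apply: subset_leq_card.
  apply/subsetP=> _ /imsetP[[y z] Xy ->] /=; have [Ty My sty] := XE _ _ Xy.
  rewrite inE groupM ?groupV //=; apply/cent1P; rewrite /commute.
  have : (y^-1 * t^-1 * y)^-1 = (y0^-1 * t^-1 * y0)^-1 by rewrite -sty -st0.
  rewrite !invMg !invgK => e.
  have -> : y * y0^-1 * t = y * (y0^-1 * (t * y0)) * y0^-1.
    by rewrite !mulgA mulgK.
  by rewrite -e !mulgA mulgV mul1g.
have C5 t : t \in M -> t != 1 -> (5 * #|'C_M[t]| <= #|M|)%N.
  move=> Mt nt; have sCM : 'C_M[t] \subset M by rewrite subsetIl.
  rewrite -(Lagrange sCM) mulnC leq_mul2l orbC ltnNge; apply/orP; left.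
  apply: contra nt => i4; have CM := perfect_index4 pM sCM i4.
  have : t \in 'Z(M).
    rewrite inE Mt; apply/centP=> y My; apply/cent1P.
    by move: My; rewrite cent1C -{1}CM inE => /andP[].
  by rewrite ZM inE.
have : (5 * \sum_(t in M) #|'C_M[t]| <= 5 * #|M| + #|M|.-1 * #|M|)%N.
  rewrite (bigD1 1) ?group1 //= mulnDr leq_add //.
    by rewrite leq_mul2l subset_leq_card ?subsetIl ?orbT.
  rewrite big_distrr /= (cardsD1 1 M) group1 add1n /= -sum_nat_const.
  rewrite [X in _ <= X](eq_bigl (fun t => (t \in M) && (t != 1))); last first.
    by move=> t; rewrite !inE andbC.
  apply: leq_sum => t /andP[Mt nt].
  by move: (C5 t Mt nt); rewrite (cardsD1 1 M) group1.
(* With [S] the sum, [m^2 <= 4 S] and [5 S <= m^2 + 4 m], whence [m <= 16]. *)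
move: half pairs; have := cardG_gt0 M; move: #|M| #|T| (\sum_(_ in _) _)%N.
move=> m k S m0 hk hS h5; nia.
Qed.

(** * Nonabelian groups *)

(** [f] permutes the left cosets of [S], and [e] is the length of the cycle through [y S]. *)
Lemma coset_period (gT : finGroupType) (f : gT -> gT) (S : {group gT}) y :
  {morph f : u v / u * v} -> injective f -> stable f S ->
  exists2 e, 0 < e & forall i, (iter i f y \in y *: S) = (e %| i).
Proof.
move=> fM fI sS.
have exe : exists e, (0 < e) && (iter e f y \in y *: S).
  exists #|cyc f y|; rewrite iter_card_cyc // lcoset_refl andbT.
  by rewrite card_cyc fingraph.order_gt0.
case: (ex_minnP exe) => e /andP[e0 Se] emin; exists e => // i.
have Sk k : iter (k * e) f y \in y *: S.
  elim: k => [|k IHk]; first exact: lcoset_refl.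
  move: IHk Se; rewrite mulSn iterD => /lcosetP[s Ss ->]; rewrite iter_endoM //.
  by move=> /lcosetP[t St ->]; rewrite mem_lcoset -mulgA mulKg groupM // stable_iter.
have ->: (iter i f y \in y *: S) = (iter (i %% e) f y \in y *: S).
  have := Sk (i %/ e); rewrite {2}(divn_eq i e) addnC iterD => /lcosetP[s Ss ->].
  by rewrite iter_endoM // !mem_lcoset mulgA groupMr // stable_iter.
rewrite /dvdn; case: posnP => [->|r0]; first by rewrite lcoset_refl.
by apply/negP=> Sr; have := emin (i %% e); rewrite r0 Sr leqNgt ltn_pmod // => /(_ isT).
Qed.

Section SplitOff.

Variables (gT : finGroupType) (f : gT -> gT).
Hypotheses (fM : {morph f : y z / y * z}) (fI : injective f).
Variable x : gT.
Hypotheses (gt2 : 2 < #|[set: gT]|) (long : #|[set: gT]| <= #|cyc f x|.*2).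

Local Notation O := (cyc f x).
Local Notation G := [set: gT].

Lemma long_cyc_eq y : y \in O -> #|G| <= #|cyc f y|.*2.
Proof. by move=> Oy; rewrite (cyc_eq fI Oy). Qed.

(** Where [y m] is on the cycle this is [inverter_lcoset], and that covers more than half of [M]. As
    [M] is abelian both sides are multiplicative in [m], so they agree on a subgroup, which is then
    all of [M]. *)
Lemma inverter_conj (M : {group gT}) i y : iter i f x = x^-1 ->
  abelian M -> stable f M -> M != G :> {set gT} -> y \in O ->
  {in M, forall m, iter i f m = y * m^-1 * y^-1}.
Proof.
move=> ix abM sM nM Oy.
have longy := long_cyc_eq Oy; have := long_lcoset_proper fM fI gt2 longy sM nM.
pose My := [set m in M | iter i f m == y * m^-1 * y^-1].
have gMy : group_set My.
  apply/group_setP; split.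
    by rewrite inE group1 (endo1 (iter_endoM fM i)) invg1 mulg1 mulgV eqxx.
  move=> m n /setIdP[Mm /eqP im] /setIdP[Mn /eqP jn].
  rewrite inE groupM //= iter_endoM // im jn invMg -(centsP abM _ (groupVr Mm) _ (groupVr Mn)).
  by rewrite !mulgA mulgKV.
rewrite (cyc_eq fI Oy) => ltM.
have sMyM : Group gMy \subset M by apply/subsetP=> m; rewrite inE => /andP[].
have leMy : #|O :&: y *: M| <= #|Group gMy|.
  rewrite -(card_lcoset (Group gMy) y); apply: subset_leq_card.
  apply/subsetP=> z /setIP[Oz /lcosetP[m Mm zE]]; rewrite zE in Oz *.
  rewrite mem_lcoset mulKg inE Mm; apply/eqP.
  exact: (inverter_lcoset fM ix Oy Oz).
have MyM : Group gMy = M.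
  apply/group_inj/eqP; rewrite eqEsubset sMyM -indexg_eq1.
  have := Lagrange sMyM; have := indexg_gt0 M (Group gMy).
  have := cardG_gt0 (Group gMy); move: #|M : _| => k g0 k0 e.
  have : (#|Group gMy| * k < #|Group gMy| * 2)%N by rewrite e; clia.
  by rewrite ltn_pmul2l //; case: k k0 {e} => [|[]].
by move=> m; rewrite -{1}MyM inE => /andP[_ /eqP].
Qed.

(** By [inverter_conj] conjugation by [x] and by any [y] on the cycle agree on [M], so [x^-1 y]
    centralises [M]. *)
Lemma split_noncentral (M : {group gT}) : M <| G -> stable f M -> abelian M ->
  ~~ (M \subset 'Z(G)) -> split_off f x.
Proof.
move=> nMG sM abM nMZ; have [i ix] := long_inverter fM fI gt2 long.
have nM : M != G :> {set gT}.
  by apply: contra nMZ => /eqP MG; rewrite -MG subsetI subxx.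
exists 'C(M)%G => /=.
  apply: contra nMZ => /eqP CG; rewrite subsetI normal_sub //=.
  by rewrite centsC CG.
apply/subsetP=> y Oy; rewrite mem_lcoset; apply/centP=> m Mm.
have := inverter_conj ix abM sM nM Oy Mm.
rewrite (inverter_conj ix abM sM nM (cyc_refl x) Mm) => /(congr1 invg).
rewrite !invMg !invgK /commute => e.
have -> : x^-1 * y * m = x^-1 * (y * (m * y^-1)) * y by rewrite !mulgA mulgKV.
by rewrite -e !mulgA mulVg mul1g.
Qed.

(* With [beta = f^e], [e] minimal such that [beta x] lies in [x Z], and
   [D = [Z, beta]], the coset [x Z] being half filled by the cycle makes [Z / D]
   cyclic, generated by [w = x^-1 beta x]; it has even order as commutators are
   fixed by [beta] and have order 2. *)
Lemma split_class2 : ~~ abelian G -> abelian (G / 'Z(G)) -> split_off f x.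
Proof.
move=> nab abQ; pose Z := 'Z(G)%G; have [i ix] := long_inverter fM fI gt2 long.
have sZ : stable f Z by apply: center_stable.
have abZ : abelian Z := center_abelian _.
have nZ : Z != G :> {set gT} by apply: contra nab => /eqP <-.
have cZ z t : z \in Z -> z * t = t * z.
  by rewrite inE => /andP[_ /centP cz]; apply: cz; rewrite inE.
have iZ : {in Z, forall z, iter i f z = z^-1}.
  move=> z Zz; rewrite (inverter_conj ix abZ sZ nZ (cyc_refl x) Zz).
  by rewrite -(cZ _ _ (groupVr Zz)) mulgK.
have cl2 s t : [~ s, t] \in Z.
  have dZ : G^`(1) \subset Z by apply: der1_min => //; apply: normal_norm; apply: center_normal.
  by apply: (subsetP dZ); apply: mem_commg; rewrite inE.
(* If [x] commuted with the whole cycle, then by applying powers of [f] any two points of it would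
   commute, and the cycle generates the group. *)
have [c Oc ncxc] : exists2 c, c \in O & [~ x, c] != 1.
  apply/exists_inP; apply: contraR nab; rewrite negb_exists_in => /forall_inP cx.
  have cO : abelian O.
    apply/centsP=> _ /cycP[j ->] t Ot.
    have [k _ tE] : exists2 k, true & t = iter j f (iter k f x).
      by move: Ot; rewrite -(cyc_eq fI (mem_cyc f x j)) => /cycP[k ->];
         exists k => //; rewrite iter_endoC.
    have := cx _ (mem_cyc f x k); rewrite negbK => /commgP cxk.
    by rewrite /commute tE -!iter_endoM // cxk.
  rewrite -abelian_gen in cO.
  have -> : G = <<O>>.
    apply/esym/(long_stable_full fM fI gt2 long (M := <<O>>%G) _ (cyc_refl x)).
      exact/(stable_gen fM)/cyc_stable.
    by rewrite mem_gen ?cyc_refl.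
  exact: cO.
pose z := [~ x, c]; have Zz : z \in Z by apply: cl2.
(* The inverting power inverts the central [z], but sends [[x, c]] to [[x^-1, c^-1]], which is
   [[x, c]] in class 2. *)
have z2 : z ^+ 2 = 1.
  apply/eqP; rewrite expgS expg1 -eq_invg_mul; apply/eqP.
  rewrite -(iZ z Zz) {1}/z /commg /conjg !iter_endoM //.
  rewrite !(endoV (iter_endoM fM i)) ix (inverter_cyc fM ix Oc) !invgK.
  have e : c * x * z = x * c by rewrite /z /commg /conjg !mulgA mulgK mulgV mul1g.
  have -> : x * (c * (x^-1 * c^-1)) = x * c * (x^-1 * c^-1) by rewrite !mulgA.
  by rewrite -e -(cZ z) // -!mulgA (mulKVg x) mulgV mulg1.
have [e _ eP] := coset_period x fM fI sZ.
pose beta := iter e f; have bM : {morph beta : s t / s * t} by apply: iter_endoM.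
pose w := x^-1 * beta x; have Zw : w \in Z by rewrite -mem_lcoset eP.
have bx : beta x = x * w by rewrite mulKVg.
have bZ y : y^-1 * beta y \in Z.
  have gB : group_set [set t | t^-1 * beta t \in Z].
    apply/group_setP; split=> [|s t]; first by rewrite inE (endo1 bM) mulVg group1.
    move=> /[1!inE] Zs /[1!inE] Zt; rewrite inE bM invMg.
    have -> : t^-1 * s^-1 * (beta s * beta t) = t^-1 * (s^-1 * beta s * beta t).
      by rewrite !mulgA.
    by rewrite (cZ _ (beta t) Zs) mulgA groupM.
  have : Group gB = G :> {set gT}.
    apply: (long_stable_full fM fI gt2 long _ (cyc_refl x)); last by rewrite inE.
    move=> t /[1!inE] Zt; rewrite inE -(endoV fM) /beta -iterSr iterS -fM.
    exact: sZ.
  by move/setP/(_ y); rewrite in_setT => /[1!inE].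
(* [beta] changes [x] and [c] by central factors, to which commutators are insensitive. *)
have bz : beta z = z.
  have E y : beta y = y * (y^-1 * beta y) by rewrite mulKVg.
  have com0 s t : s \in Z -> [~ s, t] = 1.
    by move=> Zs; apply/eqP/commgP; rewrite /commute cZ.
  have J s t : s \in Z -> t ^ s = t by move=> Zs; rewrite conjgE -(cZ s) // mulKg.
  rewrite /z /commg /conjg !bM !(endoV bM) -conjgE -commgEl.
  rewrite (E x) (E c) commMgJ (com0 _ _ (bZ x)) mulg1 J //.
  by rewrite commgMJ J // -[[~ x, c^-1 * _]]invgK invg_comm com0 // invg1 mul1g.
have bZZ : {in Z, forall u, beta u \in Z} by move=> u Zu; apply: stable_iter.
have phiM : {in Z &, {morph (fun u => u^-1 * beta u) : s t / s * t}}.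
  move=> s t Zs Zt /=; rewrite bM invMg -(cZ _ _ (groupVr Zs)) -!mulgA; congr (_ * _).
  by rewrite mulgA (cZ _ _ (groupVr Zt)) -mulgA.
pose phi := Morphism phiM; pose D := (phi @* Z)%G.
have phiE u : u \in Z -> u^-1 * beta u \in D.
  by move=> Zu; apply: (mem_morphim phi).
have sDZ : D \subset Z.
  by apply/subsetP=> _ /morphimP[u Zu _ ->] /=; rewrite groupM ?groupV ?bZZ.
have sD : stable f D.
  move=> _ /morphimP[u Zu _ ->] /=; rewrite fM (endoV fM).
  by rewrite /beta -iterS iterSr; apply: phiE; apply: sZ.
(* [D] is the image of [phi] on [Z], so [#|Z : D|] is the order of the kernel, which contains the
   involution [z]. *)
have evq : 2 %| #|Z : D|.
  have -> : #|Z : D| = #|'ker phi|.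
    have sKZ : 'ker phi \subset Z := subsetIl _ _.
    have := Lagrange sDZ; rewrite {1}(card_morphim phi Z) setIid -(Lagrange sKZ) mulnC.
    by move/eqP; rewrite eqn_pmul2r ?indexg_gt0 // => /eqP.
  rewrite -(_ : #[z] = 2) ?order_dvdG //; last first.
    by apply: nt_prime_order.
  by apply/kerP => //=; rewrite bz mulVg.
(* The returns of the cycle to [x Z] all lie in [x <w> D], and they are more than half of [x Z]. *)
have WZ : <[w]> <*> D = Z.
  have sWZ : <[w]> <*> D \subset Z by rewrite join_subG cycle_subG Zw.
  have Hb k : x^-1 * iter (k * e) f x \in <[w]> <*> D.
    have DW u : u \in D -> u \in <[w]> <*> D by apply/subsetP/joing_subr.
    elim: k => [|k IHk]; first by rewrite mulVg group1.
    rewrite mulSn iterD -[iter (k * e) f x](mulKVg x).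
    set h := x^-1 * _ in IHk *; rewrite -/beta bM bx -mulgA mulKg.
    rewrite groupM //; first by rewrite (subsetP (joing_subl _ _)) ?cycle_id.
    rewrite -(mulKVg h (beta h)) groupM //; apply: DW; apply: phiE.
    exact: (subsetP sWZ).
  apply/eqP; rewrite eqEsubset sWZ -indexg_eq1.
  have leO : #|O :&: x *: Z| <= #|<[w]> <*> D|.
    rewrite -(card_lcoset (<[w]> <*> D) x); apply: subset_leq_card.
    apply/subsetP=> _ /setIP[/cycP[j ->]]; rewrite !mem_lcoset => Zj.
    by move: Zj; rewrite -mem_lcoset eP => /dvdnP[k ->].
  have := long_lcoset_proper fM fI gt2 long sZ nZ.
  have := Lagrange sWZ; have := indexg_gt0 Z (<[w]> <*> D).
  have := cardG_gt0 (<[w]> <*> D)%G; move: #|Z : _| => k g0 k0 eZ lt.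
  have : (#|<[w]> <*> D| * k < #|<[w]> <*> D| * 2)%N by rewrite eZ; clia.
  by rewrite ltn_pmul2l //; case: k k0 {eZ} => [|[]].
have nDZ : Z \subset 'N(D) by apply: sub_abelian_norm.
have Zw' : <[w]> \subset 'N(D) by apply: subset_trans nDZ; rewrite cycle_subG.
have QE : Z / D = <[coset D w]>.
  by rewrite -WZ quotientYidr // quotient_cycle // -cycle_subG.
have wD k : (w ^+ k \in D) = (#|Z : D| %| k).
  have Nw : w \in 'N(D) by rewrite -cycle_subG.
  rewrite -card_quotient // QE [#|_|]orderE order_dvdn -morphX //=.
  by apply/idP/eqP=> [/coset_id|/coset_idr] -> //; apply: groupX.
pose h := #|Z : D|./2; have qE : #|Z : D| = h.*2.
  by rewrite -[LHS]odd_double_half; move: evq; rewrite dvdn2 => /negPf->.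
have h0 : 0 < h by rewrite -double_gt0 -qE indexg_gt0.
have expD u v n : u \in Z -> v \in D -> ((u * v) ^+ n \in D) = (u ^+ n \in D).
  move=> Zu Dv; have cuv : commute u v by apply: cZ.
  by rewrite expgMn // groupMr // groupX.
(* Modulo [D], the map [y |-> y^-1 beta y] is a morphism to the cyclic group [Z / D] of order [2 h];
   the group sought is the preimage of the squares. *)
have gA : group_set [set y | (y^-1 * beta y) ^+ h \in D].
  apply/group_setP; split=> [|s t]; first by rewrite inE (endo1 bM) mulVg expg1n group1.
  move=> /[1!inE] Ds /[1!inE] Dt; rewrite inE bM invMg.
  have -> : t^-1 * s^-1 * (beta s * beta t) = t^-1 * (s^-1 * beta s * beta t).
    by rewrite !mulgA.
  rewrite (cZ _ (beta t) (bZ s)) mulgA expgMn ?groupM //.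
  by apply/commute_sym; apply: cZ; apply: bZ.
exists (Group gA) => /=.
  apply/eqP=> /setP/(_ x); rewrite in_setT inE -/w wD qE => /dvdn_leq.
  by move=> /(_ h0); rewrite -addnn -[leqRHS]addn0 leq_add2l leqNgt h0.
apply/subsetP=> y Oy; rewrite mem_lcoset inE bM invMg invgK (endoV bM).
pose v := y^-1 * beta y.
have -> : y^-1 * x * ((beta x)^-1 * beta y) = w^-1 * v.
  have xw : x * (beta x)^-1 = w^-1.
    by rewrite bx invMg mulgA -(cZ w^-1) ?groupV // mulgK.
  rewrite -mulgA (mulgA x) xw.
  by rewrite mulgA -(cZ w^-1) ?groupV // -mulgA.
have : v \in <[w]> <*> D by rewrite WZ; apply: bZ.
rewrite norm_joinEl // => /mulsgP[_ d /cycleP[k ->] Dd vE].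
(* [v] is the image of [w] under a power of [f], so it is no square modulo [D] either: its exponent
   [k] is odd, and [w^-1 v] is a square. *)
have nvD : v ^+ h \notin D.
  have /cycP[j yE] := Oy; have -> : v = iter j f w.
    by rewrite /v /w yE iter_endoM // (endoV (iter_endoM fM j)) /beta iter_endoC.
  rewrite -(endoX (iter_endoM fM j)); apply/negP=> /(stable_iterV fI sD); rewrite wD qE => /dvdn_leq.
  by move=> /(_ h0); rewrite -addnn -[leqRHS]addn0 leq_add2l leqNgt h0.
have Zwk n : w ^+ n \in Z by rewrite groupX.
rewrite vE expD // -expgM wD qE in nvD; rewrite vE mulgA expD ?groupM ?groupV //.
case: (posnP k) => [k0|k0]; first by rewrite k0 dvdn0 in nvD.
rewrite -(prednK k0) expgS mulKg -expgM wD qE -muln2 mulnC dvdn_pmul2r //.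
by rewrite -muln2 mulnC dvdn_pmul2r // dvdn2 negbK -{1}(prednK k0) /= in nvD; rewrite dvdn2.
Qed.

End SplitOff.

(** * Endomorphisms induced on quotients *)

Section QuotientEndo.

Variables (gT : finGroupType) (f : gT -> gT).
Hypotheses (fM : {morph f : y z / y * z}) (fI : injective f).
Variable Z : {group gT}.
Hypotheses (nZ : Z <| [set: gT]) (sZ : stable f Z).

Definition quo_endo (u : coset_of Z) : coset_of Z := coset Z (f (repr u)).

Let inN y : y \in 'N(Z).
Proof. by rewrite (subsetP (normal_norm nZ)) ?inE. Qed.

Lemma coset_eqP y z : reflect (coset Z y = coset Z z) (y^-1 * z \in Z).
Proof.
apply: (iffP idP) => [Zyz|e].
  by rewrite -[z](mulKVg y) coset_morphM ?inN // (coset_id Zyz) mulg1.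
by apply: coset_idr; rewrite ?inN // coset_morphM ?groupV ?inN // morphV ?inN //= e mulVg.
Qed.

Lemma quo_endoE y : quo_endo (coset Z y) = coset Z (f y).
Proof.
apply/coset_eqP; rewrite -endoV // -fM; apply: sZ.
by apply/coset_eqP; rewrite coset_reprK.
Qed.

Lemma quo_endoM : {morph quo_endo : u v / u * v}.
Proof.
move=> u v; rewrite -[u]coset_reprK -[v]coset_reprK -morphM ?inN //.
by rewrite !quo_endoE fM morphM.
Qed.

Lemma quo_endo_inj : injective quo_endo.
Proof.
move=> u v; rewrite -[u]coset_reprK -[v]coset_reprK !quo_endoE.
move/coset_eqP; rewrite -endoV // -fM => /(stableV fI sZ) e.
exact/coset_eqP.
Qed.

Lemma quo_cyc x : cyc quo_endo (coset Z x) = coset Z @: cyc f x.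
Proof.
have iE i : iter i quo_endo (coset Z x) = coset Z (iter i f x).
  by elim: i => //= i ->; rewrite quo_endoE.
apply/setP=> u; apply/cycP/imsetP=> [[i ->]|[_ /cycP[i ->] ->]].
  by exists (iter i f x); rewrite ?mem_cyc.
by exists i.
Qed.

Lemma card_cyc_quo x : #|cyc f x| <= (#|cyc quo_endo (coset Z x)| * #|Z|)%N.
Proof.
rewrite quo_cyc -sum1_card (partition_big_imset (coset Z)) /= -sum_nat_const.
apply: leq_sum => _ /imsetP[y Oy ->]; rewrite sum1dep_card.
rewrite -(card_lcoset Z y); apply: subset_leq_card; apply/subsetP=> z.
rewrite inE mem_lcoset => /andP[_ /eqP e]; exact/coset_eqP.
Qed.

Lemma quo_setT : [set: gT] / Z = [set: coset_of Z].
Proof.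
apply/setP=> u; rewrite inE -[u]coset_reprK; apply: mem_quotient.
by rewrite inE.
Qed.

Lemma quo_split x : split_off quo_endo (coset Z x) -> split_off f x.
Proof.
case=> A nA sOA; exists (coset Z @*^-1 A)%G.
  apply: contra nA => /eqP e; apply/eqP/setP=> u; rewrite inE -[u]coset_reprK.
  have : repr u \in coset Z @*^-1 A by rewrite e inE.
  by rewrite !inE => /andP[].
apply/subsetP=> y Oy; have := subsetP sOA (coset Z y).
rewrite quo_cyc imset_f // => /(_ isT).
rewrite !mem_lcoset => Axy; apply/morphpreP; split; first exact: inN.
by rewrite /= coset_morphM ?inN // morphV ?inN.
Qed.

End QuotientEndo.

Lemma nonabelian_card_gt2 (gT : finGroupType) :
  ~~ abelian [set: gT] -> 2 < #|[set: gT]|.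
Proof.
move=> nab; rewrite ltnNge; apply: contra nab => G2; apply: cyclic_abelian.
move: (cardG_gt0 [set: gT]) G2; rewrite leq_eqVlt => /orP[/eqP G1 _|lt le].
  by rewrite (card1_trivg (esym G1)) cyclic1.
by apply: prime_cyclic; rewrite (_ : #|_| = 2) //; apply/eqP; rewrite eqn_leq le.
Qed.

(* Either [G] is of class at most 2, or one may pass to [G / 'Z(G)], or the centre
   is trivial and a minimal invariant normal subgroup is abelian or perfect. *)
Theorem split_nonabelian (gT : finGroupType) (f : gT -> gT) (x : gT) :
  {morph f : y z / y * z} -> injective f -> ~~ abelian [set: gT] ->
  #|[set: gT]| <= #|cyc f x|.*2 -> split_off f x.
Proof.
have [n] := ubnP #|[set: gT]|; elim: n gT f x => // n IHn gT f x /ltnSE leGn.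
move=> fM fI nab long.
have gt2 := nonabelian_card_gt2 nab.
have nZ := center_normal [set: gT]; have sZ := center_stable fM fI.
have [abQ|nabQ] := boolP (abelian ([set: gT] / 'Z([set: gT]))).
  exact: split_class2.
have [Z1|nZ1] := eqVneq 'Z([set: gT]) 1; last first.
  apply: (quo_split fM nZ sZ).
  have ZL := Lagrange (normal_sub nZ).
  rewrite -card_quotient ?normal_norm // quo_setT in ZL.
  have Z2 : 1 < #|'Z([set: gT])| by rewrite cardG_gt1.
  apply: IHn.
  - apply: leq_trans leGn; by rewrite -ZL -[X in X < _]mul1n ltn_pmul2r.
  - exact: quo_endoM.
  - exact: quo_endo_inj.
  - by rewrite -quo_setT.
  have := card_cyc_quo fM nZ sZ x => le; rewrite -(leq_pmul2l (ltnW Z2)) ZL.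
  by apply: leq_trans long _; rewrite -doubleMr leq_double mulnC.
pose P (M : {group gT}) := [&& M != 1 :> {set gT}, M <| [set: gT] & f @: M \subset M].
have stP M : f @: (M : {group gT}) \subset M -> stable f M.
  by move=> sM y My; apply: (subsetP sM); apply: imset_f.
have Pst (M : {group gT}) : M :!=: 1 -> M <| [set: gT] -> stable f M -> P M.
  move=> nM1 nM sM; rewrite /P nM1 nM; apply/subsetP=> _ /imsetP[y My ->].
  exact: sM.
have PT : P [set: gT]%G.
  apply: Pst; rewrite ?normal_refl //.
  by apply: contra nab => /eqP->; apply: abelian1.
have [M /mingroupP[PM minM] _] := mingroup_exists PT.
have /and3P[nM1 nM /stP sM] := PM.
have [abM|nabM] := boolP (abelian M).
  apply: (split_noncentral fM fI gt2 long nM sM abM).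
  by rewrite Z1 subG1.
have pM : M^`(1) = M.
  rewrite -[RHS](minM (M^`(1))%G) ?der_sub //; apply: Pst => /=.
  - by apply: contra nabM => /eqP/derG1P.
  - exact: char_normal_trans (der_char _ _) nM.
  apply: stable_gen => // _ /imset2P[s t Ms Mt ->].
  have -> : f [~ s, t] = [~ f s, f t] by rewrite /commg /conjg !fM !endoV.
  by apply/imset2P; exists (f s) (f t); rewrite ?sM.
have ZM : 'Z(M) = 1.
  apply/eqP; apply: contraT => nZM; case/negP: nabM.
  rewrite -(minM 'Z(M)%G) ?center_sub ?center_abelian //; apply: Pst => //=.
    exact: char_normal_trans (center_char _) nM.
  move=> z /setIP[Mz /centP cz]; rewrite inE sM //=; apply/centP=> m Mm.
  have [h _ fh] := injF_bij fI; move: Mm; rewrite -(fh m) => /(stableV fI sM) Mh.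
  by have := cz _ Mh; rewrite /commute -!fM => ->.
have [i ix] := long_inverter fM fI gt2 long.
(* Correcting [f^i] by conjugation with [x] gives a morphism inverting every [m] with [x m] on the
   cycle, that is, at least half of [M]. *)
case/eqP: nM1; apply: (@perfect_half_inverted _ M (fun m => x^-1 * iter i f m * x)) => //.
  by move=> y z _ _; rewrite /= iter_endoM // -!mulgA (mulKVg x).
apply: leq_trans (long_lcoset fM fI gt2 long sM) _; rewrite leq_double.
rewrite -[leqRHS](card_lcoset _ x); apply: subset_leq_card.
apply/subsetP=> z /setIP[Oz /lcosetP[m Mm zE]]; rewrite zE in Oz *.
rewrite mem_lcoset mulKg inE Mm (inverter_lcoset fM ix (cyc_refl x) Oz).
by rewrite !mulgA mulVg mul1g mulgKV eqxx.
Qed.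

(** * Cosets filled by a cycle *)

Lemma card_cyc_iter (gT : finGroupType) (f : gT -> gT) e y : injective f ->
  e %| #|cyc f y| -> #|cyc (iter e f) y| = #|cyc f y| %/ e.
Proof.
move=> fI /dvdnP[q nE]; have n0 : 0 < #|cyc f y| by rewrite card_cyc fingraph.order_gt0.
have e0 : 0 < e by move: n0; rewrite nE muln_gt0 => /andP[].
have eI : injective (iter e f) by apply: iter_endo_inj.
have dvdE k : (#|cyc (iter e f) y| %| k) = (q %| k).
  by rewrite -iter_eq_dvdn // -iterM iter_eq_dvdn // nE dvdn_pmul2r.
by rewrite nE mulnK //; apply/eqP; rewrite eqn_dvd dvdE dvdnn -dvdE dvdnn.
Qed.

Section FilledCoset.

Variables (gT : finGroupType) (g : gT -> gT).
Hypotheses (gM : {morph g : y z / y * z}) (gI : injective g).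

(** The cycle visits the cosets of [T] inside [y W] in turn; each return map then fills its coset,
    and counting identifies the return time. *)
Lemma filled_block (W T : {group gT}) y : T \subset W -> stable g T ->
    cyc g y = y *: W ->
  cyc (iter #|W : T| g) y = y *: T /\
  (forall i, (iter i g y \in y *: T) = (#|W : T| %| i)).
Proof.
move=> sTW sT fullW; have [e e0 eP] := coset_period y gM gI sT.
have cW : #|cyc g y| = #|W| by rewrite fullW card_lcoset.
have eW : e %| #|cyc g y| by rewrite -eP iter_card_cyc // lcoset_refl.
have full : cyc (iter e g) y = y *: T.
  apply/setP=> z; apply/cycP/idP=> [[k ->]|Tz].
    by rewrite -iterM eP dvdn_mull.
  have : z \in y *: W by rewrite mem_lcoset (subsetP sTW) // -mem_lcoset.
  rewrite -fullW => /cycP[i zE]; move: Tz; rewrite zE eP => /dvdnP[k ->].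
  by exists k; rewrite iterM.
have eE : e = #|W : T|.
  rewrite -divgS // -cW -(card_lcoset T y) -full card_cyc_iter //.
  rewrite divnA // mulKn //.
  by rewrite cW cardG_gt0.
by rewrite -eE.
Qed.

(** Telescoping: [c^-1 g^k(c)] is the product of the iterates of [c^-1 g(c)]. *)
Lemma diff_iter_mem (S : {group gT}) c k : stable g S ->
  c^-1 * g c \in S -> c^-1 * iter k g c \in S.
Proof.
move=> sS Sc; elim: k => [|k IHk]; first by rewrite mulVg group1.
by rewrite iterS -(mulKVg c (iter k g c)) gM mulgA groupM // sS.
Qed.

(* The [k]-th iterate of [y |-> y t] is [y t^k d^(k choose 2)] if [g] fixes
   [d = t^-1 g(t)]. *)
Lemma filled_card_odd p (T : {group gT}) y : prime p -> odd p -> p.-abelem T ->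
  cyc g y = y *: T -> stable g T ->
  {in T, forall t, g (t^-1 * g t) = t^-1 * g t} -> #|T| <= p.
Proof.
move=> pr_p op abT fullT sT gd; rewrite -(card_lcoset T y) -fullT.
apply: card_cyc_iterI => //; first exact: prime_gt0.
have [abelT eT] := abelemP pr_p abT.
pose t := y^-1 * g y; have gy : g y = y * t by rewrite mulKVg.
have Tt : t \in T by rewrite -mem_lcoset -fullT (mem_cyc g y 1).
pose d := t^-1 * g t; have gt : g t = t * d by rewrite mulKVg.
have Td : d \in T by rewrite groupM ?groupV ?sT.
have com u v : u \in T -> v \in T -> commute u v by move=> Tu Tv; apply: (centsP abelT).
have it k : iter k g y = y * t ^+ k * d ^+ 'C(k, 2).
  elim: k => [|k IHk]; first by rewrite bin0n !expg0 !mulg1.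
  rewrite iterS IHk !gM !(endoX gM) gy gt (gd t Tt) expgMn; last exact: com.
  rewrite -/d binS bin1 expgD expgS -!mulgA.
  by rewrite (com (d ^+ k) (d ^+ 'C(k, 2))) ?groupX.
by rewrite it bin2odd // expgM (eT t Tt) (eT d Td) expg1n !mulg1.
Qed.

(** Additively, the last hypothesis says [(g - 1)^3 = 0] on [T]. Since [(g - 1) y] lies in [T],
    [g^4 - 1 = (g - 1)^4] kills [y] in characteristic 2. *)
Lemma filled_card_two (T : {group gT}) y : 2.-abelem T ->
  cyc g y = y *: T -> stable g T ->
  (forall t d, t \in T -> d = t^-1 * g t -> g (d^-1 * g d) = d^-1 * g d) -> #|T| <= 4.
Proof.
move=> abT fullT sT ge; rewrite -(card_lcoset T y) -fullT.
apply: card_cyc_iterI => //.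
have [abelT eT] := abelemP (isT : prime 2) abT.
have sq u : u \in T -> u * u = 1 by move=> /eT; rewrite expgS expg1.
pose t := y^-1 * g y; have gy : g y = y * t by rewrite mulKVg.
have Tt : t \in T by rewrite -mem_lcoset -fullT (mem_cyc g y 1).
pose d := t^-1 * g t; have gt : g t = t * d by rewrite mulKVg.
have Td : d \in T by rewrite groupM ?groupV ?sT.
pose e := d^-1 * g d; have gd : g d = d * e by rewrite mulKVg.
have Te : e \in T by rewrite groupM ?groupV ?sT.
have gee : g e = e by apply: (ge t d).
have g2y : g (g y) = y * d by rewrite gy gM gt gy -mulgA (mulgA t) sq // mul1g.
have g2d : g (g d) = d by rewrite gd gM gee gd -mulgA sq // mulg1.
by rewrite /= g2y (gM y d) (gM (g y) (g d)) g2y g2d -mulgA sq // mulg1.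
Qed.

End FilledCoset.

Section FilledAbelem.

Variables (gT : finGroupType) (g : gT -> gT) (p : nat) (W : {group gT}) (y : gT).
Hypotheses (gM : {morph g : y z / y * z}) (gI : injective g) (pr_p : prime p).
Hypotheses (abW : p.-abelem W) (sW : stable g W) (fullW : cyc g y = y *: W).

Let pW : p.-group W := abelem_pgroup abW.

Lemma filled_iter c : c \in W -> iter #|W| g c = c.
Proof.
move=> Wc; have iy v : v \in y *: W -> iter #|W| g v = v.
  by rewrite -fullW => Ov; rewrite -(card_lcoset W y) -fullW -(cyc_eq gI Ov) iter_card_cyc.
apply: (mulgI y); rewrite -{1}(iy y) ?lcoset_refl // -iter_endoM //.
by rewrite iy // mem_lcoset mulKg.
Qed.

Lemma filled_fix (V : {group gT}) : V \subset W -> stable g V -> V :!=: 1 ->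
  exists2 v, v \in V & (v != 1) && (g v == v).
Proof.
(* Only on [W] is the order of [g] known to be a power of [p]; extending by the identity gives a
   permutation of the whole type with that property, so that fixed points can be counted modulo
   [p]. *)
move=> sVW sV nV; pose h z := if z \in W then g z else z.
have hI : injective h.
  move=> u v; rewrite /h; case: ifP => Wu; case: ifP => Wv; first exact: gI.
  - by move=> e; rewrite -e sW in Wv.
  - by move=> e; rewrite e sW in Wu.
  by [].
pose s := perm hI; have pS : p.-group <[s]>.
  have s1 : s ^+ #|W| = 1.
    apply/permP=> z; rewrite permX perm1.
    have [Wz|nWz] := boolP (z \in W).
      have sE k : iter k s z = iter k g z.
        by elim: k => //= k ->; rewrite permE /h stable_iter.
      by rewrite sE filled_iter.
    by elim: #|W| => //= k ->; rewrite permE /h (negPf nWz).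
  apply: pnat_dvd pW; rewrite -orderE order_dvdn s1; exact: eqxx.
have actsV : [acts <[s]>, on V | 'P].
  rewrite cycle_subG !inE /=; apply/subsetP=> v Vv; rewrite inE apermE permE.
  by rewrite /h (subsetP sVW) // sV.
have fixE v : (v \in 'Fix_(V | 'P)(<[s]>)) = (v \in V) && (h v == v).
  rewrite in_setI afix_cycle ?in_setT //; congr (_ && _).
  by apply/afix1P/eqP; rewrite /= apermE permE.
have hV v : v \in V -> h v = g v by move=> Vv; rewrite /h (subsetP sVW).
have := pgroup_fix_mod pS actsV; rewrite (cardsD1 1 'Fix_(V | 'P)(<[s]>)).
have [_ pV _] := pgroup_pdiv (pgroupS sVW pW) nV.
rewrite (eqP pV : #|V| %% p = 0)%N fixE hV ?group1 // (endo1 gM) eqxx => e.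
have /card_gt0P[v] : 0 < #|'Fix_(V | 'P)(<[s]>) :\ 1|.
  rewrite lt0n; apply/eqP=> e0; move: e.
  by rewrite e0 addn0 modn_small ?prime_gt1.
rewrite in_setD1 fixE => /and3P[nv Vv]; rewrite hV // => gv; exists v => //.
by rewrite nv gv.
Qed.

Local Notation N := (fun c => c^-1 * g c).

Let NW j c : c \in W -> iter j N c \in W.
Proof. by move=> Wc; elim: j => //= j IHj; rewrite groupM ?groupV ?sW. Qed.

Let NM j : {in W &, {morph iter j N : u v / u * v}}.
Proof.
move=> u v Wu Wv; elim: j => //= j ->; rewrite gM invMg.
have com s t : s \in W -> t \in W -> s * t = t * s.
  by move=> Ws Wt; apply: (centsP (abelem_abelian abW)).
have [Wu' Wv'] : iter j N u \in W /\ iter j N v \in W by split; apply: NW.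
rewrite (com (iter j N v)^-1) ?groupV // -!mulgA; congr (_ * _).
by rewrite mulgA (com (iter j N v)^-1) ?groupV ?sW // -mulgA.
Qed.

Let gN j c : g (iter j N c) = iter j N (g c).
Proof. by elim: j => //= j <-; rewrite gM endoV. Qed.

Let N1 j : iter j N 1 = 1.
Proof. by elim: j => //= j ->; rewrite (endo1 gM) mulVg. Qed.

(** Additively, the kernel of [(g - 1)^j] on [W]. The chain of these kernels measures how unipotent
    [g] is. *)
Definition diff_ker j := [set c in W | iter j N c == 1].

Lemma diff_ker_group j : group_set (diff_ker j).
Proof.
apply/group_setP; split=> [|u v]; first by rewrite inE group1 N1 eqxx.
move=> /setIdP[Wu /eqP u1] /setIdP[Wv /eqP v1].
by rewrite inE groupM //= NM // u1 v1 mulg1 eqxx.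
Qed.

Canonical diff_ker_grp j := Group (diff_ker_group j).

Lemma diff_ker_sub j : diff_ker j \subset W.
Proof. by apply/subsetP=> c /setIdP[]. Qed.

Lemma diff_ker_stable j : stable g (diff_ker j).
Proof.
by move=> c /setIdP[Wc /eqP c1]; rewrite inE sW // -gN c1 (endo1 gM) eqxx.
Qed.

Lemma diff_kerS j : diff_ker j \subset diff_ker j.+1.
Proof.
apply/subsetP=> c /setIdP[Wc /eqP c1].
by rewrite inE Wc /= c1 (endo1 gM) mulVg eqxx.
Qed.

Lemma diff_ker_diff j c : c \in diff_ker j.+1 -> N c \in diff_ker j.
Proof. by case/setIdP=> Wc c1; rewrite inE -iterSr c1 (NW 1). Qed.

Lemma diff_ker1 c : c \in diff_ker 1 -> g c = c.
Proof.
by case/setIdP=> _ /eqP c1; rewrite -[RHS]mulg1 -[in RHS]c1 /= mulKVg.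
Qed.

(** The image of [(g - 1)^j] is a nontrivial stable subgroup, so it contains a nontrivial fixed
    point of [g]; a preimage of it is new in the next kernel. *)
Lemma diff_ker_grow j : diff_ker j != W -> #|diff_ker j|.*2 <= #|diff_ker j.+1|.
Proof.
move=> nKW; pose V := iter j N @: W.
have gV : group_set V.
  apply/group_setP; split=> [|_ _ /imsetP[u Wu ->] /imsetP[v Wv ->]].
    by apply/imsetP; exists 1; rewrite ?N1.
  by apply/imsetP; exists (u * v); rewrite ?groupM ?NM.
have sVW : Group gV \subset W by apply/subsetP=> _ /imsetP[c Wc ->]; apply: NW.
have sV : stable g (Group gV).
  by move=> _ /imsetP[c Wc ->]; apply/imsetP; exists (g c); rewrite ?sW.
have nV : Group gV :!=: 1.
  apply: contra nKW => /eqP V1; rewrite eqEsubset diff_ker_sub.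
  apply/subsetP=> c Wc; rewrite inE Wc -in_set1.
  by have : iter j N c \in Group gV; [apply: imset_f | rewrite V1].
have [v /imsetP[c Wc ->] /andP[nv /eqP gv]] := filled_fix sVW sV nV.
have prK : diff_ker j \proper diff_ker j.+1.
  apply/properP; split; first exact: diff_kerS.
  by exists c; rewrite inE Wc //= gv mulVg.
rewrite -(Lagrange (diff_kerS j)) -muln2 leq_mul2l.
by rewrite indexg_gt1 (proper_subn prK) orbT.
Qed.

Let iter_fixed k u : g u = u -> iter k g u = u.
Proof. by move=> gu; elim: k => //= k ->. Qed.

(** The second kernel has order at most [p] by [filled_card_odd]. Were the first one proper in [W],
    it would have order at least [p] and the second at least [2 p]. *)
Lemma filled_abelem_odd : odd p -> #|W| <= p.
Proof.
move=> op; have [->|nW1] := eqVneq (W : {set gT}) 1.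
  by rewrite cards1 prime_gt0.
have le2 : #|diff_ker 2| <= p.
  have sK := @diff_ker_stable 2.
  have [full _] := filled_block gM gI (diff_ker_sub 2) sK fullW.
  apply: (filled_card_odd (iter_endoM gM _) (iter_endo_inj gI (i := _)) pr_p op _ full).
  - exact: abelemS (diff_ker_sub 2) abW.
  - by move=> c Kc; apply: stable_iter.
  move=> t Kt; set m := #|W : _|.
  have : t^-1 * iter m g t \in diff_ker 1.
    apply: (diff_iter_mem (S := diff_ker_grp 1) gM); first exact: diff_ker_stable.
    exact: (diff_ker_diff (j := 1)).
  by move/diff_ker1/iter_fixed.
have [K1|nK1] := eqVneq (diff_ker 1) W.
  apply: leq_trans le2; apply: subset_leq_card.
  by rewrite -K1; apply: diff_kerS.
have K0 : diff_ker 0 = 1.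
  by apply/setP=> c; rewrite !inE /= andbC; case: eqP => // ->; rewrite group1.
have := diff_ker_grow nK1; have := @diff_ker_grow 0.
rewrite K0 eq_sym cards1 => /(_ nW1) K1gt.
have pK1 : p.-group (diff_ker_grp 1) := pgroupS (diff_ker_sub 1) pW.
have nK : diff_ker_grp 1 :!=: 1 by rewrite -cardG_gt1.
have [_ pK _] := pgroup_pdiv pK1 nK.
have := dvdn_leq (cardG_gt0 (diff_ker_grp 1)) pK.
move: le2 (prime_gt0 pr_p) K1gt => /=; move: #|diff_ker 1| #|diff_ker 2| => k1 k2; lia.
Qed.

(** If the second kernel were proper in [W], the first three would have orders at least 2, 4 and 8,
    whereas [filled_card_two] bounds the third by 4. *)
Lemma filled_abelem_two : p = 2 -> #|W| <= 4.
Proof.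
move=> p2; have [->|nW1] := eqVneq (W : {set gT}) 1; first by rewrite cards1.
have le3 : #|diff_ker 3| <= 4.
  have sK := @diff_ker_stable 3.
  have [full _] := filled_block gM gI (diff_ker_sub 3) sK fullW.
  apply: (filled_card_two (iter_endoM gM _) (iter_endo_inj gI (i := _)) _ full).
  - by have := abelemS (diff_ker_sub 3) abW; rewrite {1}p2.
  - by move=> c Kc; apply: stable_iter.
  move=> t d Kt ->; set m := #|W : _|.
  have Kd j c : c \in diff_ker j.+1 -> c^-1 * iter m g c \in diff_ker j.
    move=> Kc; apply: (diff_iter_mem (S := diff_ker_grp j) gM).
      exact: diff_ker_stable.
    exact: diff_ker_diff.
  by have /Kd/Kd/diff_ker1/iter_fixed := Kt.
have [K2|nK2] := eqVneq (diff_ker 2) W.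
  apply: leq_trans le3; apply: subset_leq_card.
  by rewrite -K2; apply: diff_kerS.
have [K1|nK1] := eqVneq (diff_ker 1) W.
  case/eqP: nK2; apply/eqP; rewrite eqEsubset diff_ker_sub.
  by rewrite -K1 diff_kerS.
have K0 : diff_ker 0 = 1.
  by apply/setP=> c; rewrite !inE /= andbC; case: eqP => // ->; rewrite group1.
have := diff_ker_grow nK2; have := diff_ker_grow nK1; have := @diff_ker_grow 0.
rewrite K0 eq_sym cards1 => /(_ nW1).
move: le3; move: #|diff_ker 1| #|diff_ker 2| #|diff_ker 3| => k1 k2 k3; lia.
Qed.

End FilledAbelem.

(** * The complement of the cycle: a subgroup of index 2 *)

Section IndexTwo.

Variables (gT : finGroupType) (f : gT -> gT) (x : gT) (A : {group gT}).
Hypotheses (fM : {morph f : y z / y * z}) (fI : injective f).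
Hypotheses (gt2 : 2 < #|[set: gT]|) (long : #|[set: gT]| <= #|cyc f x|.*2).
Hypotheses (nA : A != [set: gT] :> {set gT}) (sOA : cyc f x \subset x *: A).

Local Notation O := (cyc f x).
Local Notation G := [set: gT].

Lemma two_cardA : #|A|.*2 = #|G|.
Proof. by case: (long_lcoset_half fM fI gt2 long nA sOA). Qed.

Lemma two_cycC : O = ~: A.
Proof. by case: (long_lcoset_half fM fI gt2 long nA sOA). Qed.

Lemma two_full : O = x *: A.
Proof.
apply/eqP; rewrite eqEcard sOA card_lcoset.
by rewrite -leq_double two_cardA.
Qed.

Lemma two_stable : stable f A.
Proof.
move=> c Ac; apply: contraT => nAc; have : f c \in O by rewrite two_cycC inE.
move/(stableV fI (@cyc_stable _ f x)).
by rewrite two_cycC inE Ac.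
Qed.

Lemma two_cycE y : (y \in O) = (x^-1 * y \in A).
Proof. by rewrite two_full mem_lcoset. Qed.

Lemma two_xA c : c \in A -> x * c \in O.
Proof. by rewrite two_cycE mulKg. Qed.

(** On [A] the inverting power is inversion followed by conjugation by [x]. It is a morphism, so
    inversion is one on [A]. *)
Lemma two_abelian : abelian A.
Proof.
have [i ix] := long_inverter fM fI gt2 long.
have iA c : c \in A -> iter i f c = x * c^-1 * x^-1.
  by move=> Ac; apply: (inverter_lcoset fM ix (cyc_refl x)); apply: two_xA.
apply/centsP=> c Ac d Ad; have := iA (c * d); rewrite groupM // => /(_ isT).
rewrite iter_endoM // !iA // invMg !mulgA mulgKV => /mulIg.
rewrite -!mulgA => /mulgI/(congr1 invg); rewrite !invMg !invgK.
by move=> e; rewrite /commute e.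
Qed.

Lemma two_block (B : {group gT}) : B \subset A -> stable f B ->
  cyc (iter #|A : B| f) x = x *: B /\
  (forall i, (iter i f x \in x *: B) = (#|A : B| %| i)).
Proof. by move=> sBA sB; apply: filled_block sBA sB two_full. Qed.

Lemma two_block_any (B : {group gT}) y i : B \subset A -> stable f B -> y \in O ->
  (iter i f y \in y *: B) = (#|A : B| %| i).
Proof.
move=> sBA sB Oy; have fullY : cyc f y = y *: A.
  by rewrite (cyc_eq fI Oy) two_full; apply/esym/lcoset_eqP; rewrite -two_full.
by have [_ ->] := filled_block fM fI sBA sB fullY.
Qed.

Lemma two_iter i : #|A| %| i -> forall y, iter i f y = y.
Proof.
move=> nA_i; apply: (long_iter_full fM fI gt2 long); apply/eqP.
by rewrite iter_eq_dvdn // two_full card_lcoset.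
Qed.

Local Notation b := (x^-1 * f x).

(** By telescoping the cycle stays in [x B], yet it fills [x A]. *)
Lemma two_gen (B : {group gT}) : stable f B -> b \in B -> A \subset B.
Proof.
move=> sB Bb; have sOB : O \subset x *: B.
  apply/subsetP=> _ /cycP[i ->]; rewrite mem_lcoset.
  by apply: (diff_iter_mem fM).
by rewrite -(lcosetS x A B) -two_full.
Qed.

Lemma two_Ab : b \in A.
Proof. by rewrite -two_cycE (mem_cyc f x 1). Qed.

Definition tor p := [set c in A | c ^+ p == 1].

Lemma tor_group p : group_set (tor p).
Proof.
apply/group_setP; split=> [|u v]; first by rewrite inE group1 expg1n eqxx.
move=> /setIdP[Au /eqP u1] /setIdP[Av /eqP v1]; rewrite inE groupM //=.
by rewrite expgMn ?u1 ?v1 ?mulg1 //; apply: (centsP two_abelian).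
Qed.

Canonical tor_grp p := Group (tor_group p).

Lemma tor_sub p : tor p \subset A.
Proof. by apply/subsetP=> c /setIdP[]. Qed.

Lemma tor_stable p : stable f (tor p).
Proof.
move=> c /setIdP[Ac /eqP c1].
by rewrite inE two_stable //= -(endoX fM) c1 (endo1 fM) eqxx.
Qed.

Lemma tor_abelem p : prime p -> p.-abelem (tor p).
Proof.
move=> pr_p; apply/abelemP=> //; split; first exact: abelianS (tor_sub p) two_abelian.
by move=> c /setIdP[_ /eqP].
Qed.

Lemma tor_odd p : prime p -> odd p -> #|tor p| <= p.
Proof.
move=> pr_p op; have [full _] := two_block (tor_sub p) (@tor_stable p).
apply: (filled_abelem_odd (iter_endoM fM _) (iter_endo_inj fI (i := _)) pr_p) => //.
- exact: (tor_abelem pr_p).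
- by move=> c tc; apply: stable_iter => //; apply: tor_stable.
exact: full.
Qed.

Lemma tor_two : #|tor 2| <= 4.
Proof.
have [full _] := two_block (tor_sub 2) (@tor_stable 2).
apply: (filled_abelem_two (iter_endoM fM _) (iter_endo_inj fI (i := _)) (isT : prime 2)) => //.
- exact: tor_abelem.
- by move=> c tc; apply: stable_iter => //; apply: tor_stable.
exact: full.
Qed.

Lemma tor2_sq u : u \in tor 2 -> u * u = 1.
Proof. by case/setIdP=> _ /eqP; rewrite expgS expg1. Qed.

Lemma tor2_mul u v : u \in tor 2 -> v \in tor 2 -> u * v \in tor 2.
Proof. by move=> tu tv; apply: (groupM (G := tor_grp 2)). Qed.

Lemma tor2_enum u v : #|tor 2| = 4 -> u \in tor 2 -> v \in tor 2 ->
  u != 1 -> v != 1 -> u != v -> tor 2 = [set 1; u; v; u * v].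
Proof.
move=> t4 tu tv nu nv nuv; apply/esym/eqP; rewrite eqEcard t4; apply/andP; split.
  apply/subsetP=> w; rewrite !in_setU !in_set1 -!orbA.
  by case/or4P=> /eqP-> //; apply: tor2_mul.
rewrite !cardsU !cards1 (_ : [set 1] :&: [set u] = set0) ?cards0; last first.
  by apply/setP=> w; rewrite !inE; apply/andP=> -[/eqP-> /eqP e]; rewrite e eqxx in nu.
rewrite (_ : [set 1; u] :&: [set v] = set0) ?cards0; last first.
  apply/setP=> w; rewrite !inE; apply/andP=> -[/orP[]/eqP-> /eqP e].
    by rewrite -e eqxx in nv.
  by rewrite e eqxx in nuv.
rewrite (_ : [set 1; u; v] :&: [set u * v] = set0) ?cards0 //.
apply/setP=> w; rewrite !inE; apply/andP=> -[/orP[/orP[]|]/eqP-> /eqP e].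
- case/eqP: nuv; apply: (mulgI u); rewrite -e; exact: tor2_sq.
- by case/eqP: nv; apply: (mulgI u); rewrite -e mulg1.
- by case/eqP: nu; apply: (mulIg v); rewrite -e mul1g.
Qed.

(** The return map [g] to [x tor 2] has a nontrivial fixed point. If it had two, it would be trivial
    on [tor 2], so [g^2] would fix [x] and the cycle could not fill 4 elements. As [f] commutes with
    [g], it fixes the only such [u]. *)
Lemma tor2_fix : 1 < #|tor 2| -> exists u, [/\ u \in tor 2, u != 1, f u = u &
  forall v, v \in tor 2 -> iter #|A : tor 2| f v = v -> v = 1 \/ v = u].
Proof.
move=> t1; set m := #|A : tor 2|.
have [full _] := two_block (tor_sub 2) (@tor_stable 2).
have gM := iter_endoM fM m; have gI := iter_endo_inj fI (i := m).
have gst : stable (iter m f) (tor 2).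
  by move=> c tc; apply: stable_iter => //; apply: tor_stable.
have pr2 : prime 2 by [].
have [|u tu /andP[nu /eqP gu]] :=
  filled_fix (W := tor_grp 2) gM gI pr2 (tor_abelem pr2) gst full
    (subxx _) gst.
  by rewrite -cardG_gt1.
have two_of v : v \in tor 2 -> iter m f v = v -> v = 1 \/ v = u.
  move=> tv gv; have [->|nv] := eqVneq v 1; first by left.
  have [->|nvu] := eqVneq v u; first by right.
  have le3 : 3 <= #|tor 2|.
    rewrite (cardsD1 1) (cardsD1 u) (cardsD1 v) !inE nv nu nvu /=.
    have := tv; have := tu; rewrite !inE => -> ->.
    by rewrite (group1 A) expg1n eqxx.
  have t4 : #|tor 2| = 4.
    have := tor_two; have := card_pgroup (abelem_pgroup (tor_abelem (isT : prime 2))).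
    move: le3; rewrite /=; move: #|tor 2| => k k3 kE k4.
    by move: k3 k4; rewrite kE; case: (logn 2 k) => [|[|[|a]]] //; rewrite !expnS; lia.
  have tE := tor2_enum t4 tu tv nu nv; rewrite eq_sym in nvu; have {}tE := tE nvu.
  have g1 w : w \in tor 2 -> iter m f w = w.
    rewrite tE !inE -!orbA; case/or4P=> /eqP-> //; first exact: (endo1 gM).
    by rewrite gM gu gv.
  have := card_cyc_iterI gI (i := 2) (x := x); rewrite -/m in full.
  rewrite full card_lcoset t4 => /(_ isT) le2.
  pose t := x^-1 * iter m f x; have xt : iter m f x = x * t by rewrite mulKVg.
  have tt : t \in tor 2 by rewrite -mem_lcoset -full (mem_cyc (iter m f) x 1).
  have : 4 <= 2 by apply: le2; rewrite /= xt gM xt g1 // -mulgA tor2_sq // mulg1.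
  by [].
exists u; split=> //; have [] := two_of (f u) => //.
- exact: tor_stable.
- by rewrite -iterSr iterS gu.
by move=> fu; case/eqP: nu; apply: fI; rewrite fu (endo1 fM).
Qed.

Lemma tor2_fixed v u : u \in tor 2 -> u != 1 -> f u = u -> v \in tor 2 -> f v = v ->
  v = 1 \/ v = u.
Proof.
move=> tu nu fu tv fv; have fixm w : f w = w -> iter #|A : tor 2| f w = w.
  by move=> fw; elim: #|_ : _| => //= k ->.
have t1 : 1 < #|tor 2| by rewrite (cardG_gt1 (tor_grp 2)); apply/trivgPn; exists u.
have [u' [_ _ _ two_of]] := tor2_fix t1.
case: (two_of v tv (fixm v fv)) => ->; first by left.
by case: (two_of u tu (fixm u fu)) => uE; [rewrite uE eqxx in nu | right].
Qed.

Lemma tor4_odd_index : #|tor 2| = 4 -> odd #|A : tor 2|.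
Proof.
move=> t4; have [|u [tu nu fu two_of]] := tor2_fix; first by rewrite t4.
apply: contraT => ev; set h := #|A : tor 2|./2.
have mE : #|A : tor 2| = (h + h)%N by rewrite addnn -[LHS]odd_double_half (negPf ev).
have hu : iter h f u = u by elim: (h) => //= k ->.
have /subsetPn[v tv] : ~~ (tor 2 \subset [set 1; u]).
  apply/negP=> /subset_leq_card; rewrite t4 cards2; by case: (_ != _).
rewrite !inE negb_or => /andP[nv nvu].
have hv : iter h f v \in tor 2 by apply: stable_iter => //; apply: tor_stable.
have hI := iter_endo_inj fI (i := h); have hM := iter_endoM fM h.
have tE : tor 2 = [set 1; u; v; u * v] by apply: tor2_enum; rewrite // eq_sym.
have [||v1|vu] := two_of v; rewrite ?v1 ?vu ?eqxx // in nv nvu *.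
rewrite mE iterD; move: hv; rewrite {1}tE !inE -!orbA; case/or4P=> /eqP hv.
- by case/eqP: nv; apply: hI; rewrite hv (endo1 hM).
- by case/eqP: nvu; apply: hI; rewrite hv hu.
- by rewrite !hv.
by rewrite hv hM hu hv mulgA tor2_sq // mul1g.
Qed.

(** Since [f^(2 i)] is trivial, either [f^i] is trivial, whence [x^2 = 1], or [i] is an odd multiple
    of half the period. Then [f^i x] stays in [x <u>], [u] being the fixed involution, which gives
    [x^2 = u]. In both cases [f^i] fixes [A], and its other description makes [x] invert [A]. *)
Lemma two_structure :
  [/\ {in A, forall c, x * c * x^-1 = c^-1}, x * x \in tor 2 & f (x * x) = x * x].
Proof.
have [i ix] := long_inverter fM fI gt2 long.
have iA c : c \in A -> iter i f c = x * c^-1 * x^-1.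
  by move=> Ac; apply: (inverter_lcoset fM ix (cyc_refl x)); apply: two_xA.
have iV c : c \in A -> iter i f c = c -> x * c * x^-1 = c^-1.
  by move=> Ac ic; have := iA c^-1; rewrite groupV invgK => <- //; rewrite -{2}ic (endoV (iter_endoM fM i)).
have [n_i|n_i] := boolP (#|A| %| i).
  have id_i := two_iter n_i; have x2 : x * x = 1 by rewrite -{1}[x]id_i ix mulVg.
  split; last by rewrite x2 (endo1 fM).
    by move=> c Ac; apply: iV.
  by rewrite x2; apply: (group1 (tor_grp 2)).
have n_2i : #|A| %| i + i.
  have cA : #|O| = #|A| by rewrite two_full card_lcoset.
  by rewrite -cA -iter_eq_dvdn // iterD ix (endoV (iter_endoM fM i)) ix invgK.
have evA : 2 %| #|A|.
  rewrite dvdn2; apply: contra n_i => oA; rewrite -(@Gauss_dvdr _ 2) ?mul2n -?addnn //.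
  by rewrite coprimen2.
have t1 : 1 < #|tor 2|.
  have [c Ac oc] := Cauchy (isT : prime 2) evA.
  rewrite (cardG_gt1 (tor_grp 2)); apply/trivgPn; exists c; last by rewrite -order_gt1 oc.
  by rewrite inE Ac -oc expg_order eqxx.
have [u [tu nu fu _]] := tor2_fix t1; have u2 := tor2_sq tu.
have ou : #[u] = 2 by apply: nt_prime_order; rewrite // expgS expg1.
have Au : <[u]> \subset A by rewrite cycle_subG; case/setIdP: tu.
have sU : stable f <[u]>.
  by move=> _ /cycleP[k ->]; rewrite (endoX fM) fu mem_cycle.
have iU : #|A : <[u]>| %| i.
  have := Lagrange Au; rewrite -orderE ou => cA.
  by move: n_2i; rewrite -cA addnn -mul2n dvdn_pmul2l.
have [_ /(_ i)] := two_block Au sU; rewrite iU ix mem_lcoset -invMg groupV => Ux2.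
(* If [x^2 = 1], then [f^i] fixes [x], so that the period [#|A|] divides [i]. *)
have x2u : x * x = u.
  have : x * x \in [set 1; u] by rewrite -cycle2g.
  rewrite !inE => /orP[]/eqP // x21.
  case/negP: n_i; have cA : #|O| = #|A| by rewrite two_full card_lcoset.
  rewrite -cA -iter_eq_dvdn // ix; apply/eqP/(mulgI x); by rewrite mulgV x21.
rewrite x2u fu; split=> //.
(* Multiplying [x] by the fixed element [u] leaves [x^-1 f(x)] unchanged, so [f^i] fixes [b], and
   with it [A]. *)
have ixu : iter i f x = x * u.
  by rewrite ix; apply: (mulgI x); rewrite mulgV mulgA x2u u2.
pose F := [set c in A | iter i f c == c].
have gF : group_set F.
  apply/group_setP; split=> [|s t]; first by rewrite inE group1 (endo1 (iter_endoM fM i)) eqxx.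
  by case/setIdP=> As /eqP is1 /setIdP[At /eqP it]; rewrite inE groupM // iter_endoM // is1 it eqxx.
have /subsetP sAF : A \subset Group gF.
  apply: two_gen.
    by move=> c /setIdP[Ac /eqP ic]; rewrite inE two_stable //= -iterSr iterS ic.
  rewrite inE two_Ab /= iter_endoM // (endoV (iter_endoM fM i)) -iterSr iterS ixu fM fu.
  rewrite invMg -mulgA; apply/eqP.
  have comu c : c \in A -> u * c = c * u.
    by move=> Ac; apply: (centsP two_abelian) => //; rewrite -cycle_subG.
  by rewrite (mulgA x^-1) -(comu b) ?two_Ab // mulgA mulVg mul1g.
by move=> c Ac; apply: iV => //; have /setIdP[_ /eqP] := sAF c Ac.
Qed.

End IndexTwo.

(** A fixed point of [c |-> 1 + m c] modulo [p], with the congruence spelled out in natural numbers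
    so that it can be read in exponents. *)
Lemma fixpoint_mod_prime p m : prime p -> m != 1 %[mod p] ->
  exists j s t, (1 + m * j + p * s = j + p * t)%N.
Proof.
move=> pr_p nm; have p1 := prime_gt1 pr_p; pose a := (m + p.-1)%N.
have cap : coprime a p.
  rewrite coprime_sym prime_coprime //; apply: contra nm => /dvdnP[k aE].
  apply/eqP; rewrite -(modnMDl k 1) -aE /a.
  have -> : (m + p.-1 + 1 = m + p)%N by lia.
  by rewrite modnDr.
have a0 : 0 < a by rewrite /a; lia.
have [[u v] /= uvE] := coprimeP _ a0 cap.
(* [a] stands for [m - 1] and [u] for its inverse, so [j] stands for [-(m - 1)^-1]. *)
exists (u * p.-1)%N, (u * p.-1)%N, (1 + v * p.-1)%N.
have uE : (u * a = 1 + v * p)%N by lia.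
rewrite /a in uE; have pE : p = p.-1.+1 by lia.
move: uE; rewrite pE; move: p.-1 => q; nia.
Qed.

Lemma mod4_three m : m = 1 %[mod 2] -> m != 1 %[mod 4] -> m.+1 %% 4 = 0.
Proof. by rewrite -addn1; lia. Qed.

Lemma odd_sqr_pred4 o : odd o -> 4 %| (o * o)%N.-1.
Proof.
move=> oo; rewrite -(odd_double_half o) oo; move: o./2 => h.
by apply/dvdnP; exists (h * h.+1)%N; lia.
Qed.

(** * Generators and parameters in the index 2 case *)

Section IndexTwoParameters.

Variables (gT : finGroupType) (f : gT -> gT) (x : gT) (A : {group gT}).
Hypotheses (fM : {morph f : y z / y * z}) (fI : injective f).
Hypotheses (gt2 : 2 < #|[set: gT]|) (long : #|[set: gT]| <= #|cyc f x|.*2).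
Hypotheses (nA : A != [set: gT] :> {set gT}) (sOA : cyc f x \subset x *: A).

Local Notation O := (cyc f x).
Local Notation b := (x^-1 * f x).

Let abA := two_abelian fM fI gt2 long nA sOA.
Let stA := two_stable fM fI gt2 long nA sOA.
Let Ab := two_Ab fM fI gt2 long nA sOA.

(** Otherwise take [j] from [fixpoint_mod_prime]: [f] maps [x r^j] into its own coset of
    [B = V <r^p>], although it permutes the cosets of [B] in [x A] in a single cycle of length
    [#|A : B| > 1]. *)
Lemma two_one_mod (V : {group gT}) v r m p :
    V \subset A -> stable f V -> v \in V -> r \in A -> f r = r ^+ m ->
    f x = x * v * r -> prime p -> #|V <*> <[r ^+ p]>| < #|A| ->
  m = 1 %[mod p].
Proof.
move=> sVA sV Vv Ar fr fx pr_p ltB; apply/eqP; apply: contraT => nm.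
have [j [s [t jE]]] := fixpoint_mod_prime pr_p nm.
set B := (V <*> <[r ^+ p]>)%G.
have sBA : B \subset A by rewrite join_subG sVA cycle_subG groupX.
have Bp k : (r ^+ p) ^+ k \in B.
  by rewrite (subsetP (joing_subr V <[r ^+ p]>)) // mem_cycle.
have sB : stable f B.
  rewrite /B /=; apply: stable_gen => // c; rewrite !inE => /orP[Vc|].
    by rewrite sV.
  case/cycleP=> k ->; rewrite !(endoX fM) fr.
  have -> : ((r ^+ m) ^+ p) ^+ k = (r ^+ p) ^+ (m * k) by rewrite -!expgM; congr (_ ^+ _); lia.
  by rewrite mem_cycle orbT.
have com c d : c \in A -> d \in A -> c * d = d * c.
  by move=> Ac Ad; apply: (centsP abA).
have Oy : x * r ^+ j \in O by apply: (two_xA fM fI gt2 long nA sOA); rewrite groupX.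
have := two_block_any fM fI gt2 long nA sOA 1 sBA sB Oy.
have -> : iter 1 f (x * r ^+ j) \in x * r ^+ j *: B.
  rewrite /= fM (endoX fM) fr fx mem_lcoset invMg -!mulgA mulKg.
  have -> : r * (r ^+ m) ^+ j = r ^+ (1 + m * j) by rewrite expgD expg1 expgM.
  have Av : v \in A by apply: (subsetP sVA).
  rewrite mulgA (com _ v) ?groupV ?groupX // -mulgA groupM //.
    by rewrite (subsetP (joing_subl _ _)).
  have -> : r ^+ (1 + m * j) = r ^+ j * ((r ^+ p) ^+ t * (r ^+ p) ^- s).
    apply: (mulIg ((r ^+ p) ^+ s)); rewrite -!mulgA mulVg mulg1 -!expgM -!expgD.
    by rewrite jE.
  by rewrite mulKg groupM ?groupV.
move/esym; rewrite dvdn1 indexg_eq1 => /subset_leq_card.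
by rewrite leqNgt ltB.
Qed.

Lemma rank1_cyclic (B : {group gT}) : B \subset A ->
  (forall p, prime p -> #|B :&: tor A p| <= p) -> cyclic B.
Proof.
move=> sBA le_p; rewrite abelian_rank1_cyclic ?(abelianS sBA) //.
have [p pr_p ->] := rank_witness B.
have [E] := p_rank_geP (leqnn 'r_p(B)).
case/pnElemP=> sEB abE <-; have := card_pgroup (abelem_pgroup abE).
have : #|E| <= p.
  apply: leq_trans (le_p p pr_p); apply: subset_leq_card; rewrite subsetI sEB.
  apply/subsetP=> e Ee; rewrite inE (subsetP sBA) ?(subsetP sEB) //=.
  by case/abelemP: abE => // _ ->.
by move=> leE EE; rewrite -(leq_exp2l _ _ (prime_gt1 pr_p)) expn1 -EE.
Qed.

Lemma tor2_card : #|tor A 2| != 4 -> #|tor A 2| <= 2.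
Proof.
have := tor_two fM fI gt2 long nA sOA.
pose T := tor_grp fM fI gt2 long nA sOA 2.
have abT : 2.-abelem T by apply: (tor_abelem fM fI gt2 long nA sOA).
have := card_pgroup (abelem_pgroup abT).
rewrite /=; move: #|tor A 2| => k kE; rewrite kE.
by case: (logn 2 k) => [|[|[|a]]] //; rewrite !expnS; lia.
Qed.

(** [f c] has the order of [c], and a cyclic group has only one subgroup of each order. *)
Lemma cyclic_stable (B : {group gT}) c : cyclic B -> stable f B -> c \in B ->
  f c \in <[c]>.
Proof.
move=> cB sB Bc; have Bfc := sB c Bc.
rewrite -cycle_subG; suff -> : <[f c]> = <[c]> by [].
apply/eqP; rewrite (eq_subG_cyclic cB) ?cycle_subG // -!orderE.
have fX k : f c ^+ k = 1 <-> c ^+ k = 1.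
  by rewrite -(endoX fM); split=> [|->]; rewrite ?(endo1 fM) // -{1}(endo1 fM) => /fI.
rewrite eqn_dvd !order_dvdn; apply/andP; split; apply/eqP; apply/fX; exact: expg_order.
Qed.

Theorem two_cyclic : #|tor A 2| != 4 -> exists m k,
  [/\ A = <[b]>%G, f b = b ^+ m, x * x = b ^+ k,
      k = 0 \/ ~~ odd #|A| /\ k = #|A| %/ 2
    & [/\ m < #|A|, one_mod_primes #|A| m & 4 %| #|A| -> m = 1 %[mod 4]]].
Proof.
move=> t4; have cA : cyclic A.
  apply: (rank1_cyclic (subxx A)) => p pr_p.
  apply: leq_trans (subset_leq_card (subsetIr _ _)) _.
  case: (even_prime pr_p) => [->|op]; first exact: tor2_card.
  exact: (tor_odd fM fI gt2 long nA sOA).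
have sb : stable f <[b]>.
  move=> c bc; have Ac : c \in A by apply: subsetP bc; rewrite cycle_subG.
  apply: (subsetP (_ : <[c]> \subset <[b]>)); first by rewrite cycle_subG.
  exact: cyclic_stable cA stA Ac.
have AE : A = <[b]>%G.
  apply/group_inj/eqP; rewrite eqEsubset cycle_subG Ab andbT.
  by apply: (two_gen fM fI gt2 long nA sOA sb); apply: cycle_id.
have cardA : #|A| = #[b] by rewrite {1}AE.
have [m ltm fb] := cyclePmin (sb b (cycle_id b)).
have [_ x2 _] := two_structure fM fI gt2 long nA sOA.
have A2 : x * x \in <[b]> by case/setIdP: x2 => + _; rewrite {1}AE.
have [k ltk kE] := cyclePmin A2.
exists m, k; split=> //.
  (* [b^k] has order at most 2 and [k] is below the order of [b]. *)
  case: (posnP k) => [|k0]; first by left.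
  right; move/tor2_sq: x2; rewrite kE -expgD => /eqP.
  rewrite -order_dvdn cardA addnn -muln2 => /dvdnP[q qE].
  have q1 : q = 1%N by move: ltk k0 qE; nia.
  by move: qE; rewrite q1 mul1n => <-; rewrite mulnK // oddM andbF.
have b0 : 0 < #|A| by apply: cardG_gt0.
have nb p : 1 < p -> p %| #|A| -> #|<[b ^+ p]>| < #|A|.
  move=> p1 pA; rewrite -orderE orderXdiv -?cardA // ltn_Pdiv //.
split; first by rewrite cardA.
  move=> p pr_p pA; apply: (@two_one_mod 1%G 1 b); rewrite ?sub1G ?group1 //.
  - by move=> c /set1gP->; rewrite (endo1 fM) group1.
  - by rewrite mulg1 mulKVg.
  by rewrite joing1G nb // prime_gt1.
move=> A4; have m2 : m = 1 %[mod 2].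
  apply: (@two_one_mod 1%G 1 b); rewrite ?sub1G ?group1 //.
  - by move=> c /set1gP->; rewrite (endo1 fM) group1.
  - by rewrite mulg1 mulKVg.
  by rewrite joing1G nb // (dvdn_trans _ A4).
(* If [m] is 3 modulo 4, then [f^2 x = x b^(1 + m)] is already back in [x <b^4>], which has return
   time 4. *)
apply/eqP; apply: contraT => m4.
have m3 : m.+1 %% 4 = 0 by apply: mod4_three.
have sB : stable f <[b ^+ 4]>.
  move=> _ /cycleP[j ->]; rewrite !(endoX fM) fb.
  have -> : ((b ^+ m) ^+ 4) ^+ j = (b ^+ 4) ^+ (m * j) by rewrite -!expgM; congr (_ ^+ _); lia.
  exact: mem_cycle.
have sBA : <[b ^+ 4]> \subset A by rewrite cycle_subG groupX.
have [_ /(_ 2)] := two_block fM fI gt2 long nA sOA sBA sB.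
have -> : iter 2 f x \in x *: <[b ^+ 4]>.
  rewrite mem_lcoset /=.
  have -> : x^-1 * f (f x) = b * f b by rewrite fM (endoV fM) !mulgA mulgK.
  by rewrite fb -expgS (divn_eq m.+1 4) m3 addn0 mulnC expgM mem_cycle.
have -> : #|A : <[b ^+ 4]>| = 4.
  rewrite -divgS // -orderE orderXdiv -?cardA //.
  have [c cE] := dvdnP A4; rewrite cE mulnK // mulKn //.
  by move: b0; rewrite cE; case: c {cE}.
by [].
Qed.

Theorem two_klein : #|tor A 2| = 4 -> exists o r1 r2 r m k,
  [/\ A = <<[set:: [:: r1; r2; r]]>>%G, #|A| = (4 * o)%N /\ odd o,
      [/\ r1 ^+ 2 = 1, r2 ^+ 2 = 1 & r ^+ o = 1],
      [/\ f r1 = r2, f r2 = r1, f r = r ^+ m & f x = x * r1 * r]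
    & [/\ x * x = (r1 * r2) ^+ k, k <= 1, m < o & one_mod_primes o m]].
Proof.
move=> t4; pose T := tor_grp fM fI gt2 long nA sOA 2.
have sTA : T \subset A by apply: (tor_sub A 2).
have stT : stable f T by apply: (tor_stable fM fI gt2 long nA sOA).
set o := #|A : T|; have oo : odd o by apply: (tor4_odd_index fM fI gt2 long nA sOA).
have cardA : #|A| = (4 * o)%N by rewrite -(Lagrange sTA) t4.
have sq u : u \in T -> u * u = 1 by apply: tor2_sq.
have com c d : c \in A -> d \in A -> c * d = d * c.
  by move=> Ac Ad; apply: (centsP abA).
have oddX u k : u \in T -> odd k -> u ^+ k = u.
  move=> Tu ok; rewrite -(odd_double_half k) ok expgD expg1 -mul2n expgM.
  by rewrite expgS expg1 sq // expg1n mulg1.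
have [|u [Tu nu fu two_of]] := tor2_fix fM fI gt2 long nA sOA; first by rewrite t4.
have ooo : odd (o * o)%N by rewrite oddM oo.
(* [o^2] is 1 modulo 4 and 0 modulo [o], so these are the components of [b] in the Klein four-group
   and in the part of odd order. *)
pose r1 := b ^+ (o * o)%N; pose r := b^-1 ^+ (o * o)%N.-1.
have o0 : 0 < o by case: (o) oo.
have br : b = r1 * r.
  rewrite /r1 /r -{1}(prednK (_ : 0 < o * o)%N) ?muln_gt0 ?o0 // expgS -mulgA.
  by rewrite expgVn mulgV mulg1.
have nTA : T <| A by rewrite /normal sTA sub_abelian_norm.
have Tr1 : r1 \in T.
  have hallT : 2.-Hall(A) T.
    rewrite pHallE sTA t4 cardA partnM // (@part_pnat_id _ 4) //.
    by rewrite part_p'nat // p'natE // dvdn2 negbK.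
  rewrite (mem_normal_Hall hallT nTA) ?groupX //.
  rewrite /p_elt (pnat_dvd (_ : #[r1] %| 2 ^ 2)) ?pnatX ?pnat_id // order_dvdn.
  rewrite -expgM mulnC mulnA -cardA expgM.
  by have := expg_cardG Ab => ->; rewrite expg1n.
have ro : r ^+ o = 1.
  have /dvdnP[q qE] : #|A| %| ((o * o).-1 * o)%N.
    by rewrite cardA dvdn_pmul2r // odd_sqr_pred4.
  by rewrite -expgM qE mulnC expgM expgVn expg_cardG // invg1 expg1n.
have Ar : r \in A by rewrite groupX ?groupV.
(* If [r1] were fixed, [f] would fix the 2-component of every element of [A], hence all of [T]. *)
have fr1 : f r1 != r1.
  apply/eqP=> fr1; pose F := [set c in A | f (c ^+ (o * o)%N) == c ^+ (o * o)%N].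
  have gF : group_set F.
    apply/group_setP; split=> [|s t]; first by rewrite inE group1 expg1n (endo1 fM) eqxx.
    case/setIdP=> As /eqP fs /setIdP[At /eqP ft].
    by rewrite inE groupM //= expgMn ?fM ?fs ?ft //; apply: com.
  have /subsetP sAF : A \subset Group gF.
    apply: (two_gen fM fI gt2 long nA sOA).
      by move=> c /setIdP[Ac /eqP fc]; rewrite inE stA //= -(endoX fM) !fc.
    by rewrite inE Ab fr1 eqxx.
  have sTu : T \subset [set 1; u].
    apply/subsetP=> c Tc; have Ac := subsetP sTA c Tc.
    have /setIdP[_ /eqP] := sAF c Ac; rewrite oddX // => fc.
    rewrite !inE; case: (two_of c Tc) => [|->|->]; rewrite ?eqxx ?orbT //.
    by elim: #|_ : _| => //= k ->.
  have := subset_leq_card sTu; rewrite t4 cards2; by case: (_ != _).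
pose r2 := f r1; have Tr2 : r2 \in T by apply: stT.
have nr1 : r1 != 1 by apply: contraNneq fr1 => ->; rewrite (endo1 fM).
have nr2 : r2 != 1 by rewrite -(endo1 fM) (inj_eq fI).
have TE : tor A 2 = [set 1; r1; r2; r1 * r2].
  by apply: (tor2_enum fM fI gt2 long nA sOA); rewrite // eq_sym.
have uE : u = r1 * r2.
  move: (Tu); rewrite TE !inE -!orbA; case/or4P=> /eqP uE //.
  - by rewrite uE eqxx in nu.
  - by rewrite -uE fu eqxx in fr1.
  by case/eqP: fr1; apply: fI; rewrite -/r2 -uE.
have fr2 : f r2 = r1.
  apply: (mulgI r2); rewrite -{1}/(f r1) -fM -uE fu uE.
  by apply: com; apply: (subsetP sTA).
(* The elements of order dividing the odd [o] have no 2-torsion, and their torsion at odd primes is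
   bounded by [tor_odd]. *)
have cT : cyclic (tor_grp fM fI gt2 long nA sOA o).
  apply: rank1_cyclic; first exact: tor_sub.
  move=> p pr_p; case: (even_prime pr_p) => [->|op]; last first.
    apply: leq_trans (subset_leq_card (subsetIr _ _)) _.
    exact: (tor_odd fM fI gt2 long nA sOA).
  apply: (@leq_trans #|[set 1 : gT]|); last by rewrite cards1.
  apply: subset_leq_card; apply/subsetP=> c /setIP[/setIdP[_ /eqP co] Tc].
  by rewrite inE -co oddX.
have [m ltm fr] : {m | m < #[r] & f r = r ^+ m}.
  apply: cyclePmin; apply: (cyclic_stable cT); last by rewrite inE Ar ro eqxx.
  exact: (tor_stable fM fI gt2 long nA sOA).
have sTr k : T <*> <[r ^+ k]> = T * <[r ^+ k]>.
  apply: cent_joinEr; apply: (centSS _ sTA abA).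
  by rewrite cycle_subG groupX.
have AE : A :=: T <*> <[r]>.
  apply/eqP; rewrite eqEsubset join_subG sTA cycle_subG Ar !andbT.
  apply: (two_gen fM fI gt2 long nA sOA).
    move=> c; apply: (stable_gen fM) => d /setUP[Td|].
      by apply/setUP; left; apply: stT.
    case/cycleP=> k ->; rewrite (endoX fM) fr -expgM.
    by apply/setUP; right; apply: mem_cycle.
  rewrite br groupM //; first by rewrite (subsetP (joing_subl _ _)).
  by rewrite (subsetP (joing_subr _ _)) ?cycle_id.
have or : #[r] = o.
  apply/eqP; rewrite eqn_leq dvdn_leq ?order_dvdn ?ro //=.
  have := mul_cardG T <[r]>; rewrite -[r]expg1 -sTr expg1 -AE cardA t4 -orderE.
  by move=> e; rewrite -(leq_pmul2l (isT : 0 < 4)) e leq_pmulr.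
exists o, r1, r2, r, m.
have [_ x2 fx2] := two_structure fM fI gt2 long nA sOA.
have [k k1 kE] : exists2 k, k <= 1%N & x * x = (r1 * r2) ^+ k.
  have [->|->] := tor2_fixed fM fI gt2 long nA sOA Tu nu fu x2 fx2.
    by exists 0%N.
  by exists 1%N; rewrite ?expg1.
have fx : f x = x * r1 * r by rewrite -mulgA -br mulKVg.
exists k; split=> //.
- apply/group_inj => /=; apply/eqP; rewrite eqEsubset; apply/andP; split.
    have gen s : s \in [:: r1; r2; r] -> s \in <<[set:: [:: r1; r2; r]]>>.
      by move=> ss; rewrite mem_gen // inE.
    rewrite AE join_subG cycle_subG gen ?inE ?eqxx ?orbT // andbT.
    have sr1 := gen r1 (mem_head _ _).
    have sr2 : r2 \in <<[set:: [:: r1; r2; r]]>> by rewrite gen // !inE eqxx orbT.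
    rewrite /= TE; apply/subsetP=> c; rewrite !inE -!orbA.
    by case/or4P=> /eqP-> //; rewrite groupM.
  rewrite gen_subG; apply/subsetP=> c; rewrite !inE.
  by case/or3P=> /eqP-> //; apply: (subsetP sTA).
- by split=> //; rewrite expgS expg1 sq.
split=> //; first by rewrite -or.
move=> p pr_p po; apply: (two_one_mod sTA stT Tr1 Ar fr fx pr_p).
have := mul_cardG T <[r ^+ p]>; rewrite -sTr cardA t4 -orderE orderXdiv ?or //.
move=> e; apply: (@leq_ltn_trans (4 * (o %/ p))).
  by rewrite e leq_pmulr.
by rewrite ltn_pmul2l // ltn_Pdiv ?prime_gt1.
Qed.

End IndexTwoParameters.

(** * Fixed-point-free automorphisms of abelian groups *)

(** A number dividing [2 i] but not [i] has the same 2-part as [2 i]. So all nontrivial elements of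
    odd order have cycle lengths with one and the same 2-part. *)
Lemma dvdn_half_period i d l j q : l = (2 ^ j * q)%N -> 0 < j -> odd q -> 0 < d ->
  l %| i * 2 -> ~~ (l %| i) -> d %| i * 2 -> ~~ (d %| i) -> 2 ^ j %| d.
Proof.
move=> lE j0 oq d0 l2i nli d2i ndi; apply: contraT => njd.
have cq : coprime (2 ^ j) q by rewrite coprimeXl // coprime2n.
have qi : q %| i.
  have : q %| i * 2 by apply: dvdn_trans l2i; rewrite lE dvdn_mull.
  by rewrite Gauss_dvdl // coprimen2.
have /dvdnP[i' iE] : 2 ^ j %| i * 2 by apply: dvdn_trans l2i; rewrite lE dvdn_mulr.
have jE : (2 ^ j = 2 ^ j.-1 * 2)%N by rewrite -expnSr prednK.
have {}iE : i = (i' * 2 ^ j.-1)%N.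
  by apply/eqP; rewrite -(eqn_pmul2r (isT : 0 < 2)) iE jE mulnA.
case/negP: ndi; rewrite -(partnC 2 d0) Gauss_dvd ?coprime_partC //; apply/andP; split.
  rewrite iE p_part dvdn_mull // dvdn_exp2l // -ltnS prednK // ltnNge.
  apply: contra njd => le; apply: dvdn_trans (dvdn_part 2 d).
  by rewrite p_part dvdn_exp2l.
have : d`_2^' %| i * 2 by apply: dvdn_trans d2i; apply: dvdn_part.
rewrite Gauss_dvdl // coprime_sym coprime2n.
by have := part_pnat 2^' d; rewrite p'natE // dvdn2 negbK.
Qed.

(** Eliminating [2^k] gives [p^(s-t) (p^t - 1) = 2 p^a]. As [p^t - 1] is prime to [p], it divides 2,
    so [p^t = 3]. *)
Lemma mersenne_arith p k t s a : prime p -> odd p -> 0 < t <= s ->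
  (2 ^ k = p ^ t + 1)%N -> (p ^ s = 2 ^ k.-1 * p ^ (s - t) + p ^ a)%N ->
  [/\ p = 3, t = 1%N & k = 2].
Proof.
move=> pr_p op /andP[t0 ts] kE sE.
have k0 : 0 < k.
  by case: k kE {sE} => // /eqP; rewrite expn0 addn1 eqSS eq_sym expn_eq0 eqn0Ngt prime_gt0.
have e1 : (p ^ (s - t) * (p ^ t).-1 = 2 * p ^ a)%N.
  have e2 : (2 ^ k = 2 * 2 ^ k.-1)%N by rewrite -expnS prednK.
  have e3 : (p ^ s = p ^ (s - t) * p ^ t)%N by rewrite -expnD subnK.
  have pt0 : (0 < p ^ t)%N by rewrite expn_gt0 prime_gt0.
  move: sE e3 kE; rewrite e2; move: (p ^ s)%N (p ^ (s - t))%N (p ^ t)%N (p ^ a)%N pt0 (2 ^ k.-1)%N.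
  by move=> A B [//|C] D _ E -> /= e3 e4; nia.
have : ((p ^ t).-1 %| 2 * p ^ a)%N by rewrite -e1 dvdn_mull.
have pt : (p ^ t).-1.+1 = (p ^ t)%N by rewrite prednK // expn_gt0 prime_gt0.
rewrite Gauss_dvdl; last first.
  rewrite coprimeXr // coprime_sym prime_coprime //; apply/negP=> pd.
  have := dvdn_exp t0 (dvdnn p); rewrite -pt -addn1 dvdn_addr // dvdn1.
  by move/eqP=> p1; rewrite p1 in pr_p.
have p3 : 2 < p by case: p pr_p op {kE sE e1 pt} => [|[|[|]]].
have le_pt : (p <= p ^ t)%N by rewrite -{1}[p]expn1 leq_exp2l // ltnW.
move/(dvdn_leq (isT : 0 < 2)) => le2.
have ptE : (p ^ t)%N = 3 by lia.
have pE : p = 3 by lia.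
have tE : t = 1%N by apply/eqP; rewrite -(eqn_exp2l _ _ (ltnW p3)) ptE expn1 pE.
split=> //; apply/eqP; rewrite -(eqn_exp2l _ _ (isT : 1 < 2)) kE ptE.
by [].
Qed.

Lemma order_endo (gT : finGroupType) (f : gT -> gT) :
  {morph f : u v / u * v} -> injective f -> forall y, #[f y] = #[y].
Proof.
move=> fM fI y; have fX k : (f y ^+ k == 1) = (y ^+ k == 1).
  by rewrite -(endoX fM) -{1}(endo1 fM) (inj_eq fI).
by apply/eqP; rewrite eqn_dvd !order_dvdn fX expg_order -fX expg_order !eqxx.
Qed.

Section AbelianPcore.

Variable gT : finGroupType.
Local Notation G := [set: gT].
Hypothesis abG : abelian G.

Lemma abelian_pcore_Hall pi : pi.-Hall(G) 'O_pi(G).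
Proof. exact/nilpotent_pcore_Hall/abelian_nil. Qed.

Lemma abelian_mem_pcore pi y : (y \in 'O_pi(G)) = pi.-elt y.
Proof. by rewrite (mem_normal_Hall (abelian_pcore_Hall pi)) ?pcore_normal ?inE. Qed.

Lemma abelian_card_pcore pi : #|'O_pi(G)| = (#|G|`_pi)%N.
Proof. exact: card_Hall (abelian_pcore_Hall pi). Qed.

End AbelianPcore.

Section AbelianFixedPointFree.

Variables (gT : finGroupType) (f : gT -> gT) (x : gT).
Hypotheses (fM : {morph f : y z / y * z}) (fI : injective f).
Hypotheses (abG : abelian [set: gT]) (gt2 : 2 < #|[set: gT]|).
Hypotheses (half : #|[set: gT]| = #|cyc f x|.*2).
Hypothesis nofix : forall y, f y = y -> y = 1.

Local Notation O := (cyc f x).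
Local Notation G := [set: gT].

Let long : #|G| <= #|O|.*2.
Proof. by rewrite half. Qed.

Let com (y z : gT) : y * z = z * y.
Proof. by apply: (centsP abG); rewrite inE. Qed.

Let memO pi y : (y \in 'O_pi(G)) = pi.-elt y.
Proof. exact: abelian_mem_pcore. Qed.

Let stO pi : stable f 'O_pi(G).
Proof. by move=> y; rewrite !memO /p_elt (order_endo fM fI). Qed.

Let iter_constt i pi y : iter i f y.`_pi = (iter i f y).`_pi.
Proof. by elim: i => //= i ->; rewrite /constt (order_endo fM fI) (endoX fM). Qed.

Let iter_period j : iter j f x = x -> forall y, iter j f y = y.
Proof. exact: (long_iter_full fM fI gt2 long). Qed.

(** Let [g] act as [f^j] on the [pi]-component and trivially on the other one; it commutes with [f]
    and fixes [x], so [long_fix_full] applies. *)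
Lemma constt_iter_full pi j y : iter j f x.`_pi = x.`_pi -> iter j f y.`_pi = y.`_pi.
Proof.
move=> xj; pose g z := z.`_pi^' * iter j f z.`_pi.
have gM : {morph g : u v / u * v}.
  move=> u v; rewrite /g !(consttM _ (com u v)) iter_endoM // -!mulgA; congr (_ * _).
  by rewrite !mulgA (com v.`_pi^').
have gx : g x = x by rewrite /g xj com consttC.
have gf z : g (f z) = f (g z).
  by rewrite /g fM -!(iter_constt 1) /= -!iterSr.
have := long_fix_full fM fI gt2 long gM gf gx y; rewrite /g => e.
by apply: (mulgI y.`_pi^'); rewrite e com consttC.
Qed.

Lemma constt_neq1 p : prime p -> p %| #|G| -> x.`_p != 1.
Proof.
move=> pr_p pG; apply/eqP=> xp1.
have OG : 'O_p^'(G) = G.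
  have sO : stable f 'O_p^'(G)%G := @stO p^'.
  apply: (long_stable_full fM fI gt2 long sO (cyc_refl x)).
  by rewrite /= memO -(consttC p x) xp1 mul1g p_elt_constt.
by have := pcore_pgroup p^' G; rewrite OG /pgroup p'natE // pG.
Qed.

Lemma constt_card pi : x.`_pi != 1 -> #|cyc f x.`_pi| < #|G|`_pi.
Proof.
move=> nx; rewrite -(abelian_card_pcore abG); apply: proper_card; apply/properP; split.
  by apply: (cyc_sub (@stO pi)); rewrite memO p_elt_constt.
exists 1; first exact: group1.
by rewrite (cyc_sym fI) cyc1 // inE.
Qed.

(** The whole cycle has length the lcm of the two. Each component cycle misses 1, so the product of
    the lengths is below [#|G|], twice the lcm; hence the gcd is below 2. *)
Lemma constt_coprime pi : x.`_pi != 1 -> x.`_pi^' != 1 ->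
  coprime #|cyc f x.`_pi| #|cyc f x.`_pi^'| /\
  (#|cyc f x.`_pi| * #|cyc f x.`_pi^'| = #|O|)%N.
Proof.
move=> n1 n2; set l := #|cyc f x.`_pi|; set l' := #|cyc f x.`_pi^'|.
have LE : #|O| = lcmn l l'.
  apply/eqP; rewrite eqn_dvd dvdn_lcm; apply/and3P; split.
  - rewrite -iter_eq_dvdn // -{1}(consttC pi x) iter_endoM //.
    have -> : iter (lcmn l l') f x.`_pi = x.`_pi.
      by apply/eqP; rewrite iter_eq_dvdn // dvdn_lcml.
    have -> : iter (lcmn l l') f x.`_pi^' = x.`_pi^'.
      by apply/eqP; rewrite iter_eq_dvdn // dvdn_lcmr.
    by rewrite consttC.
  - by rewrite -iter_eq_dvdn // iter_constt iter_card_cyc.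
  by rewrite -iter_eq_dvdn // iter_constt iter_card_cyc.
have lt_ll : (l * l' < #|O| * 2)%N.
  rewrite muln2 -half -(partnC pi (cardG_gt0 G)).
  by apply: ltn_mul; apply: constt_card.
have O0 : 0 < #|O| by rewrite card_cyc fingraph.order_gt0.
have := muln_lcm_gcd l l'; rewrite -LE /coprime => e.
have g0 : 0 < gcdn l l' by rewrite gcdn_gt0 /l card_cyc fingraph.order_gt0.
have g2 : gcdn l l' < 2 by rewrite -(ltn_pmul2l O0) e.
by move: g0 g2 e; case: gcdn => [|[]] // _ _ <-; rewrite muln1.
Qed.

(** As the group is abelian, [z |-> f^i(z) z^2] is a morphism commuting with [f], and it fixes
    [x]. *)
Lemma fpf_inverter : exists i, forall y, iter i f y = y^-1.
Proof.
have [i ix] := long_inverter fM fI gt2 long; exists i => y.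
pose g z := iter i f z * z ^+ 2.
have gM : {morph g : u v / u * v}.
  move=> u v; rewrite /g iter_endoM // expgMn; last exact: com.
  move: (iter i f v) (u ^+ 2) (v ^+ 2) => s t w.
  by rewrite -!mulgA (mulgA s t) (com s t) -!mulgA.
have gx : g x = x by rewrite /g ix expgS expg1 mulKg.
have gf z : g (f z) = f (g z) by rewrite /g fM (endoX fM) -iterSr.
have := long_fix_full fM fI gt2 long gM gf gx y; rewrite /g expgS expg1 => e.
by apply: (mulIg (y * y)); rewrite e mulKg.
Qed.

Lemma odd_inv_neq (y : gT) : y != 1 -> odd #[y] -> y^-1 != y.
Proof.
move=> ny oy; apply/eqP=> yV; have : y ^+ 2 == 1 by rewrite expgS expg1 -{1}yV mulVg.
rewrite -order_dvdn => /(dvdn_leq (isT : 0 < 2)) y2.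
by move: ny oy y2 (order_gt0 y); rewrite -order_eq1; case: #[y] => [|[|[]]].
Qed.

(** The cycle length divides [2 i]; if odd it would divide [i], and then [y^-1 = y]. *)
Lemma even_cyc y : y != 1 -> odd #[y] -> ~~ odd #|cyc f y|.
Proof.
move=> ny oy; have [i iV] := fpf_inverter; apply/negP=> ol.
have : #|cyc f y| %| i * 2.
  by rewrite muln2 -addnn -iter_eq_dvdn // iterD !iV invgK.
rewrite Gauss_dvdl ?coprimen2 // -iter_eq_dvdn // iV.
by apply/negP/odd_inv_neq.
Qed.

(** Two cycles of full length together with 1 would exceed the order of [H]. So every element off
    the cycle of [y] has a smaller period, dividing [e], and the leftover is the fixed subgroup of
    [f^e]. *)
Lemma cyc_rest (H : {group gT}) y e : stable f H -> y \in H ->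
    (forall z, z \in H -> iter #|cyc f y| f z = z) -> #|H| <= #|cyc f y|.*2 ->
    ~~ (#|cyc f y| %| e) ->
    (forall z, z \in H -> #|cyc f z| %| #|cyc f y| -> #|cyc f z| != #|cyc f y| ->
       #|cyc f z| %| e) ->
  exists F : {group gT}, F \subset H /\ #|H| = (#|cyc f y| + #|F|)%N.
Proof.
set l := #|cyc f y| => sH Hy lH leH nle small.
pose F := [set z in H | iter e f z == z].
have gF : group_set F.
  apply/group_setP; split=> [|u v]; first by rewrite inE group1 (endo1 (iter_endoM fM e)) eqxx.
  case/setIdP=> Hu /eqP eu /setIdP[Hv /eqP ev].
  by rewrite inE groupM // (iter_endoM fM) eu ev eqxx.
have l1 : l != 1%N by apply: contraNneq nle => ->; apply: dvd1n.
have nF z : z \in cyc f y -> iter e f z != z.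
  by move=> Oz; rewrite iter_eq_dvdn // (cyc_eq fI Oz).
exists (Group gF); split; first by apply/subsetP=> z /setIdP[].
have HE : H :=: cyc f y :|: F.
  apply/setP=> z; apply/idP/setUP=> [Hz|[Oz|/setIdP[]//]]; last first.
    by apply: (subsetP (cyc_sub sH Hy)).
  have [Oz|nOz] := boolP (z \in cyc f y); first by left.
  right; rewrite inE Hz /= iter_eq_dvdn //.
  have zl : #|cyc f z| %| l by rewrite -iter_eq_dvdn // lH.
  apply: small => //; apply/eqP=> zE; move: leH; rewrite leqNgt => /negP; case.
  have dis : [disjoint cyc f y & cyc f z].
    rewrite -setI_eq0; apply/eqP/setP=> w; rewrite in_setI in_set0; apply/negP=> /andP[yw zw].
    by case/negP: nOz; rewrite -(cyc_eq fI yw) (cyc_eq fI zw) cyc_refl.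
  have n1 w : #|cyc f w| = l -> 1 \notin cyc f w.
    move=> wl; apply/negP; rewrite (cyc_sym fI) cyc1 // inE => /eqP w1.
    by case/eqP: l1; rewrite -wl w1 cyc1 // cards1.
  have sub : 1 |: (cyc f y :|: cyc f z) \subset H.
    by rewrite !subUset sub1set group1 !cyc_sub.
  apply: leq_trans (subset_leq_card sub).
  rewrite cardsU1 in_setU negb_or !n1 //= cardsU (disjoint_setI0 dis) cards0 subn0.
  by rewrite zE addnn.
rewrite HE cardsU (_ : cyc f y :&: F = set0) ?cards0 ?subn0 //.
apply/setP=> z; rewrite in_setI in_set0; apply/negP=> /andP[Oz /setIdP[_ ez]].
by have := nF z Oz; rewrite ez.
Qed.

(** Otherwise the group is a 2-group on which [f] has 2-power order, and its number of fixed points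
    is even; but 1 is the only one. *)
Lemma fpf_odd_constt : x.`_2^' != 1.
Proof.
apply/eqP=> x21; have sO : stable f 'O_2(G)%G := @stO 2.
have OG : 'O_2(G) = G.
  apply: (long_stable_full fM fI gt2 long sO (cyc_refl x)).
  by rewrite /= memO -(consttC 2 x) x21 mulg1 p_elt_constt.
have p2 := pcore_pgroup 2 G; rewrite OG in p2.
pose s := perm fI; have sE k z : (s ^+ k) z = iter k f z.
  by rewrite permX; elim: k => //= k ->; rewrite permE.
have ps : 2.-group <[s]>.
  apply: pnat_dvd p2; rewrite -orderE order_dvdn; apply/eqP/permP=> z.
  rewrite sE perm1; apply: iter_period; apply/eqP.
  by rewrite iter_eq_dvdn // half -muln2 dvdn_mulr.
have acts : [acts <[s]>, on G | 'P].
  by rewrite cycle_subG !inE /=; apply/subsetP=> v _; rewrite !inE.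
have := pgroup_fix_mod ps acts.
have -> : 'Fix_(G | 'P)(<[s]>) = 1.
  have fixE v : (v \in 'Fix_(G | 'P)(<[s]>)) = (f v == v).
    rewrite in_setI in_setT afix_cycle ?in_setT //.
    by apply/afix1P/eqP; rewrite /= apermE permE.
  apply/setP=> v; rewrite fixE in_set1.
  by apply/eqP/eqP=> [/nofix|->] //; apply: (endo1 fM).
by rewrite cards1 half -muln2 modnMl.
Qed.

(** Write [#|G| = 2^k p^s] with cycle lengths [l = p^t] for the 2-component of [x] and
    [l' = 2^(k-1) p^(s-t)] for the odd one. [cyc_rest] in both components yields the hypotheses of
    [mersenne_arith]. *)
Lemma fpf_card : [/\ #|G| = 12, #|cyc f x.`_2| = 3 & #|cyc f x.`_2^'| = 2].
Proof.
have G0 := cardG_gt0 G; have G2 : 2 %| #|G| by rewrite half -muln2 dvdn_mull.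
have cop_odd a b : coprime a b -> ~~ odd b -> odd a.
  move=> cab eb; rewrite -(negbK (odd a)) -dvdn2; apply/negP=> d2.
  have : 2 %| gcdn a b by rewrite dvdn_gcd d2 dvdn2.
  by move: cab; rewrite /coprime => /eqP->.
have n2 := constt_neq1 (isT : prime 2) G2; have n2' := fpf_odd_constt.
have [cop LE] := constt_coprime n2 n2'.
have lt2 := constt_card n2; have lt2' := constt_card n2'.
have odd_elt (pi : nat_pred) (y : gT) : 2 \notin pi -> pi.-elt y -> odd #[y].
  move=> pi2 py; rewrite -(negbK (odd _)) -dvdn2; apply: contra pi2 => d2.
  by have /pnatP := py; apply.
have o2' : odd #[x.`_2^'] by apply: (odd_elt 2^'); rewrite ?p_elt_constt.
have l'_even := even_cyc n2' o2'; have l_odd := cop_odd _ _ cop l'_even.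
set l := #|cyc f x.`_2| in cop LE lt2 l_odd *.
set l' := #|cyc f x.`_2^'| in cop LE lt2' l'_even *.
have l_gt1 : 1 < l.
  rewrite ltn_neqAle eq_sym /l card_cyc fingraph.order_gt0 andbT -card_cyc.
  apply: contra n2 => /eqP l1; apply/eqP/nofix/eqP.
  by rewrite (iter_eq_dvdn fI _ 1) l1.
have lG : l %| #|G| by rewrite half -muln2 dvdn_mulr // -LE dvdn_mulr.
pose p := pdiv l; have pr_p : prime p by apply: pdiv_prime.
have pl : p %| l := pdiv_dvd l; have op : odd p := dvdn_odd pl l_odd.
have pG : p %| #|G| := dvdn_trans pl lG.
have only_p r : prime r -> odd r -> r %| #|G| -> r = p.
  move=> pr_r or rG; apply/eqP; apply: contraT => nrp.
  have np := constt_neq1 pr_p pG; have nr := constt_neq1 pr_r rG.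
  have np' : x.`_p^' != 1.
    apply/eqP=> xp1; have sO : stable f 'O_p(G)%G := @stO p.
    have OG : 'O_p(G) = G.
      apply: (long_stable_full fM fI gt2 long sO (cyc_refl x)).
      by rewrite /= memO -(consttC p x) xp1 mulg1 p_elt_constt.
    have := pcore_pgroup p G; rewrite OG => /p_natP[m mE].
    by move: G2; rewrite mE dvdn2 oddX op orbT.
  have [cop' _] := constt_coprime np np'.
  have ep : ~~ odd #|cyc f x.`_p|.
    apply: even_cyc => //; apply: (odd_elt p); rewrite ?p_elt_constt // inE.
    by apply: contraTneq op => <-.
  have er : ~~ odd #|cyc f x.`_r|.
    apply: even_cyc => //; apply: (odd_elt r); rewrite ?p_elt_constt // inE.
    by apply: contraTneq or => <-.
  rewrite coprime_sym in cop'; have op' := cop_odd _ _ cop' ep.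
  case/negP: er; apply: dvdn_odd op'; rewrite -iter_eq_dvdn //.
  have := @constt_iter_full p^' _ x.`_r (iter_card_cyc fI x.`_p^').
  have rp' : p^'.-elt x.`_r.
    by apply: sub_p_elt (p_elt_constt r x) => q; rewrite !inE => /eqP->.
  by rewrite (constt_p_elt rp') => ->.
have [s sE] : exists s, (#|G|`_2^' = p ^ s)%N.
  suff /p_natP[s sE] : p.-nat (#|G|`_2^')%N by exists s.
  apply/pnatP=> [|r pr_r rG]; first exact: part_gt0.
  apply/eqP/only_p => //; last exact: dvdn_trans rG (dvdn_part _ _).
  have := part_pnat 2^' #|G|; rewrite p'natE // => n2r.
  by case: (even_prime pr_r) => // r2; rewrite r2 (negPf n2r) in rG.
have [t tE] : exists t, (l = p ^ t)%N.
  suff /p_natP[t tE] : p.-nat l by exists t.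
  apply/pnatP=> [|r pr_r rl]; first exact: ltnW.
  apply/eqP/only_p => //; first exact: dvdn_odd rl l_odd.
  exact: dvdn_trans rl lG.
have t0 : 0 < t by case: t tE l_gt1 => // ->.
set k := logn 2 #|G|; have kE : (#|G|`_2 = 2 ^ k)%N by rewrite p_part.
have GE : (2 ^ k * p ^ s = #|G|)%N by rewrite -kE -sE partnC.
have p0 := prime_gt0 pr_p; have p1 := prime_gt1 pr_p.
rewrite kE in lt2; rewrite sE in lt2'.
have k0 : 0 < k.
  by rewrite lt0n; apply: contraL lt2 => /eqP->; rewrite -leqNgt ltnW.
have twok : (2 ^ k = 2 ^ k.-1 * 2)%N by rewrite -expnSr prednK.
have c2p a b : coprime (p ^ a) (2 ^ b) by rewrite coprimeXl ?coprimeXr ?coprimen2.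
have eq_l' : (p ^ t * l' = 2 ^ k.-1 * p ^ s)%N.
  apply/eqP; rewrite -(eqn_pmul2r (isT : 0 < 2)) -tE LE muln2 -half -GE twok.
  by rewrite mulnAC.
have ts : t <= s.
  have : p ^ t %| 2 ^ k.-1 * p ^ s by rewrite -eq_l' dvdn_mulr.
  by rewrite Gauss_dvdr ?c2p // dvdn_Pexp2l.
have l'E : (l' = 2 ^ k.-1 * p ^ (s - t))%N.
  apply/eqP; rewrite -(@eqn_pmul2l (p ^ t)) ?expn_gt0 ?p0 // eq_l'.
  by rewrite mulnCA -expnD subnKC.
have cardO pi : #|'O_pi(G)| = (#|G|`_pi)%N := abelian_card_pcore abG pi.
have fixO pi z : z \in 'O_pi(G) -> iter #|cyc f x.`_pi| f z = z.
  rewrite memO => pz; have := @constt_iter_full pi _ z (iter_card_cyc fI x.`_pi).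
  by rewrite (constt_p_elt pz).
have memx pi : x.`_pi \in 'O_pi(G) by rewrite memO p_elt_constt.
have LG : (2 ^ k * p ^ s = (l * l').*2)%N by rewrite GE half LE.
(* The leftover subgroup has 2-power order, and parity leaves only order 1. *)
have two_p : (2 ^ k = p ^ t + 1)%N.
  have [|||F [sF]] := @cyc_rest 'O_2(G)%G x.`_2 (p ^ t.-1) (@stO 2) (memx 2) (fixO 2).
  - rewrite cardO kE -/l -(@leq_pmul2r (p ^ s)) ?expn_gt0 ?p0 // LG -doubleMl leq_double.
    by rewrite leq_mul2l ltnW ?orbT.
  - by rewrite -/l tE dvdn_Pexp2l // -ltnNge prednK.
  - move=> z _; rewrite -/l tE => /(dvdn_pfactor _ _ pr_p)[m mt ->] nm.
    rewrite dvdn_Pexp2l // -ltnS prednK // ltn_neqAle mt andbT.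
    by apply: contra nm => /eqP->.
  have : #|F| %| 2 ^ k by rewrite -kE -cardO cardSg.
  case/(dvdn_pfactor _ _ (isT : prime 2)) => a _ aE; rewrite cardO kE -/l tE aE => e.
  case: a aE e => [|a] _ e; first by rewrite e.
  have := congr1 odd e; rewrite twok oddD oddX op orbT expnS !oddM.
  by rewrite andbF.
have k2 : 1 < k.
  case: (k) two_p k0 => [|[|//]] // /eqP; rewrite expn1 addn1 eqSS eq_sym.
  by rewrite -(expn0 p) eqn_exp2l // => /eqP t00; rewrite t00 in t0.
have [a aE] : exists a, (p ^ s = 2 ^ k.-1 * p ^ (s - t) + p ^ a)%N.
  (* A smaller period keeps the factor [2^(k-1)] by [dvdn_half_period], so it divides [l' / p]. For
     [t = s] there is no [p] to lose, and only the identity has a smaller period. *)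
  pose e := if t == s then 1%N else (2 ^ k.-1 * p ^ (s - t).-1)%N.
  have [|||F [sF]] := @cyc_rest 'O_2^'(G)%G x.`_2^' e (@stO 2^') (memx 2^') (fixO 2^').
  - rewrite cardO sE -/l' -(@leq_pmul2l (2 ^ k)) ?expn_gt0 // LG -!muln2 mulnA.
    by rewrite leq_mul2r leq_mul2r ltnW ?orbT.
  - rewrite -/l' /e; case: eqP => [ts'|/eqP ts'].
      by rewrite dvdn1; apply: contra l'_even => /eqP->.
    rewrite l'E dvdn_pmul2l ?expn_gt0 // dvdn_Pexp2l // -ltnNge prednK //.
    by rewrite subn_gt0 ltn_neqAle ts' ts.
  - move=> z Oz; rewrite -/l'; have [->|nz] := eqVneq z 1; first by rewrite cyc1 // cards1 dvd1n.
    move=> dl' ndl'; have [i iV] := fpf_inverter.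
    have inv2 y : #|cyc f y| %| i * 2.
      by rewrite muln2 -addnn -iter_eq_dvdn // iterD !iV invgK.
    have ninv y : y != 1 -> odd #[y] -> ~~ (#|cyc f y| %| i).
      by move=> ny oy; rewrite -iter_eq_dvdn // iV; apply: odd_inv_neq.
    have oz : odd #[z] by apply: (odd_elt 2^') => //; rewrite -memO.
    have z0 : 0 < #|cyc f z| by rewrite card_cyc fingraph.order_gt0.
    have op_k : odd (p ^ (s - t)) by rewrite oddX op orbT.
    have k10 : 0 < k.-1 by rewrite -ltnS prednK.
    have /dvdnP[c cE] := dvdn_half_period l'E k10 op_k z0 (inv2 _) (ninv _ n2' o2')
      (inv2 z) (ninv z nz oz).
    move: dl' ndl'; rewrite cE l'E mulnC dvdn_pmul2l ?expn_gt0 //.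
    case/(dvdn_pfactor _ _ pr_p)=> m ms ->.
    rewrite eqn_pmul2l ?expn_gt0 // eqn_exp2l // => nms; rewrite /e.
    case: eqP => [ts'|/eqP ts'].
      by move: ms nms; rewrite ts' subnn leqn0 => ->.
    rewrite dvdn_pmul2l ?expn_gt0 // dvdn_Pexp2l // -ltnS prednK.
      by rewrite ltn_neqAle nms.
    by rewrite subn_gt0 ltn_neqAle ts' ts.
  have : #|F| %| p ^ s by rewrite -sE -cardO cardSg.
  case/(dvdn_pfactor _ _ pr_p) => a _ aE; rewrite cardO sE -/l' l'E aE => ->.
  by exists a.
have tts : 0 < t <= s by rewrite t0.
have [p3 t1 k2E] := mersenne_arith pr_p op tts two_p aE.
(* Otherwise [p] divides both [l] and [l']. *)
have s1 : s = 1%N.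
  apply/eqP; rewrite eqn_leq -{2}t1 ts andbT leqNgt; apply/negP=> s_gt1.
  have : p %| gcdn l l'.
    rewrite dvdn_gcd pl l'E dvdn_mull // -{1}(expn1 p) dvdn_Pexp2l // subn_gt0.
    by rewrite t1.
  by move: cop; rewrite /coprime => /eqP->; rewrite dvdn1 p3.
by rewrite -GE tE l'E s1 t1 k2E p3.
Qed.

End AbelianFixedPointFree.

(** * Presentations *)

Section Presentations.

Variable rel : forall hT : finGroupType, seq hT -> Prop.
Variables (N n : nat).
Hypothesis rel_size : forall (hT : finGroupType) (s : seq hT), rel s -> size s = n.
Hypothesis rel_pair : forall (gT hT : finGroupType) (s : seq gT) (t : seq hT),
  rel s -> rel t -> rel (zip s t : seq (gT * hT)%type).
Hypothesis rel_bound : forall (hT : finGroupType) (s : seq hT),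
  rel s -> #|<<[set:: s]>>| <= N.

(* The subgroup of [gT * hT] generated by the pairs of generators satisfies the
   relations, hence has order at most [N], and is the graph of the morphism. *)
Lemma presentsI (gT : finGroupType) (s : seq gT) :
  <<[set:: s]>> = [set: gT] -> rel s -> #|[set: gT]| = N -> presents rel s.
Proof.
move=> gen_s rel_s cardN; split=> // hT t rel_t.
have szst : size s = size t by rewrite (rel_size rel_s) (rel_size rel_t).
pose z : seq (gT * hT)%type := zip s t; pose K := <<[set:: z]>>.
have zK u : u \in z -> u \in K by move=> uz; rewrite mem_gen // inE.
have fst_group : group_set [set u.1 | u in K].
  apply/group_setP; split=> [|_ _ /imsetP[u Ku ->] /imsetP[v Kv ->]].
    by apply/imsetP; exists 1; rewrite ?group1.
  by apply/imsetP; exists (u * v); rewrite ?groupM.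
have fst_full : [set u.1 | u in K] = [set: gT].
  apply/eqP; rewrite eqEsubset subsetT -gen_s (gen_subG _ (Group fst_group)).
  apply/subsetP=> y; rewrite inE => sy.
  have : y \in unzip1 z by rewrite unzip1_zip ?szst.
  by case/mapP=> u uz ->; apply: imset_f; apply: zK.
have injK : {in K &, injective (fun u : (gT * hT)%type => u.1)}.
  apply/imset_injP; rewrite eqn_leq leq_imset_card /= fst_full cardN.
  exact/rel_bound/rel_pair.
pose F g := odflt 1 [pick h | (g, h) \in K].
have FP g : (g, F g) \in K.
  have : g \in [set u.1 | u in K] by rewrite fst_full inE.
  case/imsetP=> -[g' h] Kgh /= ->; rewrite /F; case: pickP => //= /(_ h).
  by rewrite Kgh.
have FE g h : (g, h) \in K -> F g = h.
  by move=> Kgh; have [] := injK _ _ (FP g) Kgh erefl.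
have FM : {in [set: gT] &, {morph F : g h / g * h}}.
  by move=> g h _ _; apply: FE; apply: (groupM (FP g) (FP h)).
exists (Morphism FM) => /=; rewrite -[in LHS](unzip1_zip (s := s) (t := t)) ?szst //.
rewrite -[in RHS](unzip2_zip (s := s) (t := t)) ?szst // -map_comp.
by apply/eq_in_map => -[g h] /zK /FE.
Qed.

(** The relations bound the order from above, and a concrete model [t], being an image of the
    presented group, bounds it from below. *)
Lemma presents_card (gT hT : finGroupType) (s : seq gT) (t : seq hT) :
  presents rel s -> rel t -> N <= #|<<[set:: t]>>| -> #|[set: gT]| = N.
Proof.
move=> [gen_s rel_s univ] rel_t leN.
apply/eqP; rewrite eqn_leq -{1}gen_s rel_bound //=; apply: leq_trans leN _.
have [h ht] := univ hT t rel_t.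
apply: leq_trans (leq_morphim h [set: gT]); apply: subset_leq_card.
rewrite gen_subG; apply/subsetP=> y; rewrite inE -ht => /mapP[u su ->].
by rewrite mem_morphim ?inE.
Qed.

End Presentations.

Lemma presents_endo (rel : forall hT : finGroupType, seq hT -> Prop)
    (gT : finGroupType) (s t : seq gT) :
  presents rel s -> rel gT t ->
  exists f : {morphism [set: gT] >-> gT}, [seq f y | y <- s] = t.
Proof. by case=> _ _; apply. Qed.

Lemma gen_index2_sub (gT : finGroupType) (A : {group gT}) x (s : seq gT) :
  x \in 'N(A) -> x * x \in A -> {subset s <= x |: A} -> <<[set:: s]>> \subset A :|: x *: A.
Proof.
move=> Nx Ax2 sA; pose K := A :|: x *: A.
have gK : group_set K.
  have JA a : a \in A -> a * x \in x *: A.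
    by move=> Aa; rewrite mem_lcoset -conjgE memJ_norm.
  apply/group_setP; split=> [|u v]; first by rewrite inE group1.
  case/setUP=> [Au|/lcosetP[a Aa ->]] /setUP[Av|/lcosetP[b Ab ->]].
  - by apply/setUP; left; rewrite groupM.
  - apply/setUP; right; have /lcosetP[c Ac e] := JA u Au.
    by rewrite mulgA e mem_lcoset -mulgA mulKg groupM.
  - by apply/setUP; right; rewrite mem_lcoset -mulgA mulKg groupM.
  apply/setUP; left; have /lcosetP[c Ac e] := JA a Aa.
  by rewrite mulgA -[x * a * x]mulgA e mulgA groupM // groupM.
rewrite (gen_subG _ (Group gK)); apply/subsetP=> y; rewrite inE => /sA.
by rewrite !inE => /orP[/eqP->|->] //; rewrite lcoset_refl orbT.
Qed.

Lemma card_gen_index2 (gT : finGroupType) (A : {group gT}) x (s : seq gT) :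
  x \in 'N(A) -> x * x \in A -> {subset s <= x |: A} -> #|<<[set:: s]>>| <= #|A|.*2.
Proof.
move=> Nx Ax2 sA; apply: leq_trans (subset_leq_card (gen_index2_sub Nx Ax2 sA)) _.
by apply: leq_trans (leq_card_setU _ _) _; rewrite card_lcoset addnn.
Qed.

(* Dihedral for [k = 0], dicyclic for [k = n %/ 2], and below for [k = 1]. *)
Definition dih_rel (n k : nat) (hT : finGroupType) (s : seq hT) : Prop :=
  if s is [:: r; x] then [/\ r ^+ n = 1, x ^+ 2 = r ^+ k & x * r * x^-1 = r^-1]
  else False.

Definition klein_rel (o k : nat) (hT : finGroupType) (s : seq hT) : Prop :=
  if s is [:: r1; r2; r; x]
  then Z22xZo_rel o r1 r2 r /\
       [/\ x ^+ 2 = (r1 * r2) ^+ k, [~ r1, x] = 1, [~ r2, x] = 1 & x * r * x^-1 = r^-1]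
  else False.

Lemma pair_expg (gT hT : finGroupType) (g : gT) (h : hT) n :
  ((g, h) : (gT * hT)%type) ^+ n = (g ^+ n, h ^+ n).
Proof. by elim: n => // n IHn; rewrite !expgS IHn. Qed.

Lemma pair_commg (gT hT : finGroupType) (g g' : gT) (h h' : hT) :
  [~ g, g'] = 1 -> [~ h, h'] = 1 -> [~ ((g, h) : (gT * hT)%type), (g', h')] = 1.
Proof. by move=> e e'; apply/eqP; rewrite xpair_eqE; apply/andP; split; apply/eqP. Qed.

Lemma dih_rel_size n k (hT : finGroupType) (s : seq hT) : dih_rel n k s -> size s = 2.
Proof. by case: s => [|r [|x []]]. Qed.

Lemma dih_rel_pair n k (gT hT : finGroupType) (s : seq gT) (t : seq hT) :
  dih_rel n k s -> dih_rel n k t -> dih_rel n k (zip s t : seq (gT * hT)%type).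
Proof.
case: s => [|r [|x []]] //; case: t => [|r' [|x' []]] // [r1 x1 c1] [r2 x2 c2].
split; rewrite ?pair_expg ?r1 ?r2 ?x1 ?x2 //.
by congr (_, _).
Qed.

Lemma conjV_norm (gT : finGroupType) (r x : gT) (A : {set gT}) :
  x * r * x^-1 \in A -> r ^ x^-1 \in A.
Proof. by rewrite conjgE invgK mulgA. Qed.

Lemma dih_rel_bound n k (hT : finGroupType) (s : seq hT) :
  0 < n -> dih_rel n k s -> #|<<[set:: s]>>| <= n.*2.
Proof.
case: s => [|r [|x []]] // n0 [rn x2 c].
apply: leq_trans (@card_gen_index2 _ <[r]>%G x _ _ _ _) _.
- by rewrite -groupV -cycle_subG norms_cycle conjV_norm // c groupV cycle_id.
- by rewrite -[x * x]/(x ^+ 2) x2 mem_cycle.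
- by move=> y; rewrite !inE => /orP[]/eqP->; rewrite ?eqxx ?cycle_id ?orbT.
by rewrite leq_double dvdn_leq // order_dvdn rn.
Qed.

Lemma klein_rel_size o k (hT : finGroupType) (s : seq hT) :
  klein_rel o k s -> size s = 4.
Proof. by case: s => [|r1 [|r2 [|r [|x []]]]]. Qed.

Lemma Z22xZo_rel_pair o (gT hT : finGroupType) (r1 r2 r : gT) (s1 s2 s : hT) :
  Z22xZo_rel o r1 r2 r -> Z22xZo_rel o s1 s2 s ->
  Z22xZo_rel o ((r1, s1) : (gT * hT)%type) (r2, s2) (r, s).
Proof.
case=> [[a1 a2 a3] [a4 a5 a6]] [[b1 b2 b3] [b4 b5 b6]].
by split; split; rewrite ?pair_expg ?a1 ?a2 ?a3 ?b1 ?b2 ?b3 ?pair_commg.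
Qed.

Lemma klein_rel_pair o k (gT hT : finGroupType) (s : seq gT) (t : seq hT) :
  klein_rel o k s -> klein_rel o k t -> klein_rel o k (zip s t : seq (gT * hT)%type).
Proof.
case: s => [|r1 [|r2 [|r [|x []]]]] //; case: t => [|s1 [|s2 [|s [|y []]]]] //.
case=> [rel_r [a7 a8 a9 a10]] [rel_s [b7 b8 b9 b10]].
split; first exact: Z22xZo_rel_pair.
split; try by apply: pair_commg.
  by rewrite [_ * _](_ : _ = (r1 * r2, s1 * s2)) // !pair_expg a7 b7.
by congr (_, _).
Qed.

Definition klein_join (hT : finGroupType) (r1 r2 r : hT) : {group hT} :=
  (<[r1]> <*> <[r2]> <*> <[r]>)%G.

Section KleinJoin.

Variables (hT : finGroupType) (o : nat) (r1 r2 r : hT).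
Hypotheses (o0 : 0 < o) (rel_r : Z22xZo_rel o r1 r2 r).

Local Notation A := (klein_join r1 r2 r).

Lemma klein_commute : [/\ commute r1 r2, commute r1 r & commute r2 r].
Proof. by case: rel_r => _ [/eqP/commgP a4 /eqP/commgP a5 /eqP/commgP a6]. Qed.

Lemma klein_join_mem s : s \in [:: r1; r2; r] -> s \in A.
Proof.
rewrite !inE => /or3P[]/eqP->.
- by rewrite (subsetP (joing_subl _ _)) // (subsetP (joing_subl _ _)) ?cycle_id.
- by rewrite (subsetP (joing_subl _ _)) // (subsetP (joing_subr _ _)) ?cycle_id.
by rewrite (subsetP (joing_subr _ _)) ?cycle_id.
Qed.

Lemma klein_join_cent : <[r2]> \subset 'C(<[r1]>) /\ <[r]> \subset 'C(<[r1]> <*> <[r2]>).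
Proof.
have [c12 c1 c2] := klein_commute; split.
  by rewrite cent_cycle cycle_subG; apply/cent1P.
by rewrite centY subsetI !cent_cycle !cycle_subG; apply/andP; split; apply/cent1P.
Qed.

Lemma klein_join_card : #|A| <= (4 * o)%N.
Proof.
have [[a1 a2 a3] _] := rel_r; have [c12 c123] := klein_join_cent.
have le (B C : {group hT}) : C \subset 'C(B) -> (#|B <*> C| <= #|B| * #|C|)%N.
  by move=> cBC; rewrite cent_joinEr // mul_cardG leq_pmulr.
apply: leq_trans (le _ _ c123) _; rewrite leq_mul //; last first.
  by rewrite dvdn_leq // -orderE order_dvdn a3.
apply: leq_trans (le _ _ c12) _; rewrite (@leq_mul _ _ 2 2) //.
  by rewrite dvdn_leq // -orderE order_dvdn a1.
by rewrite dvdn_leq // -orderE order_dvdn a2.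
Qed.

Lemma klein_joinP a : a \in A -> exists z j,
  [/\ a = z * r ^+ j, z ^+ 2 = 1, commute z r & exists i l, z = r1 ^+ i * r2 ^+ l].
Proof.
have [[a1 a2 a3] _] := rel_r; have [c12 c123] := klein_join_cent.
have [k12 k1 k2] := klein_commute.
have -> : (A : {set hT}) = <[r1]> * <[r2]> * <[r]>.
  have e1 := cent_joinEr c12; have e2 := cent_joinEr c123.
  by rewrite -e1; exact: e2.
case/mulsgP=> z _ /mulsgP[_ _ /cycleP[i ->] /cycleP[l ->] zE] /cycleP[j ->] ->.
exists z, j; split=> //; last by exists i, l.
  rewrite zE expgMn; last exact: commuteX2.
  by rewrite -!expgM ![(_ * 2)%N]mulnC !expgM a1 a2 !expg1n mulg1.
by apply: commute_sym; rewrite zE; apply: commuteM; apply: commuteX; apply: commute_sym.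
Qed.

End KleinJoin.

Lemma klein_rel_norm o k (hT : finGroupType) (r1 r2 r x : hT) :
  klein_rel o k [:: r1; r2; r; x] ->
  x \in 'N(klein_join r1 r2 r) /\ x * x \in klein_join r1 r2 r.
Proof.
case=> _ [a7 /eqP/commgP a8 /eqP/commgP a9 a10].
have mA := @klein_join_mem hT r1 r2 r; split; last first.
  by rewrite -[x * x]/(x ^+ 2) a7 groupX ?groupM // mA // !inE eqxx ?orbT.
have J y : y \in [:: r1; r2; r] -> y ^ x^-1 \in klein_join r1 r2 r.
  rewrite !inE => /or3P[]/eqP->; apply: conjV_norm.
  - by rewrite -a8 mulgK mA // !inE eqxx.
  - by rewrite -a9 mulgK mA // !inE eqxx ?orbT.
  by rewrite a10 groupV mA // !inE eqxx ?orbT.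
rewrite -groupV inE /= sub_conjg invgK !join_subG !cycle_subG -andbA.
have JV y : y \in [:: r1; r2; r] -> y \in (<[r1]> <*> <[r2]> <*> <[r]>) :^ x.
  by move=> yr; rewrite mem_conjg J.
by rewrite !JV ?inE ?eqxx ?orbT.
Qed.

Lemma klein_gens_sub (hT : finGroupType) (r1 r2 r x : hT) :
  {subset [:: r1; r2; r; x] <= x |: klein_join r1 r2 r}.
Proof.
have mA := @klein_join_mem hT r1 r2 r.
move=> y; rewrite !inE => /or4P[]/eqP->; rewrite ?eqxx ?orbT //.
- by rewrite mA ?orbT // !inE eqxx.
- by rewrite mA ?orbT // !inE eqxx ?orbT.
by rewrite mA ?orbT // !inE eqxx ?orbT.
Qed.

Lemma klein_rel_bound o k (hT : finGroupType) (s : seq hT) :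
  0 < o -> klein_rel o k s -> #|<<[set:: s]>>| <= (4 * o).*2.
Proof.
case: s => [|r1 [|r2 [|r [|x []]]]] // o0 rel_s.
have [Nx Ax] := klein_rel_norm rel_s.
apply: leq_trans (card_gen_index2 Nx Ax (@klein_gens_sub hT r1 r2 r x)) _.
by rewrite leq_double; apply: klein_join_card => //; case: rel_s.
Qed.

Lemma inZp_mulrn n j : (inZp 1 *+ j : 'I_n.+1)%R = inZp j.
Proof. by rewrite Zp_mulrn; apply: val_inj; rewrite /= modnMml mul1n. Qed.

(** * Permutation models of the presented groups *)

Section PermModels.

Variable T : finType.

Lemma perm_transitive_card (s : seq {perm T}) (t0 : T) :
  (forall t, exists2 g, g \in <<[set:: s]>> & g t0 = t) -> #|T| <= #|<<[set:: s]>>|.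
Proof.
move=> tr; apply: leq_trans (leq_imset_card (fun g : {perm T} => g t0) _).
rewrite -cardsT; apply: subset_leq_card; apply/subsetP=> t _.
by have [g Gg <-] := tr t; apply: imset_f.
Qed.

End PermModels.

Section DihedralModel.

Variables (n k : nat).
Hypothesis k2 : n.+1 %| k + k.

Local Notation T := (bool * 'I_n.+1)%type.

(** The pair [(i, a)] stands for [r^a x^i], and [dih_r], [dih_x] are the right multiplications by
    the generators. *)
Definition dih_r (u : T) : T := (u.1, if u.1 then u.2 - inZp 1 else u.2 + inZp 1)%R.
Definition dih_x (u : T) : T := (~~ u.1, if u.1 then u.2 + inZp k else u.2)%R.

Lemma dih_r_inj : injective dih_r.
Proof.
by move=> [i a] [j b] [/= <-]; case: i => /GRing.addIr->.
Qed.

Lemma dih_x_inj : injective dih_x.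
Proof. by move=> [i a] [j b] [/= /negb_inj<-]; case: i => [/GRing.addIr|] ->. Qed.

Let r := perm dih_r_inj.
Let x := perm dih_x_inj.

Lemma dih_r_iter j i a :
  (r ^+ j) (i, a) = (i, if i then a - inZp j else a + inZp j)%R.
Proof.
rewrite -inZp_mulrn; elim: j => [|j IHj].
  by rewrite expg0 perm1 GRing.mulr0n GRing.subr0 GRing.addr0; case: i.
rewrite expgSr permM IHj permE /dih_r /=; case: i {IHj} => /=.
  by rewrite GRing.mulrS GRing.opprD GRing.addrA [in RHS]GRing.addrAC.
by rewrite GRing.mulrS GRing.addrA [in RHS]GRing.addrAC.
Qed.

Lemma dih_model_rel : dih_rel n.+1 k [:: r; x].
Proof.
have z0 m : n.+1 %| m -> inZp m = 0%R :> 'I_n.+1.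
  by move=> /eqP e; apply: val_inj; rewrite /= e.
have zk : (inZp k + inZp k = 0 :> 'I_n.+1)%R.
  by rewrite -(inZp_mulrn n k) -GRing.mulrnDr inZp_mulrn z0.
split.
- apply/permP=> -[i a]; rewrite dih_r_iter perm1 z0 //.
  by rewrite GRing.subr0 GRing.addr0; case: i.
- apply/permP=> -[i a]; rewrite dih_r_iter expgS expg1 permM !permE /dih_x /=.
  case: i => //=; congr (_, _).
  by congr (_ + _)%R; apply/eqP; rewrite -GRing.addr_eq0 zk.
apply: (mulIg x); rewrite mulgKV; apply: (mulgI r); rewrite mulKVg.
apply/permP=> -[i a]; rewrite !permM !permE /dih_r /dih_x /=.
case: i => /=; rewrite ?GRing.addrK //.
by rewrite GRing.addrAC GRing.subrK.
Qed.

Lemma dih_model_card : n.+1.*2 <= #|<<[set:: [:: r; x]]>>|.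
Proof.
have <- : #|{: T}| = n.+1.*2 by rewrite card_prod card_bool card_ord mul2n.
apply: (@perm_transitive_card _ _ (false, 0%R)) => -[i a].
have Gr : r \in <<[set:: [:: r; x]]>> by rewrite mem_gen // !inE eqxx.
have Gx : x \in <<[set:: [:: r; x]]>> by rewrite mem_gen // !inE eqxx orbT.
exists (r ^+ a * x ^+ i); first by rewrite groupM ?groupX.
rewrite permM dih_r_iter /= GRing.add0r valZpK.
by case: i; rewrite ?expg1 ?expg0 ?perm1 ?permE.
Qed.

End DihedralModel.

Section KleinModel.

Variables (n : nat) (kap : bool).

Local Notation T := (bool * (bool * bool) * 'I_n.+1)%type.

(** As for [dih_r], these are right multiplications: [(i, (p, q), a)] stands for
    [r^a r1^p r2^q x^i], and [kap] tells whether [x^2] is [r1 r2] or 1. *)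
Definition kl_r1 (u : T) : T := (u.1.1, (~~ u.1.2.1, u.1.2.2), u.2).
Definition kl_r2 (u : T) : T := (u.1.1, (u.1.2.1, ~~ u.1.2.2), u.2).
Definition kl_r (u : T) : T := (u.1, if u.1.1 then u.2 - inZp 1 else u.2 + inZp 1)%R.
Definition kl_x (u : T) : T :=
  (~~ u.1.1, if u.1.1 then (u.1.2.1 (+) kap, u.1.2.2 (+) kap) else u.1.2, u.2).

Lemma kl_r1_inj : injective kl_r1.
Proof. by move=> [[i [p q]] a] [[j [s t]] b] [] -> /negb_inj -> -> ->. Qed.

Lemma kl_r2_inj : injective kl_r2.
Proof. by move=> [[i [p q]] a] [[j [s t]] b] [] -> -> /negb_inj -> ->. Qed.

Lemma kl_r_inj : injective kl_r.
Proof.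
by move=> [[i [p q]] a] [[j [s t]] b] [/= <- <- <-]; case: i => /GRing.addIr->.
Qed.

Lemma kl_x_inj : injective kl_x.
Proof.
move=> [[i [p q]] a] [[j [s t]] b] [/= /negb_inj<-] e ->; congr (_, _, _).
by move: e; case: i => // -[/addIb-> /addIb->].
Qed.

Let r1 := perm kl_r1_inj.
Let r2 := perm kl_r2_inj.
Let r := perm kl_r_inj.
Let x := perm kl_x_inj.

Lemma kl_r_iter j v a :
  (r ^+ j) (v, a) = (v, if v.1 then a - inZp j else a + inZp j)%R.
Proof.
rewrite -inZp_mulrn; elim: j => [|j IHj].
  by rewrite expg0 perm1 GRing.mulr0n GRing.subr0 GRing.addr0; case: v.1.
rewrite expgSr permM IHj permE /kl_r /=; case: v.1 {IHj} => /=.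
  by rewrite GRing.mulrS GRing.opprD GRing.addrA [in RHS]GRing.addrAC.
by rewrite GRing.mulrS GRing.addrA [in RHS]GRing.addrAC.
Qed.

Lemma kl_model_rel : klein_rel n.+1 kap [:: r1; r2; r; x].
Proof.
have sq (s : {perm T}) : (forall u, s (s u) = u) -> s ^+ 2 = 1.
  by move=> ss; apply/permP=> u; rewrite expgS expg1 permM ss perm1.
have com (s t : {perm T}) : (forall u, t (s u) = s (t u)) -> [~ s, t] = 1.
  by move=> st; apply/eqP/commgP/permP=> u; rewrite !permM st.
split; split.
- split; [apply: sq | apply: sq | ].
  + by move=> [[i [p q]] a]; rewrite !permE /kl_r1 /= negbK.
  + by move=> [[i [p q]] a]; rewrite !permE /kl_r2 /= negbK.
  apply/permP=> -[v a]; rewrite kl_r_iter perm1.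
  have -> : inZp n.+1 = 0%R :> 'I_n.+1 by apply: val_inj; rewrite /= modnn.
  by rewrite GRing.subr0 GRing.addr0; case: v.1.
- by split; apply: com => -[[i [p q]] a]; rewrite !permE.
- apply/permP=> -[[i [p q]] a]; rewrite expgS expg1 permM !permE /kl_x /=.
  rewrite negbK; case: kap; rewrite ?expg1 ?expg0 ?perm1 ?permM ?permE /=.
    by case: i; rewrite /= ?addbT.
  by case: i; rewrite /= ?addbF.
- by apply: com => -[[i [p q]] a]; rewrite !permE /kl_x /kl_r1 /=; case: i; rewrite //= addNb.
- by apply: com => -[[i [p q]] a]; rewrite !permE /kl_x /kl_r2 /=; case: i; rewrite //= addNb.
apply: (mulIg x); rewrite mulgKV; apply: (mulgI r); rewrite mulKVg.
apply/permP=> -[[i [p q]] a]; rewrite !permM !permE /kl_r /kl_x /=.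
by case: i => /=; rewrite ?GRing.addrK ?GRing.subrK.
Qed.

Lemma kl_model_card : (4 * n.+1).*2 <= #|<<[set:: [:: r1; r2; r; x]]>>|.
Proof.
have <- : #|{: T}| = (4 * n.+1).*2.
  by rewrite !card_prod !card_bool card_ord; lia.
apply: (@perm_transitive_card _ _ (false, (false, false), 0%R)) => -[[i [p q]] a].
have mg s : s \in [:: r1; r2; r; x] -> s \in <<[set:: [:: r1; r2; r; x]]>>.
  by move=> ss; rewrite mem_gen // inE.
exists (r ^+ a * r1 ^+ p * r2 ^+ q * x ^+ i).
  by rewrite !groupM ?groupX // mg // !inE eqxx ?orbT.
rewrite !permM kl_r_iter /= GRing.add0r valZpK.
by case: p; case: q; case: i; rewrite ?expg1 ?expg0 ?perm1 ?permE //= ?permE.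
Qed.

End KleinModel.

Lemma dih_model n k : 0 < n -> n %| k + k ->
  exists (hT : finGroupType) (t : seq hT), dih_rel n k t /\ n.*2 <= #|<<[set:: t]>>|.
Proof.
case: n => // n _ k2; exists {perm (bool * 'I_n.+1)%type}.
exists [:: perm (@dih_r_inj n); perm (@dih_x_inj n k)].
by split; [apply: dih_model_rel | apply: dih_model_card].
Qed.

Lemma klein_model o k : 0 < o -> k <= 1%N ->
  exists (hT : finGroupType) (t : seq hT),
    klein_rel o k t /\ (4 * o).*2 <= #|<<[set:: t]>>|.
Proof.
case: o => // o _ k1; exists {perm (bool * (bool * bool) * 'I_o.+1)%type}.
exists [:: perm (@kl_r1_inj o); perm (@kl_r2_inj o); perm (@kl_r_inj o);
           perm (@kl_x_inj o (k == 1%N))].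
split; last exact: kl_model_card.
by have := kl_model_rel o (k == 1%N); case: k k1 => [|[]].
Qed.

Section FamilyCard.

Variables (gT : finGroupType).

Lemma dih_card n k (s : seq gT) : 0 < n -> n %| k + k ->
  presents (dih_rel n k) s -> #|[set: gT]| = n.*2.
Proof.
move=> n0 k2 ps; have [hT [t [rel_t card_t]]] := dih_model n0 k2.
by apply: (presents_card _ ps rel_t card_t) => h u; apply: dih_rel_bound.
Qed.

Lemma klein_card o k (s : seq gT) : 0 < o -> k <= 1%N ->
  presents (klein_rel o k) s -> #|[set: gT]| = (4 * o).*2.
Proof.
move=> o0 k1 ps; have [hT [t [rel_t card_t]]] := klein_model o0 k1.
by apply: (presents_card _ ps rel_t card_t) => h u; apply: klein_rel_bound.
Qed.

Lemma dih_presents n k (s : seq gT) : 0 < n -> dih_rel n k s ->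
  <<[set:: s]>> = [set: gT] -> #|[set: gT]| = n.*2 -> presents (dih_rel n k) s.
Proof.
move=> n0 rel_s gen_s card_s.
apply: (presentsI (N := n.*2) (n := 2)) => //.
- by move=> hT t; apply: dih_rel_size.
- by move=> g h u v; apply: dih_rel_pair.
by move=> hT t; apply: dih_rel_bound.
Qed.

Lemma klein_presents o k (s : seq gT) : 0 < o -> klein_rel o k s ->
  <<[set:: s]>> = [set: gT] -> #|[set: gT]| = (4 * o).*2 -> presents (klein_rel o k) s.
Proof.
move=> o0 rel_s gen_s card_s.
apply: (presentsI (N := (4 * o).*2) (n := 4)) => //.
- by move=> hT t; apply: klein_rel_size.
- by move=> g h u v; apply: klein_rel_pair.
by move=> hT t; apply: klein_rel_bound.
Qed.

End FamilyCard.

(** * The two parametric families *)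

(** The geometric sum [1 + m + ... + m^(k-1)], which is the exponent of [r] in [f^k(x)]. *)
Definition geo (m k : nat) : nat := iter k (fun b => 1 + m * b)%N 0.

Lemma geoD m a b : geo m (a + b) = (geo m a + m ^ a * geo m b)%N.
Proof.
elim: a => [|a IHa]; first by rewrite mul1n.
by rewrite addSn /= -/(geo m (a + b)) IHa -/(geo m a) expnS mulnDr !mulnA !addnA.
Qed.

Lemma geoM m a b : geo m (a * b)%N = (geo m a * geo (m ^ a)%N b)%N.
Proof.
elim: b => [|b IHb]; first by rewrite !muln0.
by rewrite mulnS geoD IHb /= -/(geo _ b); lia.
Qed.

(** Binomial expansion of the powers of [1 + p t], cut off at [p^2]. *)
Lemma geo_expand p t j :
  exists q, (geo (1 + p * t) j = j + p * t * 'C(j, 2) + p * p * q)%N.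
Proof.
elim: j => [|j [q IHj]]; first by exists 0%N; rewrite bin0n !muln0.
exists (q + t * t * 'C(j, 2) + p * t * q)%N.
by rewrite /= -/(geo _ j) IHj binS bin1; lia.
Qed.

Lemma one_modE p m : 1 < p -> m = 1 %[mod p] -> exists t, m = (1 + p * t)%N.
Proof.
move=> p1 e; exists (m %/ p)%N; rewrite {1}(divn_eq m p) e modn_small //.
by rewrite addnC mulnC.
Qed.

Lemma one_mod_expn p m a : m = 1 %[mod p] -> (m ^ a)%N = 1 %[mod p].
Proof. by move=> e; rewrite -modnXm e modnXm exp1n. Qed.

(** For odd [p] the coefficient 'C(p, 2) supplies a further factor [p]. For [p = 2] the sum is
    [1 + m], and [m = 1] modulo 4 is what keeps it from being divisible by 4. *)
Lemma geo_prime_val p m : prime p -> m = 1 %[mod p] -> (p = 2 -> m = 1 %[mod 4]) ->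
  exists2 u, geo m p = (p * u)%N & coprime p u.
Proof.
move=> pr_p mp m4; case: (even_prime pr_p) => [p2|op].
  have [t ->] := one_modE (isT : 1 < 4) (m4 p2); rewrite p2.
  by exists (1 + 2 * t)%N; [rewrite /=; lia | rewrite coprime2n oddD oddM].
have [t ->] := one_modE (prime_gt1 pr_p) mp; have [q ->] := geo_expand p t p.
exists (1 + p * (t * p.-1./2 + q))%N; first by rewrite bin2odd //; lia.
by rewrite /coprime addnC mulnC gcdnMDl gcdn1.
Qed.

(** Modulo [p] the sum is [k], so [k = k' p]. In [geo m (k' p) = geo m k' * geo (m^k') p] the last
    factor carries exactly one [p], and the induction continues with [k']. *)
Lemma geo_prime_power p e m k : prime p -> m = 1 %[mod p] ->
  (p = 2 -> 1 < e -> m = 1 %[mod 4]) -> p ^ e %| geo m k -> p ^ e %| k.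
Proof.
move=> pr_p; elim: e m k => [|e IHe] m k mp m4 pe; first by rewrite dvd1n.
have pk : p %| k.
  have : p %| geo m k by apply: dvdn_trans pe; rewrite expnS dvdn_mulr.
  have [t ->] := one_modE (prime_gt1 pr_p) mp; have [q ->] := geo_expand p t k.
  by rewrite -!mulnA dvdn_addl ?dvdn_mulr // dvdn_addl ?dvdn_mulr.
case: e IHe m4 pe => [|e] IHe m4 pe; first by rewrite expn1.
have /dvdnP[k' kE] := pk; rewrite kE expnSr dvdn_pmul2r ?prime_gt0 //.
have m4' : p = 2 -> (m ^ k')%N = 1 %[mod 4] by move=> p2; apply/one_mod_expn/m4.
have [u uE cpu] := geo_prime_val pr_p (one_mod_expn k' mp) m4'.
apply: (IHe m) => //; first by move=> p2 _; apply: m4.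
move: pe; rewrite kE geoM uE mulnCA expnS dvdn_pmul2l ?prime_gt0 //.
by rewrite Gauss_dvdl // coprimeXl.
Qed.

(* The Hull-Dobell criterion for the map [c |-> 1 + m c] on the integers modulo [n]
   to have period [n]. *)
Lemma geo_dvd n m k : 0 < n -> one_mod_primes n m -> (4 %| n -> m = 1 %[mod 4]) ->
  n %| geo m k -> n %| k.
Proof.
move=> n0 mp m4 nk; apply/(dvdn_partP _ n0) => p.
rewrite mem_primes => /and3P[pr_p _ pn]; rewrite p_part.
apply: (@geo_prime_power p _ m) => //; first exact: mp.
  move=> p2 l2; apply: m4; apply: dvdn_trans (dvdn_part 2 n).
  by rewrite p_part; apply: (@dvdn_exp2l 2 2); rewrite -[X in logn X]p2.
by apply: dvdn_trans nk; rewrite -p_part dvdn_part.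
Qed.

Lemma one_mod_coprime n m : 0 < n -> one_mod_primes n m -> coprime m n.
Proof.
move=> n0 mp; rewrite /coprime eqn_leq gcdn_gt0 n0 orbT andbT leqNgt.
apply/negP=> g1; have pr_p := pdiv_prime g1; have := pdiv_dvd (gcdn m n).
rewrite dvdn_gcd => /andP[pm pn]; have := mp _ pr_p pn.
by rewrite (eqP pm) modn_small // prime_gt1.
Qed.

Lemma full_image_inj (gT : finGroupType) (f : gT -> gT) (s : seq gT) :
  {morph f : y z / y * z} -> <<[set:: s]>> = [set: gT] ->
  {subset s <= codom f} -> injective f.
Proof.
move=> fM gen_s sf; have gF : group_set (f @: [set: gT]).
  apply/group_setP; split=> [|_ _ /imsetP[u _ ->] /imsetP[v _ ->]].
    by apply/imsetP; exists 1; rewrite ?inE ?(endo1 fM).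
  by apply/imsetP; exists (u * v); rewrite ?inE ?fM.
have : f @: [set: gT] = [set: gT].
  apply/eqP; rewrite eqEsubset subsetT /=.
  apply: (@subset_trans _ _ (mem <<[set:: s]>>)); first by rewrite gen_s.
  rewrite (gen_subG _ (Group gF)); apply/subsetP=> y; rewrite inE => /sf /codomP[z ->].
  by apply: imset_f; rewrite inE.
move=> e u v; have /imset_injP : #|f @: [set: gT]| == #|[set: gT]| by rewrite e.
by apply; rewrite inE.
Qed.

Lemma codom_expg (gT : finGroupType) (f : gT -> gT) r m n :
  {morph f : y z / y * z} -> f r = r ^+ m -> r ^+ n = 1 -> coprime m n -> 0 < m ->
  r \in codom f.
Proof.
move=> fM fr rn cmn m0; have [[u v] /= uvE] := coprimeP _ m0 cmn.
apply/codomP; exists (r ^+ u); rewrite (endoX fM) fr -expgM.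
have -> : (m * u = 1 + v * n)%N by lia.
by rewrite expgD expg1 mulnC expgM rn expg1n mulg1.
Qed.

(** [x] both centralises and inverts [x^2 = r^k], so [n %| k + k] keeps the group from collapsing.
    The congruence on [k] expresses [f(x)^2 = f(r)^k], as [x r] has the same square as [x]. *)
Definition dih_param (n k m : nat) : Prop :=
  [/\ 0 < n, n %| k + k, k = (m * k)%N %[mod n], one_mod_primes n m
    & 4 %| n -> m = 1 %[mod 4]].

Definition klein_param (o k m : nat) : Prop :=
  [/\ odd o, k <= 1%N & one_mod_primes o m].

Section DihedralFamily.

Variables (gT : finGroupType) (f : gT -> gT) (n k m : nat) (r x : gT).
Hypotheses (fM : {morph f : y z / y * z}) (pnm : dih_param n k m).
Hypotheses (ps : presents (dih_rel n k) [:: r; x]) (fr : f r = r ^+ m) (fx : f x = x * r).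

Let n0 : 0 < n. Proof. by case: pnm. Qed.

Lemma dih_family_card : #|[set: gT]| = n.*2.
Proof. by case: pnm => _ k2 _ _ _; apply: dih_card ps. Qed.

Lemma dih_family_rel : [/\ r ^+ n = 1, x ^+ 2 = r ^+ k & x * r * x^-1 = r^-1].
Proof. by case: ps. Qed.

Lemma dih_family_order : #[r] = n.
Proof.
have [rn x2 c] := dih_family_rel; have [gen_s _ _] := ps.
apply/eqP; rewrite eqn_leq dvdn_leq ?order_dvdn ?rn //=.
rewrite -leq_double -dih_family_card -gen_s.
apply: (@card_gen_index2 _ <[r]>%G x).
- by rewrite -groupV -cycle_subG norms_cycle conjV_norm // c groupV cycle_id.
- by rewrite -[x * x]/(x ^+ 2) x2 mem_cycle.
by move=> y; rewrite !inE => /orP[]/eqP->; rewrite ?eqxx ?cycle_id ?orbT.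
Qed.

Lemma dih_family_inj : injective f.
Proof.
have [rn _ _] := dih_family_rel; have [gen_s _ _] := ps.
have [_ _ _ mp _] := pnm; have rf : r \in codom f.
  have [m0|m0] := posnP m.
    have n1 : n = 1%N.
      by have := one_mod_coprime n0 mp; rewrite m0 /coprime gcd0n => /eqP.
    by apply/codomP; exists r; rewrite fr m0 expg0 -rn n1 expg1.
  exact: (codom_expg fM fr rn (one_mod_coprime n0 mp) m0).
apply: (full_image_inj fM gen_s) => y; rewrite !inE => /orP[]/eqP-> //.
have /codomP[r' rE] := rf; apply/codomP; exists (x * r'^-1).
by rewrite fM (endoV fM) -rE fx mulgK.
Qed.

Lemma dih_family_iter j : iter j f x = x * r ^+ geo m j.
Proof.
elim: j => [|j IHj]; first by rewrite expg0 mulg1.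
by rewrite iterS IHj fM (endoX fM) fx fr -mulgA -expgM expgD expg1.
Qed.

Lemma dih_family_cyc : #|cyc f x| = n.
Proof.
have [_ _ _ mp m4] := pnm; apply/eqP; rewrite eqn_leq; apply/andP; split.
  rewrite -dih_family_order orderE -(card_lcoset <[r]>%G x).
  apply: subset_leq_card; apply/subsetP=> _ /cycP[j ->].
  by rewrite dih_family_iter mem_lcoset mulKg mem_cycle.
rewrite dvdn_leq //; first by rewrite card_cyc fingraph.order_gt0.
apply: (geo_dvd n0 mp m4); rewrite -dih_family_order order_dvdn.
rewrite -(inj_eq (mulgI x)) -dih_family_iter mulg1; apply/eqP.
by apply: iter_card_cyc; apply: dih_family_inj.
Qed.

Lemma dih_family_half : #|[set: gT]| = #|cyc f x|.*2.
Proof. by rewrite dih_family_card dih_family_cyc. Qed.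

Lemma dih_family_nonabelian : 2 < n -> ~~ abelian [set: gT].
Proof.
move=> n2; have [_ _ c] := dih_family_rel; apply/negP=> /centsP abG.
have : r ^+ 2 == 1.
  rewrite expgS expg1 -eq_invg_mul -c (abG x _ r) ?inE //.
  by rewrite mulgK.
by rewrite -order_dvdn dih_family_order => /(dvdn_leq (isT : 0 < 2)); rewrite leqNgt n2.
Qed.

(** All [x r^j] have the same square, because [x] inverts [r]. This limits the orders outside [<r>]
    and lets isomorphisms recognise [<r>]. *)
Lemma dih_family_outside y : y \notin <[r]> -> y ^+ 2 = r ^+ k.
Proof.
move=> nry; have [rn x2 c] := dih_family_rel; have [gen_s _ _] := ps.
have : y \in x *: <[r]>.
  have cA : (#|<[r]>|).*2 = #|[set: gT]| by rewrite -orderE dih_family_order dih_family_card.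
  have nA : <[r]>%G != [set: gT] :> {set gT}.
    apply/eqP=> /= e; have : #[r] = #|[set: gT]| by rewrite orderE e.
    by rewrite dih_family_order dih_family_card; move: n0; lia.
  have nx : x \notin <[r]>.
    apply: contra nA => rx; rewrite eqEsubset subsetT -gen_s gen_subG.
    by apply/subsetP=> z; rewrite !inE => /orP[]/eqP->; rewrite ?cycle_id.
  have : x *: <[r]> = ~: <[r]>.
    apply/eqP; rewrite eqEcard; apply/andP; split.
      apply/subsetP=> _ /lcosetP[z rz ->]; rewrite inE groupMr //.
    by move: (cardsC <[r]>) cA; rewrite -cardsT card_lcoset; clia.
  by move=> ->; rewrite inE.
case/lcosetP=> _ /cycleP[j ->] ->; rewrite expgS expg1.
have cj : x * r ^+ j = r ^- j * x.
  have xE w : x * w * x^-1 = w ^ x^-1 by rewrite conjgE invgK mulgA.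
  by apply: (mulIg x^-1); rewrite mulgK -[RHS]expgVn -c !xE conjXg.
rewrite {1}cj -mulgA (mulgA x) -[x * x]/(x ^+ 2) x2 -expgD addnC expgD mulgA.
by rewrite mulVg mul1g.
Qed.

End DihedralFamily.

(** The universal property maps the group onto the permutation model, where all this can be seen. *)
Lemma klein_nondegenerate (gT : finGroupType) o k (r1 r2 r x : gT) :
  0 < o -> k <= 1%N -> presents (klein_rel o k) [:: r1; r2; r; x] ->
  [/\ r1 != 1, r2 != 1, r1 * r2 != 1 & o %| #[r]].
Proof.
case: o => // o _ k1 [_ _ univ].
have rel_t : klein_rel o.+1 k [:: perm (@kl_r1_inj o); perm (@kl_r2_inj o);
    perm (@kl_r_inj o); perm (@kl_x_inj o (k == 1%N))].
  by have := kl_model_rel o (k == 1%N); case: k k1 {univ} => [|[]].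
have [h [h1 h2 h3 _]] := univ _ _ rel_t.
have hX y : h y != 1 -> y != 1 by apply: contraNneq => ->; rewrite morph1.
have perm_neq (T : finType) (s : {perm T}) t : s t != t -> s != 1.
  by apply: contraNneq => ->; rewrite perm1.
split.
- by apply: hX; rewrite h1; apply: (perm_neq _ _ (false, (false, false), 0%R)); rewrite permE.
- by apply: hX; rewrite h2; apply: (perm_neq _ _ (false, (false, false), 0%R)); rewrite permE.
- apply: hX; rewrite morphM ?inE // h1 h2.
  by apply: (perm_neq _ _ (false, (false, false), 0%R)); rewrite permM !permE.
have : perm (@kl_r_inj o) ^+ #[r] = 1 by rewrite -h3 -morphX ?inE // expg_order morph1.
move/permP/(_ (false, (false, false), 0%R)); rewrite kl_r_iter perm1 => /(congr1 snd) /=.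
by rewrite GRing.add0r => /(congr1 val) /= /eqP.
Qed.

Section KleinFamily.

Variables (gT : finGroupType) (f : gT -> gT) (o k m : nat) (r1 r2 r x : gT).
Hypotheses (fM : {morph f : y z / y * z}) (pkm : klein_param o k m).
Hypothesis ps : presents (klein_rel o k) [:: r1; r2; r; x].
Hypotheses (f1 : f r1 = r2) (f2 : f r2 = r1) (fr : f r = r ^+ m).
Hypothesis fx : f x = x * r1 * r.

Local Notation A := (klein_join r1 r2 r).

Let o0 : 0 < o. Proof. by case: pkm => oo _ _; case: (o) oo. Qed.
Let oo : odd o. Proof. by case: pkm. Qed.
Let k1 : k <= 1%N. Proof. by case: pkm. Qed.
Let rel_s : klein_rel o k [:: r1; r2; r; x]. Proof. by case: ps. Qed.
Let rel_r : Z22xZo_rel o r1 r2 r. Proof. by case: rel_s. Qed.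
Let gen_s : <<[set:: [:: r1; r2; r; x]]>> = [set: gT]. Proof. by case: ps. Qed.

Let mp : one_mod_primes o m. Proof. by case: pkm. Qed.

Lemma klein_family_card : #|[set: gT]| = (4 * o).*2.
Proof. exact: klein_card ps. Qed.

Lemma klein_family_order : #[r] = o.
Proof.
have [_ _ _ or] := klein_nondegenerate o0 k1 ps.
have [[_ _ ro] _] := rel_r.
by apply/eqP; rewrite eqn_dvd or order_dvdn ro eqxx.
Qed.

Lemma klein_family_inj : injective f.
Proof.
have [[_ _ ro] _] := rel_r; have rf : r \in codom f.
  have [m0|m0] := posnP m.
    have n1 : o = 1%N.
      by have := one_mod_coprime o0 mp; rewrite m0 /coprime gcd0n => /eqP.
    by apply/codomP; exists r; rewrite fr m0 expg0 -ro n1 expg1.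
  exact: (codom_expg fM fr ro (one_mod_coprime o0 mp) m0).
apply: (full_image_inj fM gen_s) => y; rewrite !inE => /or4P[]/eqP-> //.
- by apply/codomP; exists r2.
- by apply/codomP; exists r1.
have /codomP[r' rE] := rf; apply/codomP; exists (x * r'^-1 * r2^-1).
by rewrite !fM !(endoV fM) -rE fx f2 mulgK mulgK.
Qed.

(** The component of [x^-1 f^j(x)] in the Klein four-group; it has period 4. *)
Let v j := iter j (fun w => r1 * f w) 1.

Let v4 j : v j = nth 1 [:: 1; r1; r1 * r2; r2] (j %% 4).
Proof.
have [[s1 s2 _] _] := rel_r; have [c12 _ _] := klein_commute rel_r.
elim: j => // j; rewrite /v /= -/(v j) => ->.
have : j %% 4 < 4 by rewrite ltn_mod.
have -> : j.+1 %% 4 = (j %% 4).+1 %% 4 by rewrite -addn1 -modnDml addn1.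
case: (j %% 4) => [|[|[|[|]]]] // _ /=.
- by rewrite (endo1 fM) mulg1.
- by rewrite f1.
- by rewrite fM f1 f2 -c12 mulgA -[r1 * r1]/(r1 ^+ 2) s1 mul1g.
by rewrite f2 -[r1 * r1]/(r1 ^+ 2) s1.
Qed.

Lemma klein_family_iter j : iter j f x = x * v j * r ^+ geo m j.
Proof.
have [_ cr1 cr2] := klein_commute rel_r.
have c1 := commute_sym cr1; have c2 := commute_sym cr2.
have cv i : commute r (v i).
  rewrite v4; have : i %% 4 < 4 by rewrite ltn_mod.
  case: (i %% 4) => [|[|[|[|]]]] //= _;
    by [exact: commute1 | exact: c1 | exact: (commuteM c1 c2) | exact: c2].
elim: j => [|j IHj]; first by rewrite /= !mulg1.
have fv : commute r (f (v j)).
  have -> : f (v j) = r1^-1 * v j.+1 by rewrite /= mulKg.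
  exact: (commuteM (commuteV c1) (cv j.+1)).
rewrite iterS IHj !fM (endoX fM) fx fr /= -/(v j) -expgM expgD expg1.
by rewrite -!mulgA; congr (_ * (_ * _)); rewrite mulgA fv -!mulgA.
Qed.

Lemma klein_family_stable : stable f A.
Proof.
have mA := @klein_join_mem gT r1 r2 r.
have fA y : y \in [:: r1; r2; r] -> f y \in A.
  rewrite !inE => /or3P[]/eqP->.
  - by rewrite f1 mA // !inE eqxx orbT.
  - by rewrite f2 mA // !inE eqxx.
  by rewrite fr groupX // mA // !inE eqxx !orbT.
have AE : <<[set:: [:: r1; r2; r]]>> = A.
  apply/eqP; rewrite eqEsubset; apply/andP; split.
    by rewrite gen_subG; apply/subsetP=> y; rewrite inE; apply: mA.
  by rewrite /= !join_subG !cycle_subG !mem_gen ?inE ?eqxx ?orbT.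
rewrite -AE; apply: (gen_stable fM) => y; rewrite inE => ys.
by rewrite AE; apply: fA.
Qed.

(** At a period [L] the Klein component is the inverse of a power of [r]. Its square is 1 and [r]
    has odd order, so both are trivial; this gives [4 %| L] and, by [geo_dvd], [o %| L]. *)
Lemma klein_family_cyc : #|cyc f x| = (4 * o)%N.
Proof.
have [n1 n2 n12 _] := klein_nondegenerate o0 k1 ps.
have [[s1 s2 ro] _] := rel_r; have [c12 cr1 cr2] := klein_commute rel_r.
apply/eqP; rewrite eqn_leq; apply/andP; split.
  apply: leq_trans (klein_join_card o0 rel_r); rewrite -(card_lcoset A x).
  apply: subset_leq_card; apply/subsetP=> _ /cycP[j ->].
  have Ab : x^-1 * f x \in A.
    rewrite fx -!mulgA mulKg groupM // klein_join_mem // !inE eqxx ?orbT //.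
  rewrite mem_lcoset; apply: (diff_iter_mem fM) Ab; exact: klein_family_stable.
set L := #|cyc f x|; have L0 : 0 < L by rewrite /L card_cyc fingraph.order_gt0.
have := iter_card_cyc klein_family_inj x; rewrite -/L klein_family_iter -mulgA => e.
have {}e : v L * r ^+ geo m L = 1 by apply: (mulgI x); rewrite e mulg1.
have v2 : v L ^+ 2 = 1.
  rewrite v4; have : L %% 4 < 4 by rewrite ltn_mod.
  case: (L %% 4) => [|[|[|[|]]]] // _ /=; first by rewrite expg1n.
  by rewrite expgMn // s1 s2 mulg1.
have vr : v L = (r ^+ geo m L)^-1 by apply: (mulIg (r ^+ geo m L)); rewrite e mulVg.
have og : o %| geo m L.
  have : o %| geo m L * 2.
    by rewrite -klein_family_order order_dvdn expgM -[_ ^+ 2]invgK -expgVn -vr v2 invg1.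
  by rewrite Gauss_dvdl // coprimen2.
have oL : o %| L.
  by apply: (geo_dvd o0 mp) og => o4; have := dvdn_odd o4 oo.
have v1 : v L = 1.
  have [q qE] := dvdnP og.
  by rewrite vr qE mulnC expgM ro expg1n invg1.
have fourL : 4 %| L.
  move: v1; rewrite v4 /dvdn; have : L %% 4 < 4 by rewrite ltn_mod.
  by case: (L %% 4) => [|[|[|[|]]]] //= _ /eqP; rewrite ?(negPf n1) ?(negPf n2) ?(negPf n12).
by apply: dvdn_leq => //; rewrite Gauss_dvd ?fourL // (@coprimeXl 2 2) // coprime2n.
Qed.

Lemma klein_family_half : #|[set: gT]| = #|cyc f x|.*2.
Proof. by rewrite klein_family_card klein_family_cyc. Qed.

Lemma klein_family_nonabelian : 2 < o -> ~~ abelian [set: gT].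
Proof.
move=> n2; have [_ [_ _ _ c]] := rel_s; apply/negP=> /centsP abG.
have : r ^+ 2 == 1.
  rewrite expgS expg1 -eq_invg_mul -c (abG x _ r) ?inE //.
  by rewrite mulgK.
by rewrite -order_dvdn klein_family_order => /(dvdn_leq (isT : 0 < 2)); rewrite leqNgt n2.
Qed.

(** This locates a generator of [<r>] under isomorphisms: [o] is odd, so [r^4] still generates. *)
Lemma klein_family_expg4 y : y ^+ 4 \in <[r]>.
Proof.
have [[s1 s2 ro] _] := rel_r; have [c12 cr1 cr2] := klein_commute rel_r.
have [_ [x2 /eqP/commgP x1 /eqP/commgP x2' c]] := rel_s.
have [Nx Ax] := klein_rel_norm rel_s.
have inA a : a \in A -> a ^+ 4 \in <[r]>.
  case/(klein_joinP rel_r)=> z [j [-> z2 cz _]].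
  rewrite expgMn; last exact: commuteX.
  by rewrite (expgM z 2 2) z2 expg1n mul1g -expgM mem_cycle.
have inxA a : a \in A -> (x * a) ^+ 4 = 1.
  case/(klein_joinP rel_r)=> z [j [-> z2 cz [i [l zE]]]].
  have cxz : commute x z.
    by rewrite zE; apply: commuteM; apply: commuteX; apply: commute_sym.
  have xr : x * r ^+ j = r ^- j * x.
    have xE w : x * w * x^-1 = w ^ x^-1 by rewrite conjgE invgK mulgA.
    by apply: (mulIg x^-1); rewrite mulgK -[RHS]expgVn -c !xE conjXg.
  have sq : (x * (z * r ^+ j)) ^+ 2 = x ^+ 2.
    rewrite expgS expg1 [RHS]expgS expg1.
    have e1 : x * (z * r ^+ j) = z * (r ^- j * x) by rewrite mulgA cxz -mulgA xr.
    have e2 : x * (z * r ^+ j) = x * r ^+ j * z by rewrite -mulgA (commuteX j cz).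
    rewrite {1}e2 e1 xr.
    have zz : z * z = 1 by [].
    rewrite -!mulgA (mulgA z z) zz mul1g !mulgA -xr.
    by rewrite mulgK.
  have e12 : (r1 * r2) ^+ 2 = 1 by rewrite expgMn // s1 s2 mulg1.
  by rewrite (expgM _ 2 2) sq x2 -expgM mulnC expgM e12 expg1n.
have := gen_index2_sub Nx Ax (@klein_gens_sub gT r1 r2 r x).
rewrite gen_s => /subsetP/(_ y); rewrite inE => /(_ isT).
by case/setUP=> [/inA|/lcosetP[a Aa ->]] //; rewrite inxA.
Qed.

End KleinFamily.

(** * Values of lambda *)

Lemma fdg_endoM (X : fdg) : {morph fdg_endo X : y z / y * z}.
Proof. by move=> y z; rewrite morphM ?inE. Qed.

Definition dih_fdg (n k m : nat) (X : fdg) : Prop :=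
  exists r x : X,
    [/\ presents (dih_rel n k) [:: r; x],
        fdg_endo X r = r ^+ m & fdg_endo X x = x * r].

Definition klein_fdg (o k m : nat) (X : fdg) : Prop :=
  exists r1 r2 r x : X,
    presents (klein_rel o k) [:: r1; r2; r; x] /\
    [/\ fdg_endo X r1 = r2, fdg_endo X r2 = r1,
        fdg_endo X r = r ^+ m & fdg_endo X x = x * r1 * r].

Lemma Lambda_attained (T : finType) (f : T -> T) : 0 < #|T| ->
  exists x, fingraph.order f x = Lambda f.
Proof. by case/(eq_bigmax (fingraph.order f)) => x; exists x. Qed.

Lemma lambda_halfE (T : finType) (f : T -> T) : 0 < #|T| ->
  lambda f = (1 / 2)%R <-> (Lambda f).*2 = #|T|.
Proof.
move=> T0; have nzT : (#|T|%:R != 0 :> rat)%R by rewrite Num.Theory.pnatr_eq0 -lt0n.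
rewrite /lambda -muln2; split=> [/eqP|e].
  rewrite GRing.eqr_div // GRing.mul1r -GRing.natrM Num.Theory.eqr_nat => /eqP.
  by [].
by apply/eqP; rewrite GRing.eqr_div // GRing.mul1r -GRing.natrM e.
Qed.

Lemma lambda_le_half (T : finType) (f : T -> T) : 0 < #|T| ->
  (Lambda f).*2 <= #|T| -> (lambda f <= 1 / 2)%R.
Proof.
move=> T0 le; rewrite /lambda Num.Theory.ler_pdivrMr ?Num.Theory.ltr0n //.
rewrite -Num.Theory.ler_pdivrMl // GRing.div1r GRing.invrK -GRing.natrM Num.Theory.ler_nat.
by rewrite mul2n.
Qed.

Lemma eq_lambda (T : finType) (f g : T -> T) : f =1 g -> lambda f = lambda g.
Proof.
move=> fg; rewrite /lambda /Lambda; congr (_%:R / _)%R; apply: eq_bigr => x _.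
exact/eq_card/(eq_fconnect fg).
Qed.

Section LambdaGroup.

Variable gT : finGroupType.
Local Notation G := [set: gT].

Lemma card_gT_gt0 : 0 < #|gT|.
Proof. by apply/card_gt0P; exists 1. Qed.

(** A cycle through half of the points is a longest one, since every other cycle lies in its
    complement. *)
Lemma lambda_half_cyc (f : gT -> gT) : injective f ->
  lambda f = (1 / 2)%R <-> exists x, #|cyc f x|.*2 = #|G|.
Proof.
move=> fI; rewrite (lambda_halfE f card_gT_gt0) cardsT; split=> [e|[x e]].
  have [x xE] := Lambda_attained f card_gT_gt0.
  by exists x; rewrite card_cyc xE.
rewrite -e; congr double; apply/eqP; rewrite eqn_leq card_cyc leq_bigmax andbT.
apply/bigmax_leqP => y _; rewrite -!card_cyc.
have [xy|nxy] := boolP (y \in cyc f x); first by rewrite (cyc_eq fI xy).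
have dis : cyc f x :&: cyc f y = set0.
  apply/setP=> w; rewrite in_setI in_set0; apply/negP=> /andP[xw yw].
  by case/negP: nxy; rewrite -(cyc_eq fI xw) (cyc_eq fI yw) cyc_refl.
have := max_card (mem (cyc f x :|: cyc f y)); rewrite -e cardsU dis cards0 subn0.
by rewrite -addnn leq_add2l.
Qed.

(** A longer cycle would still satisfy the hypothesis of [split_nonabelian], and would then be the
    complement of a subgroup of index 2, hence exactly half. *)
Lemma nonabelian_cyc_le (f : gT -> gT) x : {morph f : y z / y * z} -> injective f ->
  ~~ abelian G -> #|cyc f x|.*2 <= #|G|.
Proof.
move=> fM fI nab; rewrite leqNgt; apply/negP=> lt; have long := ltnW lt.
have [A nA sOA] := split_nonabelian fM fI nab long.
have gt2 := nonabelian_card_gt2 nab.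
have [cA OE] := long_lcoset_half fM fI gt2 long nA sOA.
move: lt; rewrite OE -cA ltn_double ltnNge; case/negP.
by rewrite -(leq_add2l #|A|) cardsC -cardsT -cA addnn.
Qed.

Lemma lambda_group_le_half :
  (forall a y, a \in Aut G -> #|cyc a y|.*2 <= #|G|) -> (lambda_group gT <= 1 / 2)%R.
Proof.
move=> le; apply/Order.TotalTheory.bigmax_leP; split=> [|a Aa].
  by rewrite Num.Theory.divr_ge0.
apply: (lambda_le_half card_gT_gt0).
have [x <-] := Lambda_attained a card_gT_gt0.
by rewrite -card_cyc -cardsT le.
Qed.

Lemma aut_perm (f : gT -> gT) (fM : {morph f : y z / y * z}) (fI : injective f) :
  perm fI \in Aut G.
Proof.
rewrite inE; apply/andP; split; first by apply/subsetP=> y; rewrite !inE.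
by apply/morphicP=> y z _ _; rewrite !permE fM.
Qed.

Lemma lambda_le_group (f : gT -> gT) : {morph f : y z / y * z} -> injective f ->
  (lambda f <= lambda_group gT)%R.
Proof.
move=> fM fI; rewrite (@eq_lambda _ f (perm fI)); last by move=> y; rewrite permE.
exact/Order.TotalTheory.le_bigmax_cond/(aut_perm fM).
Qed.

Lemma aut_morph a : a \in Aut G -> {morph a : y z / y * z}.
Proof. by move=> Aa y z; apply: (morphicP (Aut_morphic Aa)); rewrite inE. Qed.

End LambdaGroup.

Lemma maximal_half (X : fdg) x : injective (fdg_endo X) ->
  #|cyc (fdg_endo X) x|.*2 = #|[set: X]| ->
  (forall a y, a \in Aut [set: X] -> #|cyc a y|.*2 <= #|[set: X]|) ->
  lambda_maximal X.
Proof.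
move=> fI half le; have fh : lambda (fdg_endo X) = (1 / 2)%R.
  by apply/lambda_half_cyc => //; exists x.
apply/eqP; rewrite /lambda_maximal /fdg_lambda Order.POrderTheory.eq_le.
by rewrite lambda_le_group //= ?fh ?lambda_group_le_half //; apply: fdg_endoM.
Qed.

Lemma maximal_nonabelian (X : fdg) x : injective (fdg_endo X) ->
  #|cyc (fdg_endo X) x|.*2 = #|[set: X]| -> ~~ abelian [set: X] -> lambda_maximal X.
Proof.
move=> fI half nab; apply: (maximal_half fI half) => a y Aa.
by apply: nonabelian_cyc_le => //; [apply: aut_morph | apply: perm_inj].
Qed.

Lemma lambda_half_intro (X : fdg) x : injective (fdg_endo X) ->
  #|cyc (fdg_endo X) x|.*2 = #|[set: X]| -> periodic X /\ fdg_lambda X = (1 / 2)%R.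
Proof.
move=> fI half; split; first exact: injF_bij.
by apply/lambda_half_cyc => //; exists x.
Qed.

Lemma dih_fdg_half n k m X : dih_param n k m -> dih_fdg n k m X ->
  injective (fdg_endo X) /\ exists x, #|cyc (fdg_endo X) x|.*2 = #|[set: X]|.
Proof.
move=> pnm [r [x [ps fr fx]]]; have fM := @fdg_endoM X; split.
  exact: dih_family_inj fM pnm ps fr fx.
by exists x; rewrite (dih_family_half fM pnm ps fr fx).
Qed.

Lemma klein_fdg_half o k m X : klein_param o k m -> klein_fdg o k m X ->
  injective (fdg_endo X) /\ exists x, #|cyc (fdg_endo X) x|.*2 = #|[set: X]|.
Proof.
move=> pkm [r1 [r2 [r [x [ps [f1 f2 fr fx]]]]]]; have fM := @fdg_endoM X; split.
  exact: klein_family_inj fM pkm ps f1 f2 fr fx.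
by exists x; rewrite (klein_family_half fM pkm ps f1 f2 fr fx).
Qed.

Section SubgroupGenerators.

Variables (hT : finGroupType) (t : seq hT).
Local Notation G := <<[set:: t]>>%G.

(** The model generates a subgroup of a symmetric group; the carrier of an [fdg] is a group type, so
    the generators are moved to the type of that subgroup. *)
Definition subg_gens : seq (subg_of G) := map (subg G) t.

Lemma subg_gensK : map sgval subg_gens = t.
Proof.
rewrite -map_comp -[RHS]map_id; apply/eq_in_map => y ty /=.
by apply: subgK; rewrite mem_gen // inE.
Qed.

Lemma sgval_morph : {morph (sgval : subg_of G -> hT) : y z / y * z}.
Proof. by []. Qed.

Lemma subg_gens_full : <<[set:: subg_gens]>> = [set: subg_of G].
Proof.
apply/eqP; rewrite eqEsubset subsetT /=; apply/subsetP=> u _.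
pose K := [set sgval w | w in <<[set:: subg_gens]>>].
have gK : group_set K.
  apply/group_setP; split=> [|_ _ /imsetP[w Gw ->] /imsetP[v Gv ->]].
    by apply/imsetP; exists 1; rewrite ?group1.
  by apply/imsetP; exists (w * v); rewrite ?groupM.
have : sgval u \in Group gK.
  apply: (subsetP _ _ (valP u)); rewrite gen_subG; apply/subsetP=> y.
  rewrite inE -{1}subg_gensK => /mapP[w tw ->].
  by apply: imset_f; rewrite mem_gen // inE.
by case/imsetP=> w Gw /val_inj->.
Qed.

Lemma card_subg_gens : #|[set: subg_of G]| = #|G|.
Proof. by rewrite cardsT card_sub. Qed.

End SubgroupGenerators.

Lemma dih_rel_inj n k (gT hT : finGroupType) (h : gT -> hT) (s : seq gT) :
  {morph h : y z / y * z} -> injective h -> dih_rel n k (map h s) -> dih_rel n k s.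
Proof.
move=> hM hI; have hX := endoX hM; have hV := endoV hM; have h1 := endo1 hM.
case: s => [|r [|x []]] //= [a1 a2 a3]; split; apply: hI.
- by rewrite hX h1.
- by rewrite !hX.
by rewrite !hM !hV.
Qed.

Lemma klein_rel_inj o k (gT hT : finGroupType) (h : gT -> hT) (s : seq gT) :
  {morph h : y z / y * z} -> injective h -> klein_rel o k (map h s) -> klein_rel o k s.
Proof.
move=> hM hI; have hX := endoX hM; have hV := endoV hM; have h1 := endo1 hM.
case: s => [|r1 [|r2 [|r [|x []]]]] //= [[[a1 a2 a3] [a4 a5 a6]] [a7 a8 a9 a10]].
have hR y z : h [~ y, z] = [~ h y, h z] by rewrite /commg /conjg !hM !hV.
split; [split; split | split]; apply: hI;
  by rewrite ?hR ?hM ?hX ?hM ?hV ?h1.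
Qed.

Lemma dih_exists n k m : dih_param n k m -> exists X, dih_fdg n k m X.
Proof.
case=> n0 k2 mk mp m4; have [hT [t [rel_t card_t]]] := dih_model n0 k2.
pose s := subg_gens t; have rel_s : dih_rel n k s.
  apply: (dih_rel_inj (@sgval_morph _ t) val_inj).
  by rewrite subg_gensK.
have cardG : #|[set: subg_of <<[set:: t]>>%G]| = n.*2.
  rewrite card_subg_gens; apply/eqP; rewrite eqn_leq card_t andbT.
  exact: dih_rel_bound rel_t.
have ps := dih_presents n0 rel_s (subg_gens_full t) cardG.
case: s rel_s ps => [|r [|x []]] // [rn x2 c] ps.
have rX a b : a = b %[mod n] -> r ^+ a = r ^+ b.
  by move=> e; rewrite -(expg_mod a rn) e expg_mod.
have xrj j : x * r ^+ j = r ^- j * x.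
  have xE w : x * w * x^-1 = w ^ x^-1 by rewrite conjgE invgK mulgA.
  by apply: (mulIg x^-1); rewrite mulgK -[RHS]expgVn -c !xE conjXg.
have [f [fr fx]] : exists f : {morphism [set: subg_of <<[set:: t]>>%G] >->
    subg_of <<[set:: t]>>%G}, [seq f y | y <- [:: r; x]] = [:: r ^+ m; x * r].
  apply: (presents_endo ps); split.
  - by rewrite -expgM mulnC expgM rn expg1n.
  - rewrite -expgM -(rX _ _ mk) -x2 [LHS]expgS expg1 [RHS]expgS expg1.
    have xr := xrj 1%N; rewrite expg1 in xr; rewrite {1}xr -mulgA (mulgA x).
    by rewrite -[x * x]/(x ^+ 2) x2 -expgSr expgS mulKg.
  have xrj' : x * r * r ^+ m = r ^- m * (x * r).
    by rewrite -mulgA -expgS expgSr mulgA xrj mulgA.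
  by rewrite xrj' mulgK.
by exists (FDG f); exists r, x.
Qed.

Lemma klein_exists o k m : klein_param o k m -> exists X, klein_fdg o k m X.
Proof.
case=> oo k1 mp; have o0 : 0 < o by case: (o) oo.
have [hT [t [rel_t card_t]]] := klein_model o0 k1.
pose s := subg_gens t; have rel_s : klein_rel o k s.
  apply: (klein_rel_inj (@sgval_morph _ t) val_inj).
  by rewrite subg_gensK.
have cardG : #|[set: subg_of <<[set:: t]>>%G]| = (4 * o).*2.
  rewrite card_subg_gens; apply/eqP; rewrite eqn_leq card_t andbT.
  exact: klein_rel_bound rel_t.
have ps := klein_presents o0 rel_s (subg_gens_full t) cardG.
case: s rel_s ps => [|r1 [|r2 [|r [|x []]]]] // rel_s ps.
have [rel_r [x2 cx1 cx2 c]] := rel_s.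
have [[s1 s2 ro] _] := rel_r; have [c12 cr1 cr2] := klein_commute rel_r.
have {}cx1 : commute r1 x by apply/commgP/eqP.
have {}cx2 : commute r2 x by apply/commgP/eqP.
have com0 (y z : subg_of <<[set:: t]>>%G) : commute y z -> [~ y, z] = 1.
  by move=> cyz; apply/eqP/commgP.
have xrj j : x * r ^+ j = r ^- j * x.
  have xE w : x * w * x^-1 = w ^ x^-1 by rewrite conjgE invgK mulgA.
  by apply: (mulIg x^-1); rewrite mulgK -[RHS]expgVn -c !xE conjXg.
have [f [f1 f2 fr fx]] : exists f : {morphism [set: subg_of <<[set:: t]>>%G] >->
    subg_of <<[set:: t]>>%G},
    [seq f y | y <- [:: r1; r2; r; x]] = [:: r2; r1; r ^+ m; x * r1 * r].
  apply: (presents_endo ps); split; [split; split | split].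
  - exact: s2.
  - exact: s1.
  - by rewrite -expgM mulnC expgM ro expg1n.
  - exact/com0/commute_sym.
  - exact/com0/commuteX.
  - exact/com0/commuteX.
  - rewrite -c12 -x2 [LHS]expgS expg1 [RHS]expgS expg1.
    have xr := xrj 1%N; rewrite expg1 in xr.
    have e : x * r1 * r = r1 * (r^-1 * x) by rewrite -cx1 -mulgA xr.
    have cxx : commute (x * x) r.
      rewrite -[x * x]/(x ^+ 2) x2; apply/commute_sym/commuteX.
      by apply: commuteM; apply: commute_sym.
    have e2 : x * (x * r1 * r) = r1 * (r * (x * x)).
      by rewrite -cxx -cx1 !mulgA -cx1.
    rewrite {1}e; have -> : r1 * (r^-1 * x) * (x * r1 * r) = r1 * (r^-1 * (x * (x * r1 * r))).
      by rewrite !mulgA.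
    rewrite e2 (mulgA r^-1) -(commuteV cr1) -(mulgA r1 r^-1) mulKg mulgA.
    by rewrite -[r1 * r1]/(r1 ^+ 2) s1 mul1g.
  - by apply/com0/commuteM => //; apply: commuteM => //; apply: commute_sym.
  - by apply/com0/commuteM => //; apply: commuteM.
  have e : x * r1 * r * r ^+ m = r ^- m * (x * r1 * r).
    have rm : r1 * r ^- m = r ^- m * r1 by apply: commuteV; apply: commuteX.
    have x1 := xrj 1%N; rewrite expg1 in x1.
    have -> : x * r1 * r * r ^+ m = r1 * (x * r ^+ m.+1).
      by rewrite -cx1 expgS !mulgA.
    have -> : x * r1 * r = r1 * (x * r) by rewrite -cx1 mulgA.
    by rewrite xrj x1 expgS invMg [RHS]mulgA -rm !mulgA.
  by rewrite e mulgK.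
by exists (FDG f); exists r1, r2, r, x.
Qed.

(** * Classification *)

Lemma double_mul_mod n k m : k = 0 \/ ~~ odd n /\ k = n %/ 2 ->
  one_mod_primes n m -> k = (m * k)%N %[mod n].
Proof.
case=> [->|[en kE]] mp; first by rewrite muln0.
have n2 : 2 %| n by rewrite dvdn2.
have [t ->] := one_modE (isT : 1 < 2) (mp 2 isT n2).
have -> : ((1 + 2 * t) * k = t * n + k)%N by rewrite -(divnK n2) -kE; lia.
by rewrite modnMDl.
Qed.

Lemma dvdn_double n k : k = 0 \/ ~~ odd n /\ k = n %/ 2 -> n %| k + k.
Proof.
case=> [->|[en ->]]; first by rewrite dvdn0.
by rewrite addnn -muln2 divnK ?dvdnn // dvdn2.
Qed.

Section SplitClassification.

Variables (X : fdg) (x : X).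
Local Notation f := (fdg_endo X).
Local Notation G := [set: X].
Hypotheses (fI : injective f) (gt2 : 2 < #|G|) (half : #|G| = #|cyc f x|.*2).

Let fM := @fdg_endoM X.
Let long : #|G| <= #|cyc f x|.*2. Proof. by rewrite half. Qed.

Lemma split_gen (A : {group X}) (s : seq X) : A != G :> {set X} ->
  cyc f x \subset x *: A -> A \subset <<[set:: s]>> -> x \in <<[set:: s]>> ->
  <<[set:: s]>> = G.
Proof.
move=> nA sOA sA sx; apply/eqP; rewrite eqEsubset subsetT; apply/subsetP=> y _.
have [Ay|nAy] := boolP (y \in A); first exact: (subsetP sA).
have Oy : y \in cyc f x by rewrite (two_cycC fM fI gt2 long nA sOA) inE.
have /lcosetP[a Aa ->] := subsetP sOA y Oy.
by rewrite groupM // (subsetP sA).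
Qed.

Theorem split_classify : split_off f x ->
  (exists n k m, [/\ dih_fdg n k m X, k = 0 \/ ~~ odd n /\ k = n %/ 2, m < n,
     one_mod_primes n m & 4 %| n -> m = 1 %[mod 4]]) \/
  (exists o k m, [/\ klein_fdg o k m X, odd o, k <= 1%N, m < o & one_mod_primes o m]).
Proof.
case=> A nA sOA; have [xA x2 fx2] := two_structure fM fI gt2 long nA sOA.
have cA := two_cardA fM fI gt2 long nA sOA.
have abA := two_abelian fM fI gt2 long nA sOA.
have [t4|t4] := eqVneq #|tor A 2| 4; [right | left].
  have [o [r1 [r2 [r [m [k [AE [cardA oo] [s1 s2 ro] [f1 f2 fr fx] [xk k1 mo mp]]]]]]]] :=
    two_klein fM fI gt2 long nA sOA t4.
  exists o, k, m; split=> //; exists r1, r2, r, x; split=> //.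
  have o0 : 0 < o by case: (o) oo.
  have Ag s : s \in [:: r1; r2; r] -> s \in A by move=> rs; rewrite AE mem_gen // inE.
  have A1 : r1 \in A by rewrite Ag // !inE eqxx.
  have A2 : r2 \in A by rewrite Ag // !inE eqxx orbT.
  have Ar : r \in A by rewrite Ag // !inE eqxx !orbT.
  have com c d : c \in A -> d \in A -> [~ c, d] = 1.
    by move=> Ac Ad; apply/eqP/commgP; apply: (centsP abA).
  have xc c : c \in A -> c ^+ 2 = 1 -> [~ c, x] = 1.
    move=> Ac c2; apply/eqP/commgP/commute_sym; apply: (mulIg x^-1).
    rewrite xA // mulgK; apply: (mulgI c); rewrite mulgV.
    exact: esym c2.
  apply: klein_presents; rewrite ?half //.
  - split; first by split; split=> //; apply: com.
    by split; rewrite ?xc ?xA.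
  - apply: (split_gen nA sOA); last by rewrite mem_gen // !inE eqxx !orbT.
    rewrite {1}AE; apply: genS; apply/subsetP=> c; rewrite !inE.
    by case/or3P=> ->; rewrite ?orbT.
  by rewrite -half -cA cardA.
have [m [k [AE fb xk k_or [ltm mp m4]]]] := two_cyclic fM fI gt2 long nA sOA t4.
exists #|A|, k, m; split=> //; set b := x^-1 * f x in AE fb xk *.
exists b, x; split=> //; last by rewrite mulKVg.
have Ab : b \in A by rewrite AE cycle_id.
apply: dih_presents; rewrite ?cardG_gt0 ?cA //.
  split; rewrite ?xA //.
  by rewrite [in #|_|]AE -orderE expg_order.
apply: (split_gen nA sOA); last by rewrite mem_gen // !inE eqxx orbT.
by rewrite AE cycle_subG mem_gen // !inE eqxx.
Qed.

(** The fixed point makes the kernel of [u |-> u^-1 f(u)] nontrivial, so its image is proper; by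
    telescoping the cycle stays in [x] times this image. *)
Lemma abelian_split : abelian G -> (exists2 y, f y = y & y != 1) -> split_off f x.
Proof.
move=> abG [y fy ny]; have com (u v : X) : u * v = v * u.
  by apply: (centsP abG); rewrite inE.
have phiM : {in G &, {morph (fun u => u^-1 * f u) : s t / s * t}}.
  move=> s t _ _ /=; rewrite fM invMg (com t^-1) -!mulgA; congr (_ * _).
  by rewrite mulgA (com t^-1) -mulgA.
pose phi := Morphism phiM; pose D := (phi @* G)%G.
exists D.
  apply/eqP=> DG; have := card_morphim phi G; rewrite setIid -[phi @* G]/(D : {set X}) DG.
  move=> iK; have := Lagrange (subsetT ('ker phi)); rewrite -iK => /eqP.
  rewrite -[X in _ == X]mul1n eqn_pmul2r ?cardG_gt0 // => /eqP/card1_trivg kE.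
  have : y \in 'ker phi by apply/kerP; rewrite ?inE //= fy mulVg.
  by rewrite kE inE (negPf ny).
have sD : stable f D.
  move=> _ /morphimP[u _ _ ->] /=; rewrite fM (endoV fM).
  by apply: (mem_morphim phi); rewrite ?inE.
apply/subsetP=> _ /cycP[i ->]; rewrite mem_lcoset; apply: (diff_iter_mem fM) => //.
by apply: (mem_morphim phi); rewrite ?inE.
Qed.

End SplitClassification.

Lemma dih_fdg_card2 (X : fdg) : injective (fdg_endo X) -> #|[set: X]| = 2 ->
  dih_fdg 1 0 0 X.
Proof.
move=> fI X2; have fM := @fdg_endoM X.
have /trivgPn[x _ nx] : [set: X]%G :!=: 1 by rewrite -cardG_gt1 X2.
have XE : [set: X] = [set 1; x].
  by apply/esym/eqP; rewrite eqEcard subsetT X2 cards2 eq_sym nx.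
have x2 : x ^+ 2 = 1 by rewrite -X2 expg_cardG ?inE.
exists 1, x; split; rewrite ?(endo1 fM) ?mulg1 //.
  apply: dih_presents => //.
    by split; rewrite ?expg1n ?x2 // mulg1 mulgV invg1.
  apply/eqP; rewrite eqEsubset subsetT XE /=; apply/subsetP=> y.
  by rewrite !inE => /orP[]/eqP->; rewrite ?group1 // mem_gen // !inE eqxx orbT.
have : fdg_endo X x \in [set 1; x] by rewrite -XE inE.
rewrite !inE => /orP[]/eqP // fx; case/eqP: nx; apply: fI.
by rewrite fx (endo1 fM).
Qed.

Lemma fdg_iso_full (X Y : fdg) (h : {morphism [set: X] >-> Y}) :
  isom [set: X] [set: Y] h ->
  [/\ {morph h : y z / y * z}, injective h & #|[set: X]| = #|[set: Y]|].
Proof.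
move=> isoh; have [/injmP hI hE] := isomP isoh; split.
- by move=> y z; rewrite morphM ?inE.
- by move=> y z; apply: hI; rewrite inE.
by rewrite (card_isog (isom_isog _ _ isoh)).
Qed.

Lemma fdg_iso_half (X Y : fdg) : fdg_iso X Y ->
  injective (fdg_endo Y) /\ (exists y, #|cyc (fdg_endo Y) y|.*2 = #|[set: Y]|) ->
  injective (fdg_endo X) /\ (exists x, #|cyc (fdg_endo X) x|.*2 = #|[set: X]|).
Proof.
case=> h isoh hf [fI [y yE]]; have [hM hI cXY] := fdg_iso_full isoh; split.
  by move=> u v e; apply/hI/fI; rewrite -!hf e.
have [_ hE] := isomP isoh.
have /morphimP[x _ _ xE] : y \in h @* [set: X] by rewrite hE inE.
have hi i : h (iter i (fdg_endo X) x) = iter i (fdg_endo Y) y.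
  by elim: i => //= i <-; rewrite hf.
exists x; rewrite cXY -yE; congr double.
rewrite -(card_imset (mem (cyc (fdg_endo X) x)) hI); apply: eq_card => z.
apply/imsetP/cycP=> [[_ /cycP[i ->] ->]|[i ->]]; first by exists i; rewrite hi.
by exists (iter i (fdg_endo X) x); rewrite ?mem_cyc ?hi.
Qed.

(* Both groups having the same presentation, the morphisms between them given by
   the universal property are inverse to each other. *)
Lemma presents_iso (rel : forall hT : finGroupType, seq hT -> Prop) (X Y : fdg)
    (s : seq X) (t : seq Y) (h : {morphism [set: X] >-> Y}) :
  presents rel s -> presents rel t -> [seq h y | y <- s] = t ->
  #|[set: X]| = #|[set: Y]| ->
  (forall y, y \in s -> h (fdg_endo X y) = fdg_endo Y (h y)) -> fdg_iso X Y.
Proof.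
move=> [gen_s _ _] [gen_t _ _] hst cXY hf; exists h.
  have hE : h @* [set: X] = [set: Y].
    apply/eqP; rewrite eqEsubset subsetT -gen_t gen_subG; apply/subsetP=> y.
    by rewrite inE -hst => /mapP[z _ ->]; rewrite mem_morphim ?inE.
  apply/isomP; split=> //; apply/injmP/imset_injP.
  by rewrite -morphimEdom hE cXY.
move=> x; pose K := [set u | h (fdg_endo X u) == fdg_endo Y (h u)].
have gK : group_set K.
  apply/group_setP; split=> [|u v]; first by rewrite inE !morph1.
  by rewrite !inE => /eqP hu /eqP hv; rewrite !morphM ?inE // hu hv.
have : x \in Group gK.
  have : x \in <<[set:: s]>> by rewrite gen_s inE.
  apply: subsetP; rewrite gen_subG; apply/subsetP=> y; rewrite inE => sy.
  by rewrite inE hf.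
by rewrite inE => /eqP.
Qed.

Lemma dih_fdg_iso n k m X Y : dih_param n k m -> dih_fdg n k m X -> dih_fdg n k m Y ->
  fdg_iso X Y.
Proof.
move=> [n0 k2 _ _ _] [r [x [ps fr fx]]] [r' [x' [ps' fr' fx']]].
have [_ _ univ] := ps; have [_ rel' _] := ps'; have [h hs] := univ _ _ rel'.
apply: (presents_iso ps ps' hs); first by rewrite (dih_card n0 k2 ps) (dih_card n0 k2 ps').
case: hs => hr hx y; rewrite !inE => /orP[]/eqP->.
  by rewrite fr morphX ?inE // hr fr'.
by rewrite fx morphM ?inE // hr hx fx'.
Qed.

Lemma klein_fdg_iso o k m X Y : klein_param o k m -> klein_fdg o k m X ->
  klein_fdg o k m Y -> fdg_iso X Y.
Proof.
move=> [oo k1 _] [r1 [r2 [r [x [ps [f1 f2 fr fx]]]]]].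
move=> [s1 [s2 [s [y [ps' [g1 g2 gs gy]]]]]].
have o0 : 0 < o by case: (o) oo.
have [_ _ univ] := ps; have [_ rel' _] := ps'; have [h hs] := univ _ _ rel'.
apply: (presents_iso ps ps' hs).
  by rewrite (klein_card o0 k1 ps) (klein_card o0 k1 ps').
case: hs => h1 h2 hr hx z; rewrite !inE => /or4P[]/eqP->.
- by rewrite f1 h2 h1 g1.
- by rewrite f2 h1 h2 g2.
- by rewrite fr morphX ?inE // hr gs.
by rewrite fx !morphM ?inE // h1 hr hx gy.
Qed.

(** The image of [r] has order [n]. Outside [<r'>] the orders divide 2 if [k = 0] and 4 in general,
    so it lies in [<r'>], where the second endomorphism is the power [m']. For [n = 4] and [k]
    nonzero the argument fails, elements outside also having order 4. *)
Lemma dih_fdg_noniso n k m m' X Y : 2 < n -> k = 0 \/ n != 4 ->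
  dih_param n k m -> dih_param n k m' -> m < n -> m' < n ->
  dih_fdg n k m X -> dih_fdg n k m' Y -> fdg_iso X Y -> m = m'.
Proof.
move=> n2 k4 pm pm' ltm ltm' [r [x [ps fr fx]]] [r' [x' [ps' fr' fx']]] [h isoh hf].
have [hM hI _] := fdg_iso_full isoh; have fM := @fdg_endoM Y.
have k2 : n %| k + k by case: pm.
have ow : #[h r] = n.
  rewrite -(dih_family_order pm ps); apply/eqP.
  rewrite eqn_dvd !order_dvdn -{1}(endoX hM) expg_order (endo1 hM) eqxx /=.
  by rewrite -(inj_eq hI) (endoX hM) expg_order (endo1 hM).
have [rn _ _] := dih_family_rel ps'.
have /cycleP[j wE] : h r \in <[r']>.
  apply: contraT => nw; have w2 := dih_family_outside pm' ps' nw.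
  have w4 : h r ^+ 4 == 1.
    rewrite (expgM _ 2 2) w2 -expgM muln2 -addnn.
    by have /dvdnP[q ->] := k2; rewrite mulnC expgM rn expg1n.
  case: k4 => [k0|n4].
    have : h r ^+ 2 == 1 by rewrite w2 k0.
    by rewrite -order_dvdn ow => /(dvdn_leq (isT : 0 < 2)); rewrite leqNgt n2.
  have : n %| 4 by rewrite -ow order_dvdn.
  move=> n_4; have := dvdn_leq (isT : 0 < 4) n_4.
  by move: n2 n4 n_4; case: (n) => [|[|[|[|[|]]]]].
have : h r ^+ m == h r ^+ m'.
  rewrite -(endoX hM r m) -fr hf {1}wE (endoX fM) fr' -expgM mulnC expgM -wE.
  exact: eqxx.
by rewrite eq_expg_mod_order ow !modn_small // => /eqP.
Qed.

(** The fourth power of the image of [r] lies in [<r'>], so [4 m] and [4 m'] agree modulo the odd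
    [o]. *)
Lemma klein_fdg_noniso o k m m' X Y : klein_param o k m -> klein_param o k m' ->
  m < o -> m' < o -> klein_fdg o k m X -> klein_fdg o k m' Y -> fdg_iso X Y -> m = m'.
Proof.
move=> pm pm' ltm ltm' [r1 [r2 [r [x [ps [f1 f2 fr fx]]]]]].
move=> [s1 [s2 [s [y [ps' [g1 g2 gs gy]]]]]] [h isoh hf].
have [hM hI _] := fdg_iso_full isoh; have fM := @fdg_endoM Y.
have oo : odd o by case: pm.
have ow : #[h r] = o.
  rewrite -(klein_family_order pm ps); apply/eqP.
  rewrite eqn_dvd !order_dvdn -{1}(endoX hM) expg_order (endo1 hM) eqxx /=.
  by rewrite -(inj_eq hI) (endoX hM) expg_order (endo1 hM).
have /cycleP[j wE] := klein_family_expg4 ps' (h r).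
have : h r ^+ (4 * m) == h r ^+ (4 * m').
  rewrite mulnC expgM -(endoX hM r m) -fr hf -(endoX fM) wE (endoX fM) gs -expgM mulnC.
  by rewrite expgM -wE -expgM.
rewrite eq_expg_mod_order ow.
wlog le : m m' {pm pm' fr gs} ltm ltm' / m <= m'.
  by move=> H; case: (leqP m m') => [|/ltnW] le e; [|apply/esym]; apply: H; rewrite // eq_sym.
rewrite eq_sym eqn_mod_dvd ?leq_mul2l // -mulnBr Gauss_dvdr; last first.
  by rewrite (@coprimeXr 2 _ 2) // coprimen2.
by rewrite -eqn_mod_dvd // !modn_small // => /eqP.
Qed.

(** * The group Z/2 x Z/4 *)

(** The group is the degenerate generalised dicyclic one with [o = 1]: there [r = 1], and
    [x^2 = r1 r2] determines [r2]. *)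
Lemma Z2xZ4_klein (hT : finGroupType) (v1 v2 : hT) :
  Z2xZ4_rel [:: v1; v2] <-> klein_rel 1 1 [:: v1; v1 * v2 ^+ 2; 1; v2].
Proof.
have R1 (y z : hT) : [~ y, z] = 1 <-> commute y z.
  by split=> [/eqP/commgP|/commgP/eqP].
split=> [[s1 s4 /R1 c]|[[[s1 s2 _] _] [_ /R1 c _ _]]]; last first.
  split; rewrite ?R1 //; move: s2; rewrite expgMn; last exact: commuteX.
  by rewrite s1 mul1g -expgM.
have c' : commute (v1 * v2 ^+ 2) v2.
  by apply/commute_sym/commuteM; [apply/commute_sym | apply: commuteX].
split; split; rewrite ?R1 ?expg1n ?expg1 ?invg1 ?mulg1 ?mulgV //.
- split=> //; rewrite expgMn; last exact: commuteX.
  by rewrite s1 mul1g -expgM.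
- by split; rewrite R1; [apply: commuteM => //; apply: commuteX | apply: commute1 | apply: commute1].
by rewrite mulgA -[v1 * v1]/(v1 ^+ 2) s1 mul1g.
Qed.

Lemma klein_rel_degenerate (hT : finGroupType) (r1 r2 r x : hT) :
  klein_rel 1 1 [:: r1; r2; r; x] -> r = 1 /\ r2 = r1 * x ^+ 2.
Proof.
case=> [[[s1 _ r1E] _] [x2 _ _ _]]; split; first by move: r1E; rewrite expg1.
by rewrite x2 expg1 mulgA -[r1 * r1]/(r1 ^+ 2) s1 mul1g.
Qed.

Lemma Z2xZ4_presents (gT : finGroupType) (v1 v2 : gT) :
  presents Z2xZ4_rel [:: v1; v2] <->
  presents (klein_rel 1 1) [:: v1; v1 * v2 ^+ 2; 1; v2].
Proof.
have gE : <<[set:: [:: v1; v1 * v2 ^+ 2; 1; v2]]>> = <<[set:: [:: v1; v2]]>>.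
  have g1 : v1 \in <<[set:: [:: v1; v2]]>> by rewrite mem_gen // !inE eqxx.
  have g2 : v2 \in <<[set:: [:: v1; v2]]>> by rewrite mem_gen // !inE eqxx orbT.
  apply/eqP; rewrite eqEsubset; apply/andP; split; rewrite gen_subG; apply/subsetP=> y.
    by rewrite !inE => /or4P[]/eqP->; rewrite ?group1 ?groupM ?groupX.
  by rewrite !inE => yv; rewrite mem_gen // !inE; case/orP: yv => ->; rewrite ?orbT.
split=> [[gen rel univ]|[gen rel univ]]; split; try exact/Z2xZ4_klein.
- by rewrite gE.
- move=> hT [|s1 [|s2 [|s [|y []]]]] //= rel_t.
  have [sE s2E] := klein_rel_degenerate rel_t; rewrite sE s2E in rel_t *.
  have [|h [h1 h2]] := univ hT [:: s1; y]; first exact/Z2xZ4_klein.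
  by exists h; rewrite morphM ?inE // morphX ?inE // morph1 h1 h2.
- by rewrite -gE.
move=> hT [|w1 [|w2 []]] // /Z2xZ4_klein/univ[h [h1 _ _ h2]].
by exists h; rewrite /= h1 h2.
Qed.

Lemma Z2xZ4_fdg_klein (X : fdg) : is_Z2xZ4_fdg X <-> klein_fdg 1 1 0 X.
Proof.
have fM := @fdg_endoM X.
split=> [[v1 [v2 [ps f1 f2]]]|[r1 [r2 [r [x [ps [f1 f2 fr fx]]]]]]].
  have [_ [s1 s4 /eqP/commgP c] _] := ps.
  exists v1, (v1 * v2 ^+ 2), 1, v2; split; first exact/Z2xZ4_presents.
  split; rewrite ?mulg1 ?(endo1 fM) //; last by rewrite f2 c.
  rewrite fM (endoX fM) f1 f2 expgMn // s1 mul1g -mulgA.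
  by rewrite -[v2 ^+ 2 * v2 ^+ 2]expgD s4 mulg1.
have [_ rel _] := ps; have [rE r2E] := klein_rel_degenerate rel.
rewrite rE r2E in ps f1 rel fx.
exists r1, x; split; first exact/Z2xZ4_presents.
  by rewrite f1.
have [_ [_ /eqP/commgP c _ _]] := rel.
by rewrite fx mulg1 c.
Qed.

Lemma orbit_half (gT : finGroupType) (a : gT -> gT) (S : {set gT}) y :
  (forall z, (a z \in S) = (z \in S)) -> #|S|.*2 <= #|[set: gT]| ->
  #|~: S|.*2 <= #|[set: gT]| -> #|cyc a y|.*2 <= #|[set: gT]|.
Proof.
move=> aS leS leC; have iS i : (iter i a y \in S) = (y \in S) by elim: i => //= i <-.
have [Sy|nSy] := boolP (y \in S).
  apply: leq_trans leS; rewrite leq_double; apply: subset_leq_card.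
  by apply/subsetP=> _ /cycP[i ->]; rewrite iS.
apply: leq_trans leC; rewrite leq_double; apply: subset_leq_card.
by apply/subsetP=> _ /cycP[i ->]; rewrite in_setC iS.
Qed.

(* The set of the elements of order at most 2 is invariant under automorphisms. *)
Lemma involutions_half (gT : finGroupType) (a : gT -> gT) (A : {group gT}) x y :
  {morph a : u v / u * v} -> injective a -> #|A|.*2 <= #|[set: gT]| ->
  A :|: x *: A = [set: gT] -> {in A, forall u, u ^+ 2 = 1} ->
  {in A, forall u, (x * u) ^+ 2 != 1} -> #|cyc a y|.*2 <= #|[set: gT]|.
Proof.
move=> aM aI leA AE A1 xA1; pose S := [set u : gT | u ^+ 2 == 1].
have AxA u : u \in A \/ exists2 v, v \in A & u = x * v.
  have : u \in A :|: x *: A by rewrite AE inE.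
  by case/setUP=> [|/lcosetP]; [left | right].
apply: (orbit_half (S := S)) => [z||].
- by rewrite !inE -(endoX aM) -{1}(endo1 aM) (inj_eq aI).
- apply: leq_trans leA; rewrite leq_double; apply/subset_leq_card/subsetP=> u.
  rewrite inE => u1; case: (AxA u) => // [[v Av uE]].
  by case/negP: (xA1 v Av); rewrite -uE.
apply: leq_trans leA; rewrite leq_double -(card_lcoset A x).
apply/subset_leq_card/subsetP=> u; rewrite !inE => u1.
case: (AxA u) => [/A1 u2|[v Av ->]]; first by rewrite u2 eqxx in u1.
by apply/lcosetP; exists v.
Qed.

Lemma Z2xZ4_maximal (X : fdg) : is_Z2xZ4_fdg X -> lambda_maximal X.
Proof.
have pm : klein_param 1 1 0 by split=> // p pr_p /(dvdn_leq (isT : 0 < 1)) /(leq_trans (prime_gt1 pr_p)).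
move=> /Z2xZ4_fdg_klein kX; have [fI [y half]] := klein_fdg_half pm kX.
apply: (maximal_half fI half) => a z Aa; case: kX => r1 [r2 [r [x [ps _]]]].
have [gen_s rel_s _] := ps; have [Nx Ax] := klein_rel_norm rel_s.
have [rel_r [x2 /eqP/commgP c1 /eqP/commgP c2 _]] := rel_s.
have [rE _] := klein_rel_degenerate rel_s.
have [_ _ n12 _] := klein_nondegenerate (isT : 0 < 1) (leqnn 1) ps.
have inA u : u \in klein_join r1 r2 r -> u ^+ 2 = 1 /\ commute x u.
  case/(klein_joinP rel_r)=> v [j [-> v2 _ [i [l vE]]]].
  rewrite rE expg1n mulg1 v2; split=> //.
  by rewrite vE; apply: commuteM; apply/commuteX/commute_sym.
apply: (involutions_half (A := klein_join r1 r2 r) (x := x)).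
- exact: aut_morph Aa.
- exact: perm_inj.
- rewrite (klein_card _ _ ps) // leq_double.
  exact: (klein_join_card (o := 1) isT rel_r).
- apply/eqP; rewrite eqEsubset subsetT -{1}gen_s.
  exact: (gen_index2_sub Nx Ax (@klein_gens_sub X r1 r2 r x)).
- by move=> u /inA[].
by move=> u /inA[u2 cu]; rewrite expgMn // u2 mulg1 x2 expg1.
Qed.

(** * The group (Z/2)^2 x Z/3 *)

Definition six_rel (hT : finGroupType) (s : seq hT) : Prop :=
  if s is [:: u; w; v] then Z22xZo_rel 3 u w v else False.

Lemma six_presents (gT : finGroupType) (s : seq gT) : six_rel s ->
  <<[set:: s]>> = [set: gT] -> #|[set: gT]| = 12 -> presents six_rel s.
Proof.
move=> rel_s gen_s card_s; apply: (presentsI (N := 12) (n := 3)) => //.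
- by move=> hT [|u [|w [|v []]]].
- move=> hT kT [|u [|w [|v []]]] // [|u' [|w' [|v' []]]] //; exact: Z22xZo_rel_pair.
move=> hT [|u [|w [|v []]]] // rel_t.
apply: leq_trans (klein_join_card (o := 3) isT rel_t).
apply/subset_leq_card; rewrite gen_subG; apply/subsetP=> y; rewrite inE.
exact: klein_join_mem.
Qed.

Definition six_fdg (X : fdg) : Prop :=
  #|[set: X]| = 12 /\ exists u w v : X, presents six_rel [:: u; w; v] /\
    [/\ fdg_endo X u = w, fdg_endo X w = u * w & fdg_endo X v = v ^+ 2].

Lemma six_fdg_iso X Y : six_fdg X -> six_fdg Y -> fdg_iso X Y.
Proof.
move=> [cX [u [w [v [ps [fu fw fv]]]]]] [cY [u' [w' [v' [ps' [fu' fw' fv']]]]]].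
have [_ _ univ] := ps; have [_ rel' _] := ps'; have [h hs] := univ _ _ rel'.
apply: (presents_iso ps ps' hs); first by rewrite cX cY.
case: hs => hu hw hv y; rewrite !inE => /or3P[]/eqP->.
- by rewrite fu hw hu fu'.
- by rewrite fw morphM ?inE // hu hw fw'.
by rewrite fv morphX ?inE // hv fv'.
Qed.

Lemma six_fdg_half X : six_fdg X -> injective (fdg_endo X) /\
  exists x, #|cyc (fdg_endo X) x|.*2 = #|[set: X]|.
Proof.
move=> [cX [u [w [v [[gen [[u2 w2 v3] [c1 c2 c3]] _] [fu fw fv]]]]]].
have fM := @fdg_endoM X; set f := fdg_endo X in fM fu fw fv *.
have v22 : (v ^+ 2) ^+ 2 = v by rewrite -expgM (expgD v 3 1) v3 mul1g.
have {}c1 : commute u w by apply/commgP/eqP.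
have wuw : w * (u * w) = u by rewrite c1 mulgA -[w * w]/(w ^+ 2) w2 mul1g.
have fI : injective f.
  apply: (full_image_inj fM gen) => y; rewrite !inE => /or3P[]/eqP->.
  - by apply/codomP; exists (u * w); rewrite fM fu fw wuw.
  - by apply/codomP; exists u.
  by apply/codomP; exists (v ^+ 2); rewrite (endoX fM) fv v22.
(* The component [u] has period 3 and [v] has period 2. *)
split=> //; exists (u * v); rewrite cX -[12]/(6.*2); congr double.
have i2 : iter 2 f (u * v) = u * w * v.
  by rewrite /= fM fu fv fM (endoX fM) fw fv v22.
have i3 : iter 3 f (u * v) = u * v ^+ 2.
  by rewrite iterS i2 !fM fu fw fv wuw.
have i6 : iter 6 f (u * v) = u * v.
  rewrite (iterD 3 3 f) i3 !iterS fM (endoX fM) fu fv v22 fM fw fv.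
  by rewrite fM (endoX fM) fM fu fw fv v22 wuw.
have nv : v != 1.
  apply/eqP=> v1; move: gen; rewrite v1 => gen.
  have : #|[set: X]| <= 4.
    rewrite -gen.
    have /(klein_join_card (isT : 0 < 1)) : Z22xZo_rel 1 u w 1.
      by split; split; rewrite ?expg1n //; [apply/eqP/commgP | apply/eqP/commgP; apply: commute1 | apply/eqP/commgP; apply: commute1].
    apply: leq_trans; apply/subset_leq_card; rewrite gen_subG; apply/subsetP=> y.
    by rewrite inE; apply: klein_join_mem.
  by rewrite cX.
have nw : w != 1.
  apply/eqP=> w1; have u1 : u = 1 by apply: fI; rewrite fu w1 (endo1 fM).
  have : #|[set: X]| <= 3.
    rewrite -gen; apply: (@leq_trans #|<[v]>|); last by rewrite dvdn_leq // order_dvdn v3.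
    apply/subset_leq_card; rewrite gen_subG; apply/subsetP=> y.
    by rewrite !inE u1 w1 => /or3P[]/eqP->; rewrite ?group1 ?cycle_id.
  by rewrite cX.
have d6 : #|cyc f (u * v)| %| 6 by rewrite -(iter_eq_dvdn fI) i6.
have d2 : ~~ (#|cyc f (u * v)| %| 2).
  rewrite -(iter_eq_dvdn fI) i2; apply: contra nw => /eqP/mulIg e.
  by apply/eqP/(mulgI u); rewrite e mulg1.
have d3 : ~~ (#|cyc f (u * v)| %| 3).
  rewrite -(iter_eq_dvdn fI) i3; apply: contra nv => /eqP/mulgI e.
  by apply/eqP/(mulgI v); rewrite mulg1; exact: e.
move: d6 d2 d3; case: #|_| => [|[|[|[|[|[|[|n]]]]]]] // /(dvdn_leq (isT : 0 < 6)).
Qed.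

(** A cycle longer than 6 avoids the stable subgroups of orders 4 and 3, whose union has
    [4 + 3 - 1 = 6] elements; only 6 remain. *)
Lemma abelian12_cyc (gT : finGroupType) (a : gT -> gT) y :
  {morph a : u v / u * v} -> injective a -> abelian [set: gT] ->
  #|[set: gT]| = 12 -> #|cyc a y|.*2 <= #|[set: gT]|.
Proof.
move=> aM aI abG c12; rewrite leqNgt; apply/negP=> lt; have long := ltnW lt.
have gt2 : 2 < #|[set: gT]| by rewrite c12.
have aO p : stable a 'O_p([set: gT]).
  by move=> z; rewrite !abelian_mem_pcore // /p_elt (order_endo aM aI).
have sub p : (12`_p)%N < 12 -> cyc a y \subset ~: 'O_p([set: gT]).
  move=> pn; apply/subsetP=> z Oz; rewrite inE; apply/negP=> pz.
  have := long_stable_full aM aI gt2 long (aO p) Oz pz.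
  by move/(congr1 (fun A : {set gT} => #|A|)); rewrite abelian_card_pcore // c12 => e; rewrite e ltnn in pn.
have c2 : (12`_2)%N = 4 by rewrite p_part.
have c3 : (12`_3)%N = 3 by rewrite p_part.
have O23 : 'O_2([set: gT]) :&: 'O_3([set: gT]) = 1.
  by apply: coprime_TIg; rewrite !abelian_card_pcore // c12 c2 c3.
have dis : cyc a y :&: ('O_2([set: gT]) :|: 'O_3([set: gT])) = set0.
  apply/setP=> z; rewrite in_setI in_setU in_set0; apply/negP=> /andP[Oz].
  have := subsetP (sub 2 _) z Oz; have := subsetP (sub 3 _) z Oz.
  by rewrite c2 c3 !in_setC => /(_ isT)/negPf-> /(_ isT)/negPf->.
have := subset_leq_card (subsetT (cyc a y :|: ('O_2([set: gT]) :|: 'O_3([set: gT])))).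
rewrite cardsU dis cards0 subn0 cardsU O23 !abelian_card_pcore // cards1 c12 c2 c3.
by move: lt; rewrite c12; clia.
Qed.

Lemma fpf_six (X : fdg) (x : X) : injective (fdg_endo X) -> abelian [set: X] ->
  2 < #|[set: X]| -> #|[set: X]| = #|cyc (fdg_endo X) x|.*2 ->
  (forall y, fdg_endo X y = y -> y = 1) -> six_fdg X.
Proof.
have fM := @fdg_endoM X; set f := fdg_endo X in fM *.
move=> fI abG gt2 half nofix; have long : #|[set: X]| <= #|cyc f x|.*2 by rewrite half.
have [c12 c3 c2] := fpf_card fM fI abG gt2 half nofix.
have com (y z : X) : y * z = z * y by apply: (centsP abG); rewrite inE.
set u := x.`_2 in c3; set v := x.`_2^' in c2.
have p2 : (12`_2)%N = 4 by rewrite p_part.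
have p2' : (12`_2^')%N = 3.
  by apply/eqP; rewrite -(eqn_pmul2l (isT : 0 < 4)) -{1}p2 partnC.
have u3 : iter 3 f u = u by apply/eqP; rewrite (iter_eq_dvdn fI) c3.
have v2 : iter 2 f v = v by apply/eqP; rewrite (iter_eq_dvdn fI) c2.
have stO : stable f 'O_2([set: X]).
  by move=> z; rewrite !abelian_mem_pcore // /p_elt (order_endo fM fI).
have O2 : 'O_2([set: X]) = 1 |: cyc f u :> {set X}.
  apply/esym/eqP; rewrite eqEcard abelian_card_pcore // c12 p2 cardsU1 c3.
  rewrite subUset sub1set group1 cyc_sub //=; last first.
    by rewrite abelian_mem_pcore // p_elt_constt.
  rewrite (_ : 1 \notin _ = true) //; apply/negP; rewrite (cyc_sym fI) (cyc1 fM) inE => /eqP u1.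
  by move: c3; rewrite u1 (cyc1 fM) cards1.
(* The 2-part consists of 1 and the cycle of [u], so [u^-1] is some [f^i u]. Then 3 divides [2 i],
   hence [i]. *)
have uu : u * u = 1.
  have : u^-1 \in 1 |: cyc f u by rewrite -O2 groupV abelian_mem_pcore // p_elt_constt.
  case/setU1P=> [|/cycP[i iE]]; first by move=> e; rewrite -{1}[u]invgK e invg1 mul1g -[u]invgK e invg1.
  have : iter (i + i) f u == u by rewrite iterD -iE (endoV (iter_endoM fM i)) -iE invgK.
  rewrite (iter_eq_dvdn fI) c3 addnn -mul2n Gauss_dvdr // -c3 -(iter_eq_dvdn fI) -iE.
  by move/eqP=> e; rewrite -{1}e mulVg.
(* The product over a cycle is a fixed point, hence trivial; the same argument gives [f v] below. *)
have fE : f (f u) = u * f u.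
  have : u * f u * f (f u) = 1.
    by apply: nofix; rewrite !fM; move: u3 => /= ->; rewrite -com mulgA.
  move=> /(congr1 (fun y => u * f u * y)); rewrite mulg1 => <-.
  by rewrite [RHS]mulgA [u * f u * (u * f u)](_ : _ = 1) ?mul1g // mulgA -(mulgA u) (com _ u) mulgA uu mul1g -fM uu (endo1 fM).
have v3 : v ^+ 3 = 1.
  have : v \in 'O_2^'([set: X]) by rewrite abelian_mem_pcore // p_elt_constt.
  by move/expg_cardG; rewrite abelian_card_pcore // c12 p2'.
have fv : f v = v ^+ 2.
  have : v * f v = 1 by apply: nofix; rewrite fM; move: v2 => /= ->; rewrite com.
  by move=> e; apply: (mulgI v); rewrite e -expgS v3.
have R (y z : X) : [~ y, z] = 1 by apply/eqP/commgP; apply: com.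
split=> //; exists u, (f u), v; split=> //; apply: six_presents => //.
  split; split=> //.
  by rewrite -(endoX fM) [u ^+ 2]uu (endo1 fM).
have sH : stable f <<[set:: [:: u; f u; v]]>>.
  have H1 : u \in <<[set:: [:: u; f u; v]]>> by rewrite mem_gen // !inE eqxx.
  have H2 : f u \in <<[set:: [:: u; f u; v]]>> by rewrite mem_gen // !inE eqxx orbT.
  have H3 : v \in <<[set:: [:: u; f u; v]]>> by rewrite mem_gen // !inE eqxx !orbT.
  apply: (gen_stable fM) => y; rewrite !inE => /or3P[]/eqP-> //.
    by rewrite fE groupM.
  by rewrite fv groupX.
apply: (long_stable_full fM fI gt2 long sH (cyc_refl x)).
by rewrite -(consttC 2 x) groupM // mem_gen // !inE eqxx ?orbT.
Qed.

(** * Explicit examples *)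

Section ConcreteExamples.

Import GRing.Theory.

Local Notation col2 n := 'cV['F_2]_n.

Lemma F2_cases (a : 'F_2) : (a = 0 \/ a = 1)%R.
Proof. by case: a => [[|[|]]] //= lt; [left | right]; apply: val_inj. Qed.

Lemma col2_sq n (c : col2 n) : c ^+ 2 = 1.
Proof.
apply/matrixP=> i j; rewrite !mxE.
by case: (F2_cases (c i j)) => ->; apply: val_inj.
Qed.

Lemma col2_gen n (H : {group col2 n}) :
  (forall i, (delta_mx i 0%R : col2 n) \in H) -> H = [set: col2 n] :> {set _}.
Proof.
move=> He; apply/eqP; rewrite eqEsubset subsetT; apply/subsetP=> c _.
rewrite (matrix_sum_delta c).
apply: (big_ind (fun v : col2 n => v \in H)) => [|u v Hu Hv|i _]; first exact: group1.
  exact: groupM.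
rewrite big_ord1; case: (F2_cases (c i 0%R)) => ->.
  by rewrite scale0r; apply: group1.
by rewrite scale1r.
Qed.

Lemma companion_col (R : nzRingType) n (p : {poly R}) (j : 'I_n.+1) :
  (companion n.+1 p *m delta_mx j 0 = if (j < n)%N then delta_mx (inord j.+1) 0
   else \col_i - p`_i :> 'cV_n.+1)%R.
Proof.
apply/matrixP=> i k; rewrite -colE !mxE /= (ord1 k).
case: ltnP => [lt|le]; rewrite mxE /= ?eqxx ?andbT.
  by rewrite (ltn_eqF lt) -val_eqE /= inordK.
by rewrite (_ : (j == n :> nat) = true) // eqn_leq le -ltnS ltn_ord.
Qed.

Local Notation e n i := (delta_mx (inord i) 0%R : col2 n.+1).

Lemma e_gen n (H : {group col2 n.+1}) :
  (forall i, i <= n -> e n i \in H) -> H = [set: col2 n.+1] :> {set _}.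
Proof. by move=> He; apply: col2_gen => i; rewrite -(inord_val i) He // -ltnS. Qed.

Lemma companion_e n (p : {poly 'F_2}) i : i < n ->
  (companion n.+1 p *m e n i)%R = e n i.+1.
Proof. by move=> lt; rewrite companion_col inordK ?lt // ltnW. Qed.

(** The degenerate dihedral case [n = 2]: the sum of the two basis vectors is fixed and serves as
    [r]. *)
Lemma fdg4_dih : dih_fdg 2 0 1 fdg4.
Proof.
have fe : fdg_endo fdg4 (e 1 0) = e 1 1 by apply: companion_e.
have fl : fdg_endo fdg4 (e 1 1) = e 1 0.
  rewrite /= companion_col inordK //=; apply/matrixP=> i j; rewrite !mxE (ord1 j) sqrrB1.
  rewrite !coefE -val_eqE /= inordK //.
  by case: i => [[|[|]]] //= lt; apply: val_inj.
have com (y z : fdg4) : y * z = z * y by apply: addrC.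
have sq (y : fdg4) : y * y = 1 by apply: col2_sq.
have sq2 (y : fdg4) : y ^+ 2 = 1 := sq y.
exists (e 1 0 * e 1 1), (e 1 0); split.
- apply: dih_presents => //.
  + split; rewrite ?sq2 ?expg1n //.
    rewrite com mulKg; apply/(mulgI (e 1 0 * e 1 1)); rewrite mulgV; exact: sq.
  + apply: (e_gen (H := <<_>>%G)) => i.
    have g0 : e 1 0 \in <<[set:: [:: e 1 0 * e 1 1; e 1 0]]>>.
      by rewrite mem_gen // !inE eqxx orbT.
    have g1 : e 1 1 \in <<[set:: [:: e 1 0 * e 1 1; e 1 0]]>>.
      by rewrite -(groupMl _ g0) mem_gen // !inE eqxx.
    by case: i => [|[|]].
  by rewrite cardsT card_mx card_Fp.
- by rewrite (fdg_endoM (X := fdg4)) fe fl com expg1.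
by rewrite fe mulgA sq mul1g.
Qed.

(** The degenerate generalised dihedral case [o = 1], with [r1] and [r2] the sums of consecutive
    basis vectors. *)
Lemma fdg5_klein : klein_fdg 1 0 0 fdg5.
Proof.
have fM := fdg_endoM (X := fdg5).
have f0 : fdg_endo fdg5 (e 2 0) = e 2 1 by apply: companion_e.
have f1 : fdg_endo fdg5 (e 2 1) = e 2 2 by apply: companion_e.
have com (y z : fdg5) : y * z = z * y by apply: addrC.
have sq (y : fdg5) : y * y = 1 by apply: col2_sq.
have fl : fdg_endo fdg5 (e 2 2) = e 2 0 * e 2 1 * e 2 2.
  rewrite /= companion_col inordK //=; apply/matrixP=> i j; rewrite !mxE (ord1 j).
  rewrite exprS sqrrB1 mulrBl mul1r !mulrDr !mulrN mulr1 !coefE -!val_eqE /= !inordK //.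
  by case: i => [[|[|[|]]]] //= lt; apply: val_inj.
have R (y z : fdg5) : [~ y, z] = 1 by apply/eqP/commgP; apply: com.
exists (e 2 0 * e 2 1), (e 2 1 * e 2 2), 1, (e 2 0); split.
  apply: klein_presents => //.
  + split; first by split; split; rewrite ?R ?expg1n //; apply: sq.
    by split; rewrite ?R ?expg0 //; [apply: sq | rewrite mulg1 mulgV invg1].
  + apply: (e_gen (H := <<_>>%G)) => i.
    set s := [:: _; _; _; _]; have gs y : y \in s -> y \in <<[set:: s]>>.
      by move=> sy; rewrite mem_gen // inE.
    have g0 : e 2 0 \in <<[set:: s]>> by rewrite gs // !inE eqxx !orbT.
    have g1 : e 2 1 \in <<[set:: s]>>.
      by rewrite -(groupMl _ g0) gs // !inE eqxx.
    have g2 : e 2 2 \in <<[set:: s]>>.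
      by rewrite -(groupMl _ g1) gs // !inE eqxx orbT.
    by case: i => [|[|[|]]].
  by rewrite cardsT card_mx card_Fp.
rewrite !fM f0 f1 fl (endo1 fM); split=> //.
  rewrite com -!mulgA; congr (_ * _).
  by rewrite -[RHS]mulg1; congr (_ * _); apply: sq.
by rewrite mulg1 mulgA sq mul1g.
Qed.

(** The degenerate dicyclic case [n = 2], with [r = 2] and [x = 1]. *)
Lemma fdg2_dih : dih_fdg 2 1 1 fdg2.
Proof.
exists (2%:R%R : 'Z_4), (1%R : 'Z_4); split; try exact: val_inj.
apply: dih_presents => //.
- by split; apply: val_inj.
- apply/eqP; rewrite eqEsubset subsetT /=; apply/subsetP=> y _.
  have -> : y = (1%R : 'Z_4) ^+ val y.
    by rewrite FinRing.zmodXgE natr_Zp.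
  by rewrite groupX // mem_gen // !inE eqxx orbT.
by rewrite cardsT card_ord.
Qed.

Lemma companion_fdg6 :
  (companion 2 ('X^2 + 'X + 1 : {poly 'F_2}) *m e 1 1 = e 1 0 + e 1 1)%R.
Proof.
rewrite /= companion_col inordK //=; apply/matrixP=> i j; rewrite !mxE (ord1 j).
rewrite !coefE -!val_eqE /= !inordK //.
by case: i => [[|[|]]] //= lt; apply: val_inj.
Qed.

Lemma fdg6_six : six_fdg fdg6.
Proof.
have c12 : #|[set: fdg6]| = 12.
  by rewrite cardsT card_prod card_mx card_Fp // card_ord.
split=> //.
have fM := fdg_endoM (X := fdg6).
have f0 : (companion 2 ('X^2 + 'X + 1 : {poly 'F_2}) *m e 1 0)%R = e 1 1.
  exact: companion_e.
have fl := companion_fdg6.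
have com (y z : fdg6) : y * z = z * y by congr (_, _); apply: addrC.
have sq (c : col2 2) : ((c, 0%R) : fdg6) ^+ 2 = 1.
  by rewrite [LHS]pair_expg; congr (_, _); [apply: col2_sq | apply: val_inj].
have R (y z : fdg6) : [~ y, z] = 1 by apply/eqP/commgP; apply: com.
pose s := [:: (e 1 0, 0%R); (e 1 1, 0%R); (0%R, 1%R)] : seq fdg6.
exists (e 1 0, 0%R), (e 1 1, 0%R), (0%R, 1%R); split.
  apply: six_presents => //.
    split; split; rewrite ?R ?sq //.
    by rewrite [LHS]pair_expg; congr (_, _); [exact: expg1n | apply: val_inj].
  rewrite -[LHS]/<<[set:: s]>>.
  have gs y : y \in s -> y \in <<[set:: s]>> by move=> sy; rewrite mem_gen // inE.
  have gG : group_set [set c : col2 2 | ((c, 0%R) : fdg6) \in <<[set:: s]>>].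
    apply/group_setP; split=> [|c d]; first by rewrite inE group1.
    rewrite !inE => gc gd; rewrite [X in X \in _](_ : _ = ((c, 0%R) : fdg6) * (d, 0%R)).
      exact: groupM.
    by congr (_, _); exact: esym (addr0 _).
  have gE : Group gG = [set: col2 2] :> {set _}.
    by apply: e_gen => [[|[|]]] // _; rewrite inE gs // !inE eqxx ?orbT.
  apply/eqP; rewrite eqEsubset subsetT /=; apply/subsetP=> [[c z]] _.
  have -> : ((c, z) : fdg6) = ((c, 0%R) : fdg6) * ((0%R, 1%R) : fdg6) ^+ val z.
    rewrite [X in _ * X]pair_expg; congr (_, _).
      by rewrite !FinRing.zmodXgE mul0rn [RHS]addr0.
    by rewrite !FinRing.zmodXgE natr_Zp [RHS]add0r.
  apply: groupM; last by rewrite groupX // gs // !inE eqxx !orbT.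
  have : c \in Group gG by rewrite gE inE.
  by rewrite in_set.
split; rewrite /=.
- by rewrite f0 mulr0.
- by rewrite fl mulr0; congr (_, _); exact: esym (addr0 _).
rewrite mulmx0 [RHS]pair_expg; congr (_, _); first by rewrite FinRing.zmodXgE mul0rn.
exact: val_inj.
Qed.

Lemma e_neq n i j : i <= n -> j <= n -> i != j -> e n i != e n j.
Proof.
move=> le_i le_j; apply: contraNneq => /matrixP/(_ (inord i) 0%R).
by rewrite !mxE !eqxx -!val_eqE /= !inordK // andbT; case: (i =P j).
Qed.

Lemma not_maximal (X : fdg) x (g : X -> X) y : injective (fdg_endo X) ->
  #|cyc (fdg_endo X) x|.*2 = #|[set: X]| -> {morph g : u v / u * v} -> injective g ->
  #|[set: X]| < #|cyc g y|.*2 -> ~ lambda_maximal X.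
Proof.
move=> fI half gM gI lt; have [_ lX] := lambda_half_intro fI half.
rewrite /lambda_maximal lX => e; have := lambda_le_group gM gI.
rewrite -e Order.TotalTheory.leNgt => /negP; apply.
rewrite /lambda Num.Theory.ltr_pdivlMr ?Num.Theory.ltr0n ?card_gT_gt0 //.
rewrite div1r Num.Theory.ltr_pdivrMl // -natrM Num.Theory.ltr_nat mul2n -cardsT.
by apply: leq_trans lt _; rewrite leq_double card_cyc leq_bigmax.
Qed.

Lemma fdg4_not_maximal : ~ lambda_maximal fdg4.
Proof.
have pm : dih_param 2 0 1 by split.
have [fI [x half]] := dih_fdg_half pm fdg4_dih.
(* This polynomial is primitive: its companion matrix permutes the three nonzero vectors
   cyclically. *)
pose g := mulmx (companion 2 ('X^2 + 'X + 1 : {poly 'F_2})%R) : fdg4 -> fdg4.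
have gM : {morph g : u v / u * v} by move=> u v; apply: mulmxDr.
have g0 : g (e 1 0) = e 1 1 by apply: companion_e.
have g1 : g (e 1 1) = e 1 0 * e 1 1 by exact: companion_fdg6.
have com (y z : fdg4) : y * z = z * y by apply: addrC.
have sq (y : fdg4) : y * y = 1 by apply: col2_sq.
have g01 : g (e 1 0 * e 1 1) = e 1 0 by rewrite gM g0 g1 com -mulgA sq mulg1.
have gI : injective g.
  apply: (full_image_inj gM (s := [:: e 1 0; e 1 1])).
    apply: (e_gen (H := <<_>>%G)) => [[|[|]]] // _; rewrite mem_gen // !inE eqxx ?orbT //.
  move=> y; rewrite !inE => /orP[]/eqP->; apply/codomP.
    by exists (e 1 0 * e 1 1).
  by exists (e 1 0).
apply: (not_maximal (g := g) (y := e 1 0) fI half gM gI).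
have : #|cyc g (e 1 0)| %| 3 by rewrite -(iter_eq_dvdn gI) /= g0 g1 g01.
have : ~~ (#|cyc g (e 1 0)| %| 1).
  by rewrite -(iter_eq_dvdn gI) /= g0 e_neq.
have -> : #|[set: fdg4]| = 4 by rewrite cardsT card_mx card_Fp.
by case: #|_| => [|[|[|[|n]]]] // _ /(dvdn_leq (isT : 0 < 3)).
Qed.

Lemma fdg5_not_maximal : ~ lambda_maximal fdg5.
Proof.
have pm : klein_param 1 0 0.
  by split=> // p pr_p /(dvdn_leq (isT : 0 < 1)) /(leq_trans (prime_gt1 pr_p)).
have [fI [x half]] := klein_fdg_half pm fdg5_klein.
(* A primitive polynomial, giving a cycle through all seven nonzero vectors. *)
pose p := ('X^3 + 'X + 1 : {poly 'F_2})%R.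
pose g := mulmx (companion 3 p) : fdg5 -> fdg5.
have gM : {morph g : u v / u * v} by move=> u v; apply: mulmxDr.
have com (y z : fdg5) : y * z = z * y by apply: addrC.
have sq (y : fdg5) : y * y = 1 by apply: col2_sq.
have g0 : g (e 2 0) = e 2 1 by apply: companion_e.
have g1 : g (e 2 1) = e 2 2 by apply: companion_e.
have g2 : g (e 2 2) = e 2 0 * e 2 1.
  rewrite /g companion_col inordK //=; apply/matrixP=> i j; rewrite !mxE (ord1 j).
  rewrite /p !coefE -!val_eqE /= !inordK //.
  by case: i => [[|[|[|]]]] //= lt; apply: val_inj.
have g02 : g (e 2 0 * e 2 2) = e 2 0 by rewrite gM g0 g2 com -mulgA sq mulg1.
have gI : injective g.
  apply: (full_image_inj gM (s := [:: e 2 0; e 2 1; e 2 2])).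
    apply: (e_gen (H := <<_>>%G)) => [[|[|[|]]]] // _; rewrite mem_gen // !inE eqxx ?orbT //.
  move=> y; rewrite !inE => /or3P[]/eqP->; apply/codomP.
  - by exists (e 2 0 * e 2 2).
  - by exists (e 2 0).
  by exists (e 2 1).
apply: (not_maximal (g := g) (y := e 2 0) fI half gM gI).
have : #|cyc g (e 2 0)| %| 7.
  have g012 : g (e 2 2 * (e 2 0 * e 2 1)) = e 2 0 * e 2 2.
    by rewrite !gM g0 g1 g2 -mulgA (mulgA (e 2 1)) sq mul1g.
  rewrite -(iter_eq_dvdn gI) !iterS g0 g1 g2.
  have -> : g (e 2 0 * e 2 1) = e 2 1 * e 2 2 by rewrite gM g0 g1.
  have -> : g (e 2 1 * e 2 2) = e 2 2 * (e 2 0 * e 2 1) by rewrite gM g1 g2.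
  by rewrite g012 g02.
have : ~~ (#|cyc g (e 2 0)| %| 1).
  by rewrite -(iter_eq_dvdn gI) /= g0 e_neq.
have -> : #|[set: fdg5]| = 8 by rewrite cardsT card_mx card_Fp.
by case: #|_| => [|[|[|[|[|[|[|[|n]]]]]]]] // _ /(dvdn_leq (isT : 0 < 7)).
Qed.

End ConcreteExamples.

(** * The complete list *)

Lemma one_mod_primes1 m : one_mod_primes 1 m.
Proof. by move=> p pr_p; rewrite dvdn1 => /eqP p1; rewrite p1 in pr_p. Qed.

Lemma dih_param_family n k m : 0 < n -> k = 0 \/ ~~ odd n /\ k = n %/ 2 ->
  one_mod_primes n m -> (4 %| n -> m = 1 %[mod 4]) -> dih_param n k m.
Proof.
move=> n0 kP mp m4; split=> //; first exact: dvdn_double.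
exact: double_mul_mod.
Qed.

Lemma dihedral_dih_param n m : dihedral_param n m -> dih_param n 0 m.
Proof. by case=> n3 _ mp m4; apply: dih_param_family => //; [apply: ltnW; apply: ltnW | left]. Qed.

Lemma dicyclic_dih_param n m : dicyclic_param n m -> dih_param n (n %/ 2) m.
Proof.
case=> [[en n4] _ mp m4]; apply: dih_param_family => //; last by right.
by apply: leq_trans n4.
Qed.

Lemma odd_klein_param o k m : k <= 1%N -> odd_param o m -> klein_param o k m.
Proof. by move=> k1 [[oo _] _ mp]. Qed.

Lemma dih_param_Z2 : dih_param 1 0 0.
Proof. by apply: dih_param_family => //; [left | apply: one_mod_primes1]. Qed.

Lemma dih_param_deg2 k : k <= 1%N -> dih_param 2 k 1.
Proof. by case: k => [|[|]] // _; split. Qed.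

Lemma klein_param_deg1 k : k <= 1%N -> klein_param 1 k 0.
Proof. by split=> //; apply: one_mod_primes1. Qed.

Lemma fdg1_dih : dih_fdg 1 0 0 fdg1.
Proof. by apply: dih_fdg_card2; rewrite ?cardsT ?card_ord. Qed.

Definition in_list (X : fdg) : Prop :=
  fdg_iso X fdg1 \/ fdg_iso X fdg2 \/ is_Z2xZ4_fdg X \/
  fdg_iso X fdg4 \/ fdg_iso X fdg5 \/ fdg_iso X fdg6 \/
  (exists n m : nat, dihedral_param n m /\ is_dihedral_fdg n m X) \/
  (exists n m : nat, dicyclic_param n m /\ is_dicyclic_fdg n m X) \/
  (exists o m : nat, odd_param o m /\ is_gen_dihedral_fdg o m X) \/
  (exists o m : nat, odd_param o m /\ is_gen_dicyclic_fdg o m X).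

Lemma in_list_dih n k m X : dih_fdg n k m X -> k = 0 \/ ~~ odd n /\ k = n %/ 2 ->
  m < n -> one_mod_primes n m -> (4 %| n -> m = 1 %[mod 4]) -> in_list X.
Proof.
move=> dX kP ltm mp m4.
have [n3|] := leqP 3 n.
  case: kP dX => [-> dX|[en ->] dX]; do 6 right; first by left; exists n, m.
  right; left; exists n, m; split=> //; split=> //; split=> //.
  by case: (n) n3 en => [|[|[|[]]]].
(* Degenerate cases: [n = 1] is the group of order 2; [n = 2] is the Klein four-group or the cyclic
   group of order 4, according to [k]. *)
case: n ltm dX kP mp m4 => [|[|[|n]]] // ltm dX kP mp _ _.
  left; case: m ltm dX {mp} => // _ dX; case: kP dX => [-> dX|[]] //.
  exact: (dih_fdg_iso dih_param_Z2 dX fdg1_dih).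
case: m ltm mp dX => [|[|]] // _ mp dX; first by have := mp 2 isT isT.
case: kP dX => [-> dX|[_ ->] dX].
  by do 3 right; left; apply: (dih_fdg_iso _ dX fdg4_dih); apply: dih_param_deg2.
by right; left; apply: (dih_fdg_iso _ dX fdg2_dih); apply: dih_param_deg2.
Qed.

Lemma in_list_klein o k m X : klein_fdg o k m X -> odd o -> k <= 1%N -> m < o ->
  one_mod_primes o m -> in_list X.
Proof.
move=> dX oo k1 ltm mp; have [o3|] := leqP 3 o.
  do 8 right; case: k k1 dX => [|[|]] // _ dX; [left | right]; by exists o, m.
case: o ltm dX oo mp => [|[|[|]]] // ltm dX _ _ _; case: m ltm dX => // _ dX.
case: k k1 dX => [|[|]] // _ dX.
  do 4 right; left; apply: (klein_fdg_iso _ dX fdg5_klein).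
  exact: klein_param_deg1.
by do 2 right; left; apply/Z2xZ4_fdg_klein.
Qed.

Theorem half_in_list (X : fdg) x : injective (fdg_endo X) ->
  #|cyc (fdg_endo X) x|.*2 = #|[set: X]| -> in_list X.
Proof.
move=> fI /esym half; have [gt2|] := ltnP 2 #|[set: X]|; last first.
  move: (cardG_gt0 [set: X]) half; rewrite leq_eqVlt => G0 half G2.
  have c2 : #|[set: X]| = 2.
    by move: G0 half G2; clia.
  by left; apply: (dih_fdg_iso dih_param_Z2 _ fdg1_dih); apply: dih_fdg_card2.
have fM := @fdg_endoM X.
have long : #|[set: X]| <= #|cyc (fdg_endo X) x|.*2 by rewrite half.
have classify : split_off (fdg_endo X) x -> in_list X.
  move/(split_classify fI gt2 half) => [[n [k [m [dX kP ltm mp m4]]]]|].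
    exact: in_list_dih dX kP ltm mp m4.
  by case=> o [k [m [dX oo k1 ltm mp]]]; apply: in_list_klein dX oo k1 ltm mp.
have [abG|nab] := boolP (abelian [set: X]); last first.
  exact/classify/split_nonabelian.
have [/existsP[y /andP[/eqP fy ny]]|nofix] :=
    boolP [exists y, (fdg_endo X y == y) && (y != 1)].
  by apply: classify; apply: abelian_split => //; exists y.
do 5 right; left; apply: six_fdg_iso fdg6_six; apply: (fpf_six fI abG gt2 half) => y fy.
by apply/eqP; apply: contraNT nofix => ny; apply/existsP; exists y; rewrite fy eqxx.
Qed.

Theorem in_list_half (X : fdg) : in_list X ->
  injective (fdg_endo X) /\ exists x, #|cyc (fdg_endo X) x|.*2 = #|[set: X]|.
Proof.
case=> [h|[h|[h|[h|[h|[h|[[n [m [p h]]]|[[n [m [p h]]]|[[o [m [p h]]]|[o [m [p h]]]]]]]]]]]].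
- exact/(fdg_iso_half h)/(dih_fdg_half dih_param_Z2 fdg1_dih).
- exact/(fdg_iso_half h)/(dih_fdg_half (dih_param_deg2 (leqnn 1)) fdg2_dih).
- exact/(klein_fdg_half (klein_param_deg1 (leqnn 1)))/Z2xZ4_fdg_klein.
- exact/(fdg_iso_half h)/(dih_fdg_half (dih_param_deg2 (leq0n 1)) fdg4_dih).
- exact/(fdg_iso_half h)/(klein_fdg_half (klein_param_deg1 (leq0n 1)) fdg5_klein).
- exact/(fdg_iso_half h)/(six_fdg_half fdg6_six).
- exact: dih_fdg_half (dihedral_dih_param p) h.
- exact: dih_fdg_half (dicyclic_dih_param p) h.
- exact: klein_fdg_half (odd_klein_param (leq0n 1) p) h.
exact: klein_fdg_half (odd_klein_param (leqnn 1) p) h.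
Qed.

Lemma fdg1_maximal : lambda_maximal fdg1.
Proof.
have [fI [x half]] := dih_fdg_half dih_param_Z2 fdg1_dih.
apply: (maximal_half fI half) => a y Aa.
apply: (orbit_half (S := [set 1])) => [z||].
- by rewrite !in_set1 -{1}(endo1 (aut_morph Aa)) (inj_eq perm_inj).
- by rewrite cards1 cardsT card_ord.
by rewrite -(leq_add2l #|[set 1 : fdg1]|.*2) -doubleD cardsC cards1 cardsT card_ord.
Qed.

Lemma fdg2_maximal : lambda_maximal fdg2.
Proof.
have pm := dih_param_deg2 (leqnn 1); have [fI [y half]] := dih_fdg_half pm fdg2_dih.
apply: (maximal_half fI half) => a z Aa; have [r [x [ps _ _]]] := fdg2_dih.
have or := dih_family_order pm ps; have [r2 x2 c] := dih_family_rel ps.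
have A1 u : u \in <[r]> -> u ^+ 2 = 1 by move/expg_cardG; rewrite -orderE or.
have com (u v : fdg2) : commute u v by apply: GRing.addrC.
apply: (involutions_half (A := <[r]>%G) (x := x)) => //.
- exact: aut_morph Aa.
- exact: perm_inj.
- by rewrite -orderE or cardsT card_ord.
- apply/eqP; rewrite eqEsubset subsetT; have [<- _ _] := ps.
  apply: (gen_index2_sub (A := <[r]>%G)).
  + by rewrite inE; apply/subsetP=> _ /imsetP[u ru ->]; rewrite conjgE com mulgK.
  + by rewrite -[x * x]/(x ^+ 2) x2 expg1 cycle_id.
  by move=> u; rewrite !inE => /orP[]/eqP->; rewrite ?eqxx ?cycle_id ?orbT.
move=> u /A1 u2; rewrite expgMn // u2 mulg1 x2 expg1 -order_eq1 or //.
Qed.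

Lemma fdg6_maximal : lambda_maximal fdg6.
Proof.
have [fI [y half]] := six_fdg_half fdg6_six; have [c12 _] := fdg6_six.
apply: (maximal_half fI half) => a z Aa; apply: abelian12_cyc => //.
- exact: aut_morph Aa.
- exact: perm_inj.
apply/centsP=> u _ v _; congr (_, _); exact: GRing.addrC.
Qed.

Lemma dih_fdg_maximal n k m X : 2 < n -> dih_param n k m -> dih_fdg n k m X ->
  lambda_maximal X.
Proof.
move=> n2 pm dX; have [fI [y half]] := dih_fdg_half pm dX.
apply: (maximal_nonabelian fI half); have [r [x [ps _ _]]] := dX.
exact: dih_family_nonabelian pm ps n2.
Qed.

Lemma klein_fdg_maximal o k m X : 2 < o -> klein_param o k m -> klein_fdg o k m X ->
  lambda_maximal X.
Proof.
move=> o2 pm dX; have [fI [y half]] := klein_fdg_half pm dX.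
apply: (maximal_nonabelian fI half); have [r1 [r2 [r [x [ps _]]]]] := dX.
exact: klein_family_nonabelian pm ps o2.
Qed.

Lemma dihedral_family : family_maximal_noniso dihedral_param is_dihedral_fdg.
Proof.
split=> [n m p|n m X p h|n m m' X Y p p' nm h h' iXY].
- exact: dih_exists (dihedral_dih_param p).
- by apply: dih_fdg_maximal (dihedral_dih_param p) h; case: p.
have [n3 ltm _ _] := p; have [_ ltm' _ _] := p'; apply: nm.
exact: (dih_fdg_noniso n3 (or_introl erefl) (dihedral_dih_param p)
          (dihedral_dih_param p') ltm ltm' h h' iXY).
Qed.

Lemma dicyclic_family : family_maximal_noniso dicyclic_param is_dicyclic_fdg.
Proof.
split=> [n m p|n m X p h|n m m' X Y p p' nm h h' iXY].
- exact: dih_exists (dicyclic_dih_param p).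
- by apply: dih_fdg_maximal (dicyclic_dih_param p) h; case: p => [[_ /ltnW]].
have [[_ n4] ltm _ m4] := p; have [_ ltm' _ m4'] := p'; apply: nm.
(* For the quaternion group, not covered by [dih_fdg_noniso], [m = 1] is the only parameter. *)
have [nE|n4'] := eqVneq n 4.
  rewrite nE in ltm ltm' m4 m4'; have := m4' isT; have := m4 isT.
  by rewrite !modn_small // => -> ->.
exact: (dih_fdg_noniso (ltnW n4) (or_intror n4') (dicyclic_dih_param p)
          (dicyclic_dih_param p') ltm ltm' h h' iXY).
Qed.

Lemma klein_family k (k1 : k <= 1%N) : family_maximal_noniso odd_param
  (fun o => klein_fdg o k).
Proof.
split=> [o m p|o m X p h|o m m' X Y p p' nm h h' iXY].
- exact: klein_exists (odd_klein_param k1 p).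
- by apply: klein_fdg_maximal (odd_klein_param k1 p) h; case: p => [[]].
have [_ ltm _] := p; have [_ ltm' _] := p'; apply: nm.
exact: (klein_fdg_noniso (odd_klein_param k1 p) (odd_klein_param k1 p') ltm ltm' h h' iXY).
Qed.

Theorem theorem1p1p9 :
  (forall X : fdg,
     (periodic X /\ fdg_lambda X = (1 / 2)%R) <->
     (fdg_iso X fdg1 \/
      fdg_iso X fdg2 \/
      is_Z2xZ4_fdg X \/
      fdg_iso X fdg4 \/
      fdg_iso X fdg5 \/
      fdg_iso X fdg6 \/
      (exists n m : nat, dihedral_param n m /\ is_dihedral_fdg n m X) \/
      (exists n m : nat, dicyclic_param n m /\ is_dicyclic_fdg n m X) \/
      (exists o m : nat, odd_param o m /\ is_gen_dihedral_fdg o m X) \/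
      (exists o m : nat, odd_param o m /\ is_gen_dicyclic_fdg o m X))) /\
  lambda_maximal fdg1 /\
  lambda_maximal fdg2 /\
  ((exists X : fdg, is_Z2xZ4_fdg X) /\
   (forall X : fdg, is_Z2xZ4_fdg X -> lambda_maximal X)) /\
  ~ lambda_maximal fdg4 /\
  ~ lambda_maximal fdg5 /\
  lambda_maximal fdg6 /\
  family_maximal_noniso dihedral_param is_dihedral_fdg /\
  family_maximal_noniso dicyclic_param is_dicyclic_fdg /\
  family_maximal_noniso odd_param is_gen_dihedral_fdg /\
  family_maximal_noniso odd_param is_gen_dicyclic_fdg.
Proof.
split=> [X|].
  split=> [[per lX]|h]; last first.
    by have [fI [x half]] := in_list_half h; apply: lambda_half_intro half.
  have fI := bij_inj per; have [x half] := (lambda_half_cyc fI).1 lX.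
  exact: half_in_list half.
split; first exact: fdg1_maximal.
split; first exact: fdg2_maximal.
split.
  split=> [|X]; last exact: Z2xZ4_maximal.
  have [X /Z2xZ4_fdg_klein] := klein_exists (klein_param_deg1 (leqnn 1)).
  by exists X.
split; first exact: fdg4_not_maximal.
split; first exact: fdg5_not_maximal.
split; first exact: fdg6_maximal.
split; first exact: dihedral_family.
split; first exact: dicyclic_family.
(* For the exponents 0 and 1, [(r1 r2)^k] computes to 1 and [r1 r2], so [klein_rel] is convertible
   to the two stated relations. *)
split; first exact: (klein_family (leq0n 1)).
exact: (klein_family (leqnn 1)).
Qed.
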